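(* Let $\mathbb{B}$ be the classic Bargmann space of entire functions $\phi:\mathbb{C}\to\mathbb{C}$ with $\int_{\mathbb{C}}|\phi(z)|^{2}e^{-|z|^{2}}\,dx\,dy<\infty$. For $p\in\mathbb{N}=\{0,1,2,\dots\}$ let $$\mathbb{B}_p=\Big\{\phi\in\mathbb{B}:\ \tfrac{d^{j}\phi}{dz^{j}}(0)=0\ \text{ for all } 0\le j<p\Big\},$$ with orthonormal basis $e_n(z)=\frac{z^{n}}{\sqrt{n!}}$, $n=p,p+1,\dots$. Let $\mathbb{H}_p=z^{p}\frac{d^{p+1}}{dz^{p+1}}$ be the linear, unbounded, densely defined shift operator acting on $\mathbb{B}_p$ with domain $D(\mathbb{H}_p)=\{\phi\in\mathbb{B}:\mathbb{H}_p\phi\in\mathbb{B}\}\cap\mathbb{B}_p$, whose adjoint $\mathbb{H}_p^{*}$ in $\mathbb{B}_p$ is given by $\mathbb{H}_p^{*}e_n=\omega_{n,p}e_{n+1}$ for $n\ge p$, where $$\omega_{n,p}=\begin{cases}\sqrt{n+1}, & p=0,\\[2pt] \sqrt{n+1}\,\prod_{j=0}^{p-1}(n-j), & p\ge 1.\end{cases}$$ Then: (i) for all $p\ge 0$, $\mathbb{H}_p$ is chaotic; (ii) for all $p\ge 1$, $\mathbb{H}_p+\mathbb{H}_p^{*}$ is chaotic.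
   Context: The inner product on $\mathbb{B}$ (and on its closed subspaces $\mathbb{B}_p$) is $\langle\phi,\psi\rangle=\frac1\pi\int_{\mathbb{C}}\phi(z)\overline{\psi(z)}e^{-|z|^{2}}\,dx\,dy$, $z=x+iy$. Domains: an operator $\mathbb{A}$ on $\mathbb{X}$ given by a formal action carries the domain $D(\mathbb{A})=\{\phi\in\mathbb{X}:\mathbb{A}\phi\in\mathbb{X}\}$; powers have their natural domains $D(\mathbb{A}^{m})=\{\phi\in D(\mathbb{A}):\mathbb{A}\phi\in D(\mathbb{A}^{m-1})\}$, and $D(\mathbb{A}^{\infty})=\bigcap_{n\ge0}D(\mathbb{A}^{n})$. In particular, $\mathbb{H}_p+\mathbb{H}_p^{*}$ acts on $\phi=\sum_{n\ge p}a_ne_n\in\mathbb{B}_p$ formally by $\sum_{n\ge p}(\omega_{n,p}a_{n+1}+\omega_{n-1,p}a_{n-1})e_n$ (with the term in $a_{p-1}$ taken to be $0$), with domain the set of $\phi\in\mathbb{B}_p$ for which these coefficients are square-summable. Chaotic: a linear, unbounded, densely defined operator $\mathbb{A}$ on a Banach space $\mathbb{X}$ is chaotic if (1) $\mathbb{A}^{n}$ is closed for every positive integer $n$; (2) there is $\phi\in D(\mathbb{A}^{\infty})$ whose orbit $\{\phi,\mathbb{A}\phi,\mathbb{A}^{2}\phi,\dots\}$ is dense in $\mathbb{X}$; (3) the set of periodic points $\{\phi\in\mathbb{X}:\exists\, m\ge1,\ \phi\in D(\mathbb{A}^{m}),\ \mathbb{A}^{m}\phi=\phi\}$ is dense in $\mathbb{X}$.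 *)

(* Defs.v *)
From HB Require Import structures.
From mathcomp Require Import all_boot all_order all_algebra.
From mathcomp Require Import all_classical all_reals all_analysis.
From mathcomp Require Import complex.

Set Implicit Arguments.
Unset Strict Implicit.
Unset Printing Implicit Defensive.

Import Order.TTheory GRing.Theory Num.Theory numFieldNormedType.Exports.
Local Open Scope classical_set_scope.
Local Open Scope ring_scope.
Local Open Scope complex_scope.

(* R[i] as a normed space over itself, so that [derivable f z 1] and [f^`(n)]
   below are complex differentiability and complex derivatives. *)
HB.instance Definition _ (R : rcfType) := NormedModule.copy R[i] R[i]^o.

Section UnboundedOperators.
Variables (R : realType) (V : lmodType R[i]).

(* A normed space is a subset X of an ambient vector space V together with a
   function nrm : V -> R, of which only the values on X matter. *)
Implicit Types (X : set V) (nrm : V -> R).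

Definition is_subspace X :=
  X 0 /\ forall (a : R[i]) u v, X u -> X v -> X (a *: u + v).

Definition is_norm X nrm :=
  [/\ forall u, X u -> nrm u = 0 -> u = 0,
      forall (a : R[i]) u, X u -> nrm (a *: u) = Normc.normc a * nrm u
    & forall u v, X u -> X v -> nrm (u + v) <= nrm u + nrm v].

Definition cvg_in nrm (u : nat -> V) (l : V) :=
  (fun k => nrm (u k - l)) @ \oo --> (0 : R).

Definition cauchy_in nrm (u : nat -> V) :=
  forall eps : R, 0 < eps ->
    exists N, forall m n, (N <= m)%N -> (N <= n)%N -> nrm (u m - u n) < eps.

Definition is_complete X nrm :=
  forall u : nat -> V, (forall k, X (u k)) -> cauchy_in nrm u ->
    exists2 l, X l & cvg_in nrm u l.

Definition is_banach X nrm :=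
  [/\ is_subspace X, is_norm X nrm & is_complete X nrm].

Definition dense_in X nrm (S : set V) :=
  forall u, X u -> forall eps : R, 0 < eps ->
    exists v, [/\ X v, S v & nrm (v - u) < eps].

(* Only the values of [op_act] on [op_dom] are meaningful. *)
Record operator := Operator { op_dom : set V; op_act : V -> V }.

Implicit Type A : operator.

Fixpoint pow_dom X A (m : nat) : set V :=
  if m is m'.+1 then [set u | op_dom A u /\ pow_dom X A m' (op_act A u)]
  else X.

Definition pow_op X A (m : nat) : operator :=
  Operator (pow_dom X A m) (iter m (op_act A)).

Definition dom_infty X A : set V := \bigcap_(m in setT) op_dom (pow_op X A m).

Definition linear_operator X A :=
  [/\ op_dom A `<=` X,
      forall u, op_dom A u -> X (op_act A u),
      is_subspace (op_dom A)
    & forall (a : R[i]) u v, op_dom A u -> op_dom A v ->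
        op_act A (a *: u + v) = a *: op_act A u + op_act A v].

Definition unbounded_operator nrm A :=
  ~ exists M : R, forall u, op_dom A u -> nrm (op_act A u) <= M * nrm u.

Definition closed_operator X nrm A :=
  forall (u : nat -> V) (l l' : V),
    (forall k, op_dom A (u k)) -> X l -> X l' ->
    cvg_in nrm u l -> cvg_in nrm (fun k => op_act A (u k)) l' ->
    op_dom A l /\ op_act A l = l'.

Definition orbit_set A (u : V) : set V := range (fun n => iter n (op_act A) u).

Definition periodic_points X A : set V :=
  [set u | exists m, [/\ (1 <= m)%N, op_dom (pow_op X A m) u
                       & op_act (pow_op X A m) u = u]].

Definition chaotic X nrm A :=
  [/\ is_banach X nrm,
      [/\ linear_operator X A, unbounded_operator nrm A
        & dense_in X nrm (op_dom A)],
      forall n, (1 <= n)%N -> closed_operator X nrm (pow_op X A n),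
      exists2 u, dom_infty X A u & dense_in X nrm (orbit_set A u)
    & dense_in X nrm (periodic_points X A)].

End UnboundedOperators.

Section Bargmann.
Variable R : realType.
Local Notation C := R[i].
Local Notation mu2 := ((@lebesgue_measure R) \x (@lebesgue_measure R))%E.

Definition to_complex (w : R * R) : C := w.1 +i* w.2.

Definition gauss_weight (z : C) : R := expR (- Normc.normc z ^+ 2).

Definition entire (f : C -> C) := forall z, derivable f z 1.

Definition bargmann : set (C -> C) :=
  [set f | entire f /\
    (\int[mu2]_w (Normc.normc (f (to_complex w)) ^+ 2
                  * gauss_weight (to_complex w))%:E < +oo)%E].

Definition inner_integrand (f g : C -> C) (w : R * R) : C :=
  f (to_complex w) * conjc (g (to_complex w))
  * (gauss_weight (to_complex w))%:C.

Definition bargmann_inner (f g : C -> C) : C :=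
  (pi^-1)%:C *
  ((\int[mu2]_w complex.Re (inner_integrand f g w))%R
   +i* (\int[mu2]_w complex.Im (inner_integrand f g w))%R).

Definition bargmann_norm (f : C -> C) : R :=
  Num.sqrt (complex.Re (bargmann_inner f f)).

Definition bargmann_sub (p : nat) : set (C -> C) :=
  bargmann `&` [set f | forall j, (j < p)%N -> f^`(j)%classic 0 = 0].

Definition basis_fun (n : nat) (z : C) : C :=
  z ^+ n / (Num.sqrt (n`!%:R : R))%:C.

(* The product is empty, hence equal to 1, for p = 0. *)
Definition omega (n p : nat) : R :=
  Num.sqrt n.+1%:R * \prod_(0 <= j < p) (n%:R - j%:R).

Definition Hp_act (p : nat) (f : C -> C) (z : C) : C := z ^+ p * f^`(p.+1)%classic z.

Definition Hp (p : nat) : operator (C -> C) :=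
  Operator ([set f | bargmann f /\ bargmann (Hp_act p f)] `&` bargmann_sub p)
           (Hp_act p).

(* Since H_p e_(n+1) = omega_n e_n and H_p^* e_n = omega_n e_(n+1), the n-th
   coefficients of H_p f and H_p^* f, where f = \sum_(n >= p) a_n e_n. *)
Definition Hp_coef (p : nat) (f : C -> C) (n : nat) : C :=
  (omega n p)%:C * bargmann_inner f (basis_fun n.+1).

Definition Hp_star_coef (p : nat) (f : C -> C) (n : nat) : C :=
  if (p < n)%N then (omega n.-1 p)%:C * bargmann_inner f (basis_fun n.-1)
  else 0.

Definition Hp_sum_coef (p : nat) (f : C -> C) (n : nat) : C :=
  Hp_coef p f n + Hp_star_coef p f n.

Definition Hp_sum_act (p : nat) (f : C -> C) (z : C) : C :=
  limn (fun N => \sum_(p <= n < N) Hp_sum_coef p f n * basis_fun n z).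

(* H_p + H_p^* with its maximal domain, which may exceed the intersection
   of the domains of H_p and of its adjoint. *)
Definition Hp_sum (p : nat) : operator (C -> C) :=
  Operator
    [set f | bargmann_sub p f /\
      (\sum_(p <= n <oo) (Normc.normc (Hp_sum_coef p f n) ^+ 2)%:E < +oo)%E]
    (Hp_sum_act p).

End Bargmann.

(* Main.v *)
(* In the coordinates of the orthonormal basis [e_n], [n >= p], the operator H_p is
   the weighted backward shift and H_p + H_p^* the Jacobi matrix with the weights
   w_k = omega_(p+k,p), which are log-concave and, for p >= 1, of summable inverse.
   In both cases the formal kernel is spanned by a vector K in l^2, and the right
   inverse T vanishing at the 0-th coordinate is bounded and quasi-nilpotent
   (for the Jacobi matrix it is dominated by a Volterra operator). So the vectors
   K_i = T^i K are shifted backwards by the operator A and their norms decay faster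
   than any geometric sequence, whence sum_i c_i K_i converges for c_i = O(2^i):
   periodic c give periodic points, and concatenating all finite rational lists
   gives a dense orbit. Both conclusions need the span of the K_i to be dense. In
   the Jacobi case, T agrees with T^* up to the rank-two operator
   L (x) K - K (x) L, so T^* is symmetric and quasi-nilpotent on the complement of
   that span, which must therefore vanish. All powers of A are closed because
   A^m u = T A^(m+1) u + l_m(u) K with l_m continuous.

   That the e_n are an orthonormal basis of the Bargmann space uses Goursat's
   theorem, carried out in the coordinate s with zeta = exp s to reach the Taylor
   expansion of an entire f, and the rotation invariance of the Gaussian measure:
   averages of |f|^2 over the N-th roots of unity tend to sum_n |a_n|^2 |z|^(2n),
   and Fatou's lemma gives both inequalities. *)

Require Import Defs.
From mathcomp Require Import all_boot all_order all_algebra.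
From mathcomp Require Import all_classical all_reals all_analysis.
From mathcomp Require Import complex ring lra zify measurable_realfun.

Set Implicit Arguments.
Unset Strict Implicit.
Unset Printing Implicit Defensive.

Import Order.TTheory GRing.Theory Num.Theory numFieldNormedType.Exports.
Local Open Scope classical_set_scope.
Local Open Scope ring_scope.
Local Open Scope complex_scope.

(** For p = 0 the weights are sqrt(k+1), whose inverses are not summable. From p = 1 on, summable
    inverses and log-concavity together put every solution of the Jacobi recurrence in l^2.
    Closedness of A alone does not give closedness of A^n, since the intermediate iterates along a
    graph-convergent sequence need not converge; T controls them. As T vanishes at coordinate 0 and
    K has 1 there, l_m(u) is the 0-th coordinate of A^m u, a finite combination of coordinates of u.
    The growth class 2^i contains all bounded sequences and is shift-invariant up to a factor 2.
    With norms of K_i at most D 8^-i the terms are O(4^-i), which beats the factor 2^n lost after n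
    shifts. On the analytic side the Cauchy expansion is made for a primitive F of f: the quotient
    (F w - F z)/(w - z) is differentiable at w = z by a second-order expansion of F that needs only
    f'(z), whereas the quotient of f itself would call for f'' beforehand. Differentiating the
    series of F then gives f. *)

Local Notation normc := Normc.normc.

(** * Normed subspaces *)

Section Normc.
Variable R : realType.
Implicit Types z w : R[i].

Lemma normc_ge0 z : 0 <= normc z.
Proof. by case: z => x y; rewrite /= sqrtr_ge0. Qed.

Lemma normcD z w : normc (z + w) <= normc z + normc w.
Proof. exact: le_normcD. Qed.

Lemma normcNE z : normc (- z) = normc z.
Proof. exact: normcN. Qed.

Lemma normc_distC z w : normc (z - w) = normc (w - z).
Proof. by rewrite -normcNE opprB. Qed.

Lemma normcX z n : normc (z ^+ n) = normc z ^+ n.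
Proof.
by elim: n => [|n IH]; rewrite ?expr0 ?Normc.normc1// !exprS Normc.normcM IH.
Qed.

Lemma normcR (x : R) : normc (x%:C) = `|x|.
Proof. by rewrite /= expr0n /= addr0 sqrtr_sqr. Qed.

Lemma normc_sum (I : Type) (r : seq I) (P : pred I) (F : I -> R[i]) :
  normc (\sum_(i <- r | P i) F i) <= \sum_(i <- r | P i) normc (F i).
Proof.
elim/big_rec2: _ => [|i x y _ h]; first by rewrite Normc.normc0.
by rewrite (le_trans (normcD _ _))// lerD2l.
Qed.

Lemma normc_Re z : `|complex.Re z| <= normc z.
Proof.
by case: z => x y /=; rewrite -sqrtr_sqr ler_wsqrtr// lerDl sqr_ge0.
Qed.

Lemma normc_Im z : `|complex.Im z| <= normc z.
Proof.
by case: z => x y /=; rewrite -sqrtr_sqr ler_wsqrtr// lerDr sqr_ge0.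
Qed.

Lemma normc_le_ReIm z : normc z <= `|complex.Re z| + `|complex.Im z|.
Proof.
case: z => x y /=.
rewrite -[leRHS]ger0_norm ?addr_ge0// -sqrtr_sqr ler_wsqrtr//.
rewrite sqrrD !real_normK ?num_real//.
by rewrite -addrA lerD2l lerDr mulrn_wge0// mulr_ge0.
Qed.

Lemma normc_sqr z : normc z ^+ 2 = complex.Re z ^+ 2 + complex.Im z ^+ 2.
Proof. by case: z => x y /=; rewrite sqr_sqrtr// addr_ge0 ?sqr_ge0. Qed.

Lemma geometric_small (C r eps : R) : 0 <= r < 1 -> 0 < eps ->
  exists N, forall n, (N <= n)%N -> C * r ^+ n < eps.
Proof.
move=> /andP[r0 r1] e0.
have : (fun n => C * r ^+ n) @ \oo --> (0 : R).
  rewrite -(mulr0 C); apply: cvgMr; apply: cvg_expr; rewrite ger0_norm//.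
move=> /cvgrPdist_lt /(_ _ e0) [N _ h]; exists N => n /h /=.
by rewrite sub0r normrN; apply: le_lt_trans; exact: ler_norm.
Qed.

Lemma complex_rat_dense z (eps : R) : 0 < eps ->
  exists q : rat * rat, normc (z - (ratr q.1 +i* ratr q.2)) < eps.
Proof.
move=> e0; case: z => x y.
have h (t : R) : exists q : rat, `|t - ratr q| < eps / 2.
  have [q] := @rat_in_itvoo R (t - eps / 2) (t + eps / 2) ltac:(lra).
  rewrite in_itv /= => /andP[h1 h2]; exists q.
  by rewrite ltr_norml; apply/andP; split; lra.
have [q1 h1] := h x; have [q2 h2] := h y.
exists (q1, q2).
apply: le_lt_trans (normc_le_ReIm _) _; rewrite (splitr eps).
exact: ltrD h1 h2.
Qed.

End Normc.

Section NormedSubspace.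
Variables (R : realType) (V : lmodType R[i]) (X : set V) (nrm : V -> R).
Hypotheses (subX : is_subspace X) (nrmX : is_norm X nrm).

Lemma sub0 : X 0. Proof. by case: subX. Qed.

Lemma subD u v : X u -> X v -> X (u + v).
Proof. by move=> xu xv; have := subX.2 1 _ _ xu xv; rewrite scale1r. Qed.

Lemma subZ a u : X u -> X (a *: u).
Proof. by move=> xu; have := subX.2 a _ _ xu sub0; rewrite addr0. Qed.

Lemma subN u : X u -> X (- u).
Proof. by move=> xu; rewrite -scaleN1r; exact: subZ. Qed.

Lemma subB u v : X u -> X v -> X (u - v).
Proof. by move=> xu xv; apply: subD => //; exact: subN. Qed.

Lemma sub_sum (I : Type) (r : seq I) (P : pred I) (F : I -> V) :
  (forall i, X (F i)) -> X (\sum_(i <- r | P i) F i).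
Proof.
by move=> h; elim/big_rec: _ => [|i x _ hx]; [exact: sub0|exact: subD].
Qed.

Lemma nrmZ a u : X u -> nrm (a *: u) = normc a * nrm u.
Proof. by case: nrmX => _ + _; apply. Qed.

Lemma nrmD u v : X u -> X v -> nrm (u + v) <= nrm u + nrm v.
Proof. by case: nrmX => _ _; apply. Qed.

Lemma nrm_eq0 u : X u -> nrm u = 0 -> u = 0.
Proof. by case: nrmX => + _ _; apply. Qed.

Lemma nrm0 : nrm 0 = 0.
Proof. by rewrite -(scale0r 0) nrmZ ?Normc.normc0 ?mul0r//; exact: sub0. Qed.

Lemma nrmN u : X u -> nrm (- u) = nrm u.
Proof.
by move=> xu; rewrite -scaleN1r nrmZ// normcNE Normc.normc1 mul1r.
Qed.

(** [is_norm] does not postulate nonnegativity; the triangle inequality for u and -u yields 0 <= 2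
    ||u||. *)
Lemma nrm_ge0 u : X u -> 0 <= nrm u.
Proof.
move=> xu; have := nrmD xu (subN xu); rewrite subrr nrm0 nrmN//; lra.
Qed.

Lemma nrm_distC u v : X u -> X v -> nrm (u - v) = nrm (v - u).
Proof. by move=> xu xv; rewrite -nrmN ?opprB//; exact: subB. Qed.

Lemma nrm_sum (I : Type) (r : seq I) (P : pred I) (F : I -> V) :
  (forall i, X (F i)) ->
  nrm (\sum_(i <- r | P i) F i) <= \sum_(i <- r | P i) nrm (F i).
Proof.
move=> h; suff : X (\sum_(i <- r | P i) F i) /\
    nrm (\sum_(i <- r | P i) F i) <= \sum_(i <- r | P i) nrm (F i) by case.
elim/big_rec2: _ => [|i x y _ [xy hy]]; first by rewrite nrm0; split=> //; exact: sub0.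
split; first exact: subD.
by rewrite (le_trans (nrmD _ _))// lerD2l.
Qed.

Lemma nrm_dist_trans u v w : X u -> X v -> X w ->
  nrm (u - w) <= nrm (u - v) + nrm (v - w).
Proof.
by move=> *; rewrite -(subrKA v u) nrmD//; exact: subB.
Qed.

Lemma cvg_inP (u : nat -> V) l : (forall k, X (u k)) -> X l ->
  cvg_in nrm u l <->
  forall eps, 0 < eps -> exists N, forall k, (N <= k)%N -> nrm (u k - l) < eps.
Proof.
move=> xu xl; split.
  move=> /cvgrPdist_lt h eps e0; have [N _ hN] := h _ e0.
  exists N => k /hN /=; rewrite sub0r normrN; apply: le_lt_trans; exact: ler_norm.
move=> h; apply/cvgrPdist_lt => eps e0; have [N hN] := h _ e0.
exists N => // k /= /hN; rewrite sub0r normrN ger0_norm//.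
by apply: nrm_ge0; exact: subB.
Qed.

Lemma cvg_in_unique (u : nat -> V) l l' : (forall k, X (u k)) -> X l -> X l' ->
  cvg_in nrm u l -> cvg_in nrm u l' -> l = l'.
Proof.
move=> xu xl xl' /(cvg_inP xu xl) h /(cvg_inP xu xl') h'.
apply/eqP; rewrite -subr_eq0; apply/eqP/nrm_eq0; first exact: subB.
apply/eqP; rewrite eq_le nrm_ge0 ?andbT; last exact: subB.
rewrite leNgt; apply/negP => /[dup] p0 /(fun x => divr_gt0 x (ltr0Sn _ 1)) e0.
have [N hN] := h _ e0; have [N' hN'] := h' _ e0.
have := hN (maxn N N') (leq_maxl _ _); have := hN' (maxn N N') (leq_maxr _ _).
have := nrm_dist_trans xl (xu (maxn N N')) xl'.
rewrite (nrm_distC xl (xu _)); lra.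
Qed.

Lemma cvg_in_scalar (a : nat -> R[i]) (b : R[i]) v : X v ->
  (fun k => normc (a k - b)) @ \oo --> (0 : R) ->
  cvg_in nrm (fun k => a k *: v) (b *: v).
Proof.
move=> xv h; rewrite /cvg_in.
under eq_fun do rewrite -scalerBl nrmZ//.
by rewrite -(mul0r (nrm v)); apply: cvgMl.
Qed.

Lemma cvg_in_add (u v : nat -> V) l l' :
  (forall k, X (u k)) -> (forall k, X (v k)) -> X l -> X l' ->
  cvg_in nrm u l -> cvg_in nrm v l' -> cvg_in nrm (fun k => u k + v k) (l + l').
Proof.
move=> xu xv xl xl' h h'.
apply: (@squeeze_cvgr _ _ _ _ (fun=> 0) (fun k => nrm (u k - l) + nrm (v k - l'))).
- apply: nearW => k; rewrite opprD addrACA.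
  rewrite nrm_ge0 ?nrmD//; try exact: subB.
  by apply: subD; exact: subB.
- exact: cvg_cst.
- by rewrite -[X in _ --> X](addr0 0); exact: cvgD.
Qed.

End NormedSubspace.

(** * A criterion for chaos *)

Section ChaosCriterion.
Variables (R : realType) (V : lmodType R[i]) (X : set V) (nrm : V -> R).
Variables (A : operator V) (K : nat -> V) (T : V -> V) (l : nat -> V -> R[i]).
Hypotheses (banX : is_banach X nrm) (linA : linear_operator X A).
Hypothesis clA : closed_operator X nrm A.
Hypothesis domK : forall i, op_dom A (K i).
Hypothesis AK0 : op_act A (K 0) = 0.
Hypothesis AKS : forall i, op_act A (K i.+1) = K i.
Hypothesis K0_neq0 : K 0 != 0.
Hypothesis decK : forall r : R, 0 < r ->
  exists C, forall i, nrm (K i) <= C * r ^+ i.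
Hypothesis denK : dense_in X nrm
  [set u | exists n (c : nat -> R[i]), u = \sum_(i < n) c i *: K i].
Hypothesis domT : forall f, X f -> op_dom A (T f).
Hypothesis AT : forall f, X f -> op_act A (T f) = f.
Hypothesis T_bounded : exists M, forall f, X f -> nrm (T f) <= M * nrm f.
Hypothesis TB : forall f g, X f -> X g -> T (f - g) = T f - T g.
Hypothesis l_cont : forall m (u : nat -> V) u0, (forall k, X (u k)) -> X u0 ->
  cvg_in nrm u u0 ->
  (fun k => normc (l m (u k) - l m u0)) @ \oo --> (0 : R).
Hypothesis lA : forall m u, pow_dom X A m.+1 u ->
  iter m (op_act A) u = T (iter m.+1 (op_act A) u) + l m u *: K 0.

Let subX : is_subspace X. Proof. by case: banX. Qed.
Let nrmX : is_norm X nrm. Proof. by case: banX. Qed.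
Let subdom : is_subspace (op_dom A). Proof. by case: linA. Qed.
Let dom_sub u : op_dom A u -> X u. Proof. by case: linA => + _ _ _; apply. Qed.
Let actX u : op_dom A u -> X (op_act A u).
Proof. by case: linA => _ + _ _; apply. Qed.
Let XK i : X (K i). Proof. exact: dom_sub. Qed.

Let actD a u v : op_dom A u -> op_dom A v ->
  op_act A (a *: u + v) = a *: op_act A u + op_act A v.
Proof. by case: linA => _ _ _; apply. Qed.

(** Since A^i K_i = K_0, a bound M' >= 1 for A would give ||K_0|| <= M'^i ||K_i||, against the decay
    of the K_i at rate 1/(2 M'). *)
Lemma criterion_unbounded : unbounded_operator nrm A.
Proof.
move=> [M hM].
pose M' := Num.max M 1.
have M'1 : 1 <= M' by rewrite le_max lexx orbT.
have M'0 : 0 < M' by lra.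
have step i : nrm (K i) <= M' * nrm (K i.+1).
  rewrite -AKS; apply: le_trans (hM _ (domK _)) _.
  by rewrite ler_wpM2r ?(nrm_ge0 subX nrmX)// le_max lexx.
have step' i : nrm (K 0) <= M' ^+ i * nrm (K i).
  elim: i => [|i IH]; first by rewrite expr0 mul1r.
  apply: le_trans IH _; rewrite exprSr -mulrA ler_wpM2l//.
  by rewrite exprn_ge0// ltW.
have rp : 0 < (2 * M')^-1 by rewrite invr_gt0; lra.
have [C hC] := decK rp.
have K0 : 0 < nrm (K 0).
  rewrite lt_def (nrm_ge0 subX nrmX)// andbT.
  by apply: contra_neq K0_neq0; exact: (nrm_eq0 nrmX).
have [N hN] := @geometric_small R C 2^-1 _ ltac:(lra) K0.
have := hN N (leqnn N); rewrite ltNge => /negP; apply.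
apply: le_trans (step' N) _.
apply: le_trans (ler_wpM2l _ (hC N)) _; first by rewrite exprn_ge0// ltW.
have MM : M' ^+ N * M'^-1 ^+ N = 1 by rewrite -exprMn divff ?expr1n// gt_eqF.
by rewrite invfM exprMn mulrCA [X in C * X <= _]mulrCA MM mulr1.
Qed.

Lemma criterion_dense_dom : dense_in X nrm (op_dom A).
Proof.
move=> u xu e e0; have [v [xv [n [c vE]] h]] := denK xu e0.
by exists v; split=> //; rewrite vE; apply: sub_sum => // i; exact: subZ.
Qed.

(** [pow_dom] peels off the first application of A; the induction on powers needs the last one. *)
Lemma pow_domSr m u : pow_dom X A m.+1 u <->
  pow_dom X A m u /\ op_dom A (iter m (op_act A) u).
Proof.
elim: m u => [|m IH] u.
  split=> [[du _]|[_ du]]; split=> //=; [exact: dom_sub|exact: actX].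
split=> [[du /IH[h1 h2]]|[[du h1] h2]]; split=> //; first by rewrite iterSr.
by apply/IH; split=> //; rewrite -iterSr.
Qed.

Lemma pow_dom_sub m u : pow_dom X A m u -> X u.
Proof. by case: m => //= m [/dom_sub]. Qed.

Lemma pow_act_sub m u : pow_dom X A m u -> X (iter m (op_act A) u).
Proof.
elim: m u => [|m IH] u //= [du /IH]; by rewrite -iterSr.
Qed.

Lemma criterion_closed n : closed_operator X nrm (pow_op X A n).
Proof.
elim: n => [|n IH] u v v' /= hdom xv xv' hv hv'.
  by split=> //; apply: (cvg_in_unique subX nrmX _ xv xv' hv hv') => k; exact: hdom.
have hdom' k : pow_dom X A n.+1 (u k) := hdom k.
have xu k : X (u k) by exact: pow_dom_sub (hdom' k).
have xAu k : X (iter n.+1 (op_act A) (u k)) by exact: pow_act_sub (hdom' k).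
have xT f : X f -> X (T f) by move=> /domT /dom_sub.
(* By [lA] this is the limit of the n-th iterates, so the induction hypothesis applies to the n-th
   power. It lies in the domain of A because [T v'] and [K 0] do. *)
set g := T v' + l n v *: K 0.
have xlK a : X (a *: K 0) by exact: subZ.
have cg : cvg_in nrm (fun k => iter n (op_act A) (u k)) g.
  have -> : (fun k => iter n (op_act A) (u k)) =
            (fun k => T (iter n.+1 (op_act A) (u k)) + l n (u k) *: K 0).
    by apply/funext => k; exact: lA.
  apply: (cvg_in_add subX nrmX) => //; [by move=> k; exact: xT|exact: xT| |].
  - have [M hM] := T_bounded.
    apply: (@squeeze_cvgr _ _ _ _ (fun=> 0)
      (fun k => M * nrm (iter n.+1 (op_act A) (u k) - v'))).
    + apply: nearW => k; rewrite (nrm_ge0 subX nrmX) ?andTb; last exact: subB (xT _ _) (xT _ _).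
      by rewrite -TB// hM//; exact: subB.
    + exact: cvg_cst.
    + by rewrite -(mulr0 M); apply: cvgMr.
  - exact: (cvg_in_scalar nrmX (XK 0) (l_cont n xu xv hv)).
have xg : X g by apply: subD => //; exact: xT.
have [dv Av] := IH u v g (fun k => proj1 ((pow_domSr n (u k)).1 (hdom' k))) xv xg hv cg.
have /= Av' : iter n (op_act A) v = g by exact: Av.
have dg : op_dom A g.
  by rewrite /g addrC; case: subdom => _; apply=> //; exact: domT.
split; first by apply/(pow_domSr n v); split=> //; rewrite Av'.
by rewrite Av' /g addrC actD ?AK0 ?scaler0 ?add0r ?AT//; exact: domT.
Qed.

Let series_K (c : nat -> R[i]) n := \sum_(i < n) c i *: K i.

(* Sequences dominated by [2 ^ i] are stable under the backward shift, which
   [A] represents on [\sum_i c i *: K i]. *)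
Definition growth2 (C : R) (c : nat -> R[i]) :=
  forall i, normc (c i) <= C * 2 ^+ i.

(** x is the sum of the c_i K_i. The rate is recorded besides the convergence because both density
    arguments estimate the tail: terms are at most C D 4^-i when ||K_i|| <= D 8^-i, and 2 bounds the
    geometric factor 4/3. *)
Let represents (D C : R) c x := [/\ growth2 C c, X x
  & forall n, nrm (x - series_K c n) <= C * (2 * D) * 4^-1 ^+ n].

Let XsK c n : X (series_K c n).
Proof. by apply: sub_sum => // i; exact: subZ. Qed.

Let domsK c n : op_dom A (series_K c n).
Proof. by apply: sub_sum => // i; exact: subZ. Qed.

Let act_sum n (c : nat -> R[i]) :
  op_act A (series_K c n.+1) = series_K (fun i => c i.+1) n.
Proof.
elim: n => [|n IH].
  rewrite /series_K big_ord_recl !big_ord0 /= actD//; last by case: subdom.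
  have -> : op_act A 0 = 0.
    have d0 : op_dom A 0 by case: subdom.
    by have := actD (-1) d0 d0; rewrite scaler0 addr0 scaleN1r addNr.
  by rewrite AK0 scaler0 add0r.
have recS d k : series_K d k.+1 = d k *: K k + series_K d k.
  by rewrite addrC /series_K big_ord_recr.
by rewrite recS actD// IH AKS [RHS]recS.
Qed.

Section WithDecay.
Variable D : R.
Hypothesis hD : forall i, nrm (K i) <= D * 8^-1 ^+ i.

Let D0 : 0 <= D.
Proof. by have := hD 0; have := nrm_ge0 subX nrmX (XK 0); rewrite expr0; lra. Qed.

(** The telescoping bound makes the induction immediate: one more term costs at most C D 4^-k, while
    the right-hand side gains 2 C D (4^-k - 4^-(k+1)) = (3/2) C D 4^-k. *)
Let series_K_dist C c m n : growth2 C c ->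
  nrm (series_K c (m + n) - series_K c m) <=
  C * (2 * D) * (4^-1 ^+ m - 4^-1 ^+ (m + n)).
Proof.
move=> hc.
have C0 : 0 <= C by have := hc 0; have := normc_ge0 (c 0); rewrite expr0; lra.
elim: n => [|n IH]; first by rewrite addn0 !subrr mulr0 (nrm0 subX nrmX).
rewrite addnS {1}/series_K big_ord_recr /= -/(series_K c (m + n)) addrAC.
apply: le_trans (nrmD nrmX _ _) _; [exact: subB|exact: subZ|].
apply: le_trans (lerD IH (lexx _)) _.
rewrite (nrmZ nrmX)//.
have h : normc (c (m + n)%N) * nrm (K (m + n)) <= C * D * 4^-1 ^+ (m + n).
  apply: le_trans (ler_pM (normc_ge0 _) (nrm_ge0 subX nrmX (XK _)) (hc _) (hD _)) _.
  rewrite mulrACA -exprMn (_ : 2 * 8^-1 = 4^-1)//; lra.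
apply: le_trans (lerD (lexx _) h) _.
have p : 0 <= C * D * 4^-1 ^+ (m + n).
  by rewrite mulr_ge0 ?mulr_ge0// exprn_ge0; lra.
rewrite exprS; move: p; set y := 4^-1 ^+ (m + n); lra.
Qed.

Let represents_ex C c : growth2 C c -> exists x, represents D C c x.
Proof.
move=> hc.
have C0 : 0 <= C by have := hc 0; have := normc_ge0 (c 0); rewrite expr0; lra.
have q0 n : 0 <= (4^-1 : R) ^+ n by rewrite exprn_ge0; lra.
have dist m n : (m <= n)%N ->
    nrm (series_K c n - series_K c m) <= C * (2 * D) * 4^-1 ^+ m.
  move=> mn; rewrite -(subnKC mn); apply: le_trans (series_K_dist _ _ hc) _.
  by rewrite ler_wpM2l ?mulr_ge0// gerBl.
have cau : cauchy_in nrm (series_K c).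
  move=> e e0.
  have [N hN] := @geometric_small R (C * (2 * D)) 4^-1 e ltac:(lra) e0.
  exists N => m n Nm Nn.
  wlog mn : m n Nm Nn / (n <= m)%N.
    move=> W; case/orP: (leq_total n m) => h; first exact: W.
    by rewrite (nrm_distC subX nrmX)//; exact: W.
  exact: le_lt_trans (dist _ _ mn) (hN _ Nn).
have [x xx hx] : exists2 x, X x & cvg_in nrm (series_K c) x by case: banX => _ _; apply.
exists x; split=> // n.
apply/ler_addgt0Pr => e e0.
have [N hN] := (cvg_inP subX nrmX (XsK c) xx).1 hx _ e0.
have h1 := hN (maxn N n) (leq_maxl _ _).
have h2 := dist _ _ (leq_maxr N n).
have := nrm_dist_trans subX nrmX xx (XsK c (maxn N n)) (XsK c n).
rewrite (nrm_distC subX nrmX xx (XsK c (maxn N n))); lra.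
Qed.

Let represents_cvg C c x : represents D C c x -> cvg_in nrm (series_K c) x.
Proof.
case=> hc xx hx; apply/(cvg_inP subX nrmX (XsK c) xx) => e e0.
have [N hN] := @geometric_small R (C * (2 * D)) 4^-1 e ltac:(lra) e0.
exists N => k /hN; apply: le_lt_trans.
by rewrite (nrm_distC subX nrmX).
Qed.

(** Closedness of A: it sends the partial sums of x to partial sums, one term shorter, of the
    shifted series, and both sides converge. *)
Let represents_shift C c x y : represents D C c x ->
  represents D (2 * C) (fun i => c i.+1) y -> op_dom A x /\ op_act A x = y.
Proof.
move=> hx hy.
have [_ xx _] := hx; have [_ xy _] := hy.
apply: (clA (u := fun n => series_K c n.+1)) => //.
  have := represents_cvg hx.
  by rewrite /cvg_in -(cvg_shiftS (fun n => nrm (series_K c n - x))).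
under eq_fun do rewrite act_sum.
exact: represents_cvg hy.
Qed.

Let represents_shiftn n C c x : represents D C c x ->
  pow_dom X A n x /\
  represents D (2 ^+ n * C) (fun i => c (n + i)%N) (iter n (op_act A) x).
Proof.
elim: n C c x => [|n IH] C c x hx.
  by rewrite expr0 mul1r; split=> //; case: hx.
have hc' : growth2 (2 * C) (fun i => c i.+1).
  by case: hx => hc _ _ i; have := hc i.+1; rewrite exprS; lra.
have [y hy] := represents_ex hc'.
have [dx Axy] := represents_shift hx hy.
have [h1 h2] := IH _ _ _ hy.
split; first by split=> //; rewrite Axy.
by rewrite iterSr Axy exprSr -mulrA.
Qed.

Let represents_unique C C' c x x' :
  represents D C c x -> represents D C' c x' -> x = x'.
Proof.
move=> h h'; have [_ xx _] := h; have [_ xx' _] := h'.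
exact: (cvg_in_unique subX nrmX (XsK c) xx xx' (represents_cvg h) (represents_cvg h')).
Qed.

(** A finite combination of the K_i has its coefficient list padded with zeros to a length m and
    repeated with period m. The resulting point is fixed by A^m and differs from the combination
    only by the tail beyond m. *)
Lemma criterion_periodic_decay : dense_in X nrm (periodic_points X A).
Proof.
move=> u xu e e0.
have e20 : 0 < e / 2 by lra.
have [v [xv [N [c vE]] hv]] := denK xu e20.
pose C := \sum_(i < N) normc (c i).
have C0 : 0 <= C by apply: sumr_ge0 => i _; exact: normc_ge0.
pose c0 i := if (i < N)%N then c i else 0.
have c0C i : normc (c0 i) <= C.
  rewrite /c0; case: ifPn => [iN|_]; last by rewrite Normc.normc0.
  rewrite /C (bigD1 (Ordinal iN))//= lerDl.
  by apply: sumr_ge0 => j _; exact: normc_ge0.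
have [M hM] := @geometric_small R (C * (2 * D)) 4^-1 (e / 2) ltac:(lra) e20.
(* N leaves room for the list, M makes the tail small, and 1 makes m an admissible period when the
   list is empty. *)
pose m := maxn (maxn N M) 1.
have [Nm Mm m1] : [/\ N <= m, M <= m & 1 <= m]%N by rewrite /m; split; lia.
pose cm i := c0 (i %% m)%N.
have gcm : growth2 C cm.
  move=> i; apply: le_trans (c0C _) _; rewrite ler_peMr// exprn_ege1//; lra.
have [x hx] := represents_ex gcm.
have [dx hAx] := represents_shiftn m hx.
have cmE : (fun i => cm (m + i)%N) = cm.
  by apply/funext => i; rewrite /cm modnDl.
rewrite cmE in hAx.
have [_ xx hxm] := hx.
exists x; split=> //.
  by exists m; split=> //; exact: represents_unique hAx hx.
have sE : series_K cm m = v.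
  rewrite vE /series_K -!(big_mkord xpredT (fun i => _ i *: K i)).
  rewrite (big_cat_nat _ Nm)//= [X in _ + X]big_nat_cond [X in _ + X]big1; last first.
    move=> i /andP[/andP[h1 h2] _].
    by rewrite /cm modn_small// /c0 ltnNge h1 scale0r.
  rewrite addr0; apply: eq_big_nat => i /andP[_ iN].
  by rewrite /cm modn_small ?(leq_trans iN)// /c0 iN.
have := nrm_dist_trans subX nrmX xx xv xu.
by have := hxm m; rewrite sE; have := hM m Mm; lra.
Qed.

(* Position [2 ^ k + i] with [i < 2 ^ k] carries the [i]-th entry of the list
   of Gaussian rationals coded by the 2-adic valuation of [k], so that every list
   occurs at infinitely many places. *)
Definition hypercyclic_coefs (i : nat) : R[i] :=
  let k := trunc_log 2 i in
  let s := odflt [::] (unpickle (logn 2 k) : option (seq (rat * rat))) in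
  let q := nth (0, 0) s (i - 2 ^ k) in
  let z : R[i] := ratr q.1 +i* ratr q.2 in
  if normc z <= 2 ^+ i then z else 0.

Let growth2_hypercyclic : growth2 1 hypercyclic_coefs.
Proof.
move=> i; rewrite mul1r /hypercyclic_coefs.
case: ifPn => // _; by rewrite Normc.normc0 exprn_ge0.
Qed.

(** Far enough out, the cut-off at 2^i in [hypercyclic_coefs] is inactive on the entries of s, which
    are all bounded by B. Indices past the end of s read the default (0, 0), so s is followed by
    zeros up to the end of its block. *)
Let hypercyclic_coefsE (s : seq (rat * rat)) (M : nat) : exists k, (M <= k)%N /\
  forall i, (i < 2 ^ k)%N -> hypercyclic_coefs (2 ^ k + i) =
    ratr (nth (0, 0) s i).1 +i* ratr (nth (0, 0) s i).2.
Proof.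
pose B := \sum_(q <- s) normc (ratr q.1 +i* ratr q.2 : R[i]).
have [M' hM'] : exists M', forall n, (M' <= n)%N -> B * 2^-1 ^+ n < 1.
  by apply: geometric_small; lra.
pose a := pickle s.
pose k := (2 ^ a * (2 * (M + M')).+1)%N.
have kM : (M + M' <= k)%N.
  rewrite /k; apply: leq_trans (leq_pmull _ _); [lia|by rewrite expn_gt0].
have k0 : (0 < k)%N by rewrite /k muln_gt0 expn_gt0.
have lk : logn 2 k = a.
  rewrite /k lognM ?expn_gt0// pfactorK// lognE /=.
  by rewrite dvdn2 /= mul2n odd_double /= addn0.
exists k; split; first lia.
move=> i ik; rewrite /hypercyclic_coefs.
have -> : trunc_log 2 (2 ^ k + i) = k.
  by apply: trunc_log_eq => //; rewrite leq_addr /= expnS mul2n -addnn ltn_add2l.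
rewrite lk /a pickleK /= addKn ifT//.
have B0 : 0 <= B by apply: sumr_ge0 => q _; exact: normc_ge0.
have h : normc (ratr (nth (0, 0) s i).1 +i* ratr (nth (0, 0) s i).2 : R[i]) <= B.
  case: (ltnP i (size s)) => h; last first.
    by rewrite nth_default//= raddf0 expr0n /= addr0 sqrtr0.
  rewrite /B (big_rem (nth (0,0) s i)) ?mem_nth//= lerDl.
  by apply: sumr_ge0 => q _; exact: sqrtr_ge0.
apply: le_trans h _.
have /hM' h1 : (M' <= 2 ^ k + i)%N.
  by have := ltn_expl k (isT : 1 < 2)%N; lia.
have p : 0 < (2 : R) ^+ (2 ^ k + i) by rewrite exprn_gt0//; lra.
by move: h1; rewrite exprVn ltr_pdivrMr// mul1r => /ltW.
Qed.

(** After n = 2^k shifts the growth constant has become 2^n, but the first n coefficients are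
    exactly the chosen list followed by zeros, so the remainder is at most 2^n (2 D) 4^-n = 2 D
    2^-n. This is why a block is as long as the index at which it starts. *)
Lemma criterion_hypercyclic_decay :
  exists2 u, dom_infty X A u & dense_in X nrm (orbit_set A u).
Proof.
have [x hx] := represents_ex growth2_hypercyclic.
exists x; first by move=> n _; case: (represents_shiftn n hx).
move=> u xu e e0.
have e30 : 0 < e / 3 by lra.
have [v [xv [N [c vE]] hv]] := denK xu e30.
pose S := \sum_(i < N) nrm (K i).
have S0 : 0 <= S by apply: sumr_ge0 => i _; exact: (nrm_ge0 subX nrmX).
(* Rounding each c_i within this distance moves the combination by at most e/3; the +1 guards
   against S = 0. *)
have d0 : 0 < (e / 3) / (S + 1) by rewrite divr_gt0//; lra.
have [q hq] := choice (fun i => complex_rat_dense (c i) d0).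
pose s := mkseq q N.
pose z i : R[i] := ratr (nth (0, 0) s i).1 +i* ratr (nth (0, 0) s i).2.
have [M hM] := @geometric_small R (2 * D) 2^-1 (e / 3) ltac:(lra) e30.
have [k [kM hk]] := hypercyclic_coefsE s (maxn N M).
pose n := (2 ^ k)%N.
have kn : (k < n)%N by exact: ltn_expl.
have [dx [_ xAx hAx]] := represents_shiftn n hx.
exists (iter n (op_act A) x); split=> //; first by exists n.
have sE : series_K (fun i => hypercyclic_coefs (n + i)) n = \sum_(i < N) z i *: K i.
  rewrite /series_K -!(big_mkord xpredT (fun i => _ i *: K i)).
  rewrite -(big_mkord xpredT (fun i => hypercyclic_coefs (n + i) *: K i)).
  have Nn : (N <= n)%N by lia.
  rewrite (big_cat_nat _ Nn)//= [X in _ + X]big_nat_cond [X in _ + X]big1; last first.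
    move=> i /andP[/andP[h1 h2] _].
    by rewrite hk// nth_default ?size_mkseq//= raddf0 scale0r.
  rewrite addr0; apply: eq_big_nat => i /andP[_ iN].
  by rewrite hk// (leq_trans iN).
have hv' : nrm (\sum_(i < N) z i *: K i - v) <= e / 3.
  rewrite vE -sumrB.
  apply: le_trans (nrm_sum subX nrmX _ _ _) _.
    by move=> i; apply: subB => //; exact: subZ.
  apply: (@le_trans _ _ (\sum_(i < N) (e / 3) / (S + 1) * nrm (K i))).
    apply: ler_sum => i _; rewrite -scalerBl (nrmZ nrmX)//.
    rewrite ler_wpM2r ?(nrm_ge0 subX nrmX)// normc_distC ltW//.
    by rewrite /z nth_mkseq.
  rewrite -mulr_sumr -/S -mulrA ler_piMr//; first lra.
  by rewrite mulrC ler_pdivrMr; lra.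
have xs : X (\sum_(i < N) z i *: K i) by apply: sub_sum => // i; exact: subZ.
have := hAx n; rewrite sE mulr1 => h.
have h' : nrm (iter n (op_act A) x - \sum_(i < N) z i *: K i) < e / 3.
  apply: le_lt_trans h _.
  have -> : 2 ^+ n * (2 * D) * 4^-1 ^+ n = 2 * D * 2^-1 ^+ n.
    have -> : (4^-1 : R) = 2^-1 * 2^-1 by lra.
    have h2 : (2 : R) ^+ n * 2^-1 ^+ n = 1 by rewrite -exprMn divff// expr1n.
    by rewrite exprMn mulrACA h2 mul1r.
  by apply: hM; lia.
have := nrm_dist_trans subX nrmX xAx xs xu.
have := nrm_dist_trans subX nrmX xs xv xu; lra.
Qed.

End WithDecay.

Theorem chaos_criterion : chaotic X nrm A.
Proof.
have rp : 0 < (8^-1 : R) by lra.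
have [D hD] := decK rp.
split=> //.
- by split; [exact: linA|exact: criterion_unbounded|exact: criterion_dense_dom].
- by move=> n _; exact: criterion_closed.
- exact: criterion_hypercyclic_decay hD.
- exact: criterion_periodic_decay hD.
Qed.

End ChaosCriterion.

(** * Square-summable sequences *)

Section RealL2.
Variable R : realType.
Implicit Types f g h : nat -> R.

Definition l2 f := exists M : R, forall n, \sum_(k < n) f k ^+ 2 <= M.

Definition ip f g : R := limn (fun n => \sum_(k < n) f k * g k).

Definition l2norm f : R := Num.sqrt (ip f f).

Lemma sum_homo f (f0 : forall k, 0 <= f k) :
  {homo (fun n => \sum_(k < n) f k) : n m / (n <= m)%N >-> n <= m}.
Proof.
move=> n m nm; rewrite -(subnKC nm) big_split_ord /= lerDl.
by apply: sumr_ge0.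
Qed.

Lemma l2_le f g : (forall k, `|f k| <= `|g k|) -> l2 g -> l2 f.
Proof.
move=> fg [M hM]; exists M => n; apply: le_trans (hM n).
apply: ler_sum => k _; rewrite -(real_normK (num_real (f k))).
by rewrite -(real_normK (num_real (g k))) lerXn2r// nnegrE.
Qed.

Lemma l2_comb (a : R) f g : l2 f -> l2 g -> l2 (fun k => a * f k + g k).
Proof.
move=> [M hM] [N hN]; exists (2 * a ^+ 2 * M + 2 * N) => n.
apply: (@le_trans _ _ (\sum_(k < n) (2 * a ^+ 2 * f k ^+ 2 + 2 * g k ^+ 2))).
  apply: ler_sum => k _; rewrite -subr_ge0.
  have -> : 2 * a ^+ 2 * f k ^+ 2 + 2 * g k ^+ 2 - (a * f k + g k) ^+ 2
            = (a * f k - g k) ^+ 2 by ring.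
  exact: sqr_ge0.
rewrite big_split /= -!mulr_sumr; apply: lerD.
  by apply: ler_wpM2l (hM n); rewrite mulr_ge0 ?sqr_ge0.
by apply: ler_wpM2l (hN n).
Qed.

Lemma l2_0 : l2 (fun=> 0).
Proof. by exists 0 => n; rewrite big1// => i _; rewrite expr0n. Qed.

Lemma l2D f g : l2 f -> l2 g -> l2 (fun k => f k + g k).
Proof.
move=> hf hg; have := l2_comb 1 hf hg.
by congr l2; apply/funext => k; rewrite mul1r.
Qed.

Lemma l2Z (a : R) f : l2 f -> l2 (fun k => a * f k).
Proof.
move=> hf; have := l2_comb a hf l2_0.
by congr l2; apply/funext => k; rewrite addr0.
Qed.

Lemma l2B f g : l2 f -> l2 g -> l2 (fun k => f k - g k).
Proof.
move=> hf hg; have := l2_comb (-1) hg hf.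
by congr l2; apply/funext => k; rewrite mulN1r addrC.
Qed.

Lemma sq_cvg f : l2 f -> cvgn (fun n => \sum_(k < n) f k ^+ 2).
Proof.
move=> [M hM]; apply: nondecreasing_is_cvgn.
  by apply: (@sum_homo (fun k => f k ^+ 2)) => k; exact: sqr_ge0.
by exists M => _ [n _ <-].
Qed.

(** By polarisation the partial sums are half of those of (f+g)^2 - f^2 - g^2, three monotone
    bounded sequences. *)
Lemma ip_cvg f g : l2 f -> l2 g ->
  (fun n => \sum_(k < n) f k * g k) @ \oo --> ip f g.
Proof.
move=> hf hg; have := sq_cvg (l2D hf hg) => h1.
have h2 := sq_cvg hf; have h3 := sq_cvg hg.
rewrite /ip.
have -> : (fun n => \sum_(k < n) f k * g k) =
    (fun n => 2^-1 * (\sum_(k < n) (f k + g k) ^+ 2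
                      - \sum_(k < n) f k ^+ 2 - \sum_(k < n) g k ^+ 2)).
  apply/funext => n; rewrite -!sumrB mulr_sumr; apply: eq_bigr => k _.
  by field.
apply/cvg_ex; eexists; apply: cvgMr; apply: cvgB; first apply: cvgB; eassumption.
Qed.

Lemma ip_eq f g (l : R) :
  (fun n => \sum_(k < n) f k * g k) @ \oo --> l -> ip f g = l.
Proof. by move=> h; apply/cvg_lim. Qed.

Lemma ipC f g : ip f g = ip g f.
Proof.
by rewrite /ip; congr (lim (_ @ \oo)); apply/funext => n;
   apply: eq_bigr => k _; rewrite mulrC.
Qed.

Lemma ip_comb (a : R) f g h : l2 f -> l2 g -> l2 h ->
  ip (fun k => a * f k + g k) h = a * ip f h + ip g h.
Proof.
move=> hf hg hh; apply: ip_eq.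
have -> : (fun n => \sum_(k < n) (a * f k + g k) * h k) =
  (fun n => a * (\sum_(k < n) f k * h k) + \sum_(k < n) g k * h k).
  apply/funext => n; rewrite mulr_sumr -big_split /=; apply: eq_bigr => k _; ring.
by apply: cvgD; [apply: cvgMr|]; exact: ip_cvg.
Qed.

Lemma ip_combr (a : R) f g h : l2 f -> l2 g -> l2 h ->
  ip h (fun k => a * f k + g k) = a * ip h f + ip h g.
Proof. by move=> *; rewrite ipC ip_comb// !(ipC h). Qed.

Lemma ip_ge_sum f n : l2 f -> \sum_(k < n) f k ^+ 2 <= ip f f.
Proof.
move=> hf; have h := ip_cvg hf hf.
have -> : ip f f = limn (fun n => \sum_(k < n) f k ^+ 2).
  by rewrite /ip; congr (lim (_ @ \oo)); apply/funext => m;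
     apply: eq_bigr => k _; rewrite expr2.
apply: nondecreasing_cvgn_le (sq_cvg hf) n.
by apply: (@sum_homo (fun k => f k ^+ 2)) => k; exact: sqr_ge0.
Qed.

Lemma ip_le f (M : R) : l2 f -> (forall n, \sum_(k < n) f k ^+ 2 <= M) -> ip f f <= M.
Proof.
move=> hf h; apply: limr_le; first by apply/cvg_ex; eexists; exact: ip_cvg.
by apply: nearW => n; apply: le_trans (h n); apply: ler_sum => k _; rewrite expr2.
Qed.

Lemma ip_ge0 f : l2 f -> 0 <= ip f f.
Proof. by move=> hf; have := ip_ge_sum 0 hf; rewrite big_ord0. Qed.

Lemma sqr_l2norm f : l2 f -> l2norm f ^+ 2 = ip f f.
Proof. by move=> hf; rewrite sqr_sqrtr// ip_ge0. Qed.

Lemma l2norm_ge0 f : 0 <= l2norm f.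
Proof. exact: sqrtr_ge0. Qed.

Lemma coord_le_l2norm f k : l2 f -> `|f k| <= l2norm f.
Proof.
move=> hf; rewrite -sqrtr_sqr ler_wsqrtr//.
apply: le_trans (ip_ge_sum k.+1 hf).
by rewrite big_ord_recr /= lerDr; apply: sumr_ge0 => i _; exact: sqr_ge0.
Qed.

Lemma l2norm_eq0 f : l2 f -> l2norm f = 0 -> f = fun=> 0.
Proof.
move=> hf h; apply/funext => k; apply/eqP; rewrite -normr_le0 -h.
exact: coord_le_l2norm.
Qed.

Lemma CauchySchwarz f g : l2 f -> l2 g -> `|ip f g| <= l2norm f * l2norm g.
Proof.
move=> hf hg.
have a0 := ip_ge0 hf; have b0 := ip_ge0 hg.
have q t : 0 <= t ^+ 2 * ip g g + 2 * t * ip f g + ip f f.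
  have := ip_ge0 (l2_comb t hg hf).
  rewrite ip_comb//; last exact: l2_comb.
  rewrite !ip_combr// (ipC g f) => /le_trans; apply; rewrite le_eqVlt; apply/orP; left.
  apply/eqP; ring.
suff h : ip f g ^+ 2 <= ip f f * ip g g.
  by rewrite -sqrtr_sqr /l2norm -sqrtrM// ler_wsqrtr.
have [b00|bn0] := eqVneq (ip g g) 0.
  rewrite b00 mulr0.
  have [->|fg0] := eqVneq (ip f g) 0; first by rewrite expr0n.
  (* With no quadratic term, this t makes the nonnegative expression equal to -1. *)
  have := q (- (ip f f + 1) / (2 * ip f g)); rewrite b00 mulr0 add0r.
  have -> : 2 * (- (ip f f + 1) / (2 * ip f g)) * ip f g = - (ip f f + 1) by field.
  lra.
have bp : 0 < ip g g by rewrite lt_def bn0.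
(* The minimiser of the quadratic in t. *)
have := q (- ip f g / ip g g).
have -> : (- ip f g / ip g g) ^+ 2 * ip g g + 2 * (- ip f g / ip g g) * ip f g + ip f f
   = (ip f f * ip g g - ip f g ^+ 2) / ip g g by field.
by rewrite pmulr_lge0 ?invr_gt0// subr_ge0.
Qed.

Lemma l2normD f g : l2 f -> l2 g ->
  l2norm (fun k => f k + g k) <= l2norm f + l2norm g.
Proof.
move=> hf hg; have hfg := l2D hf hg.
rewrite -(ler_pXn2r (_ : 0 < 2)%N)// ?nnegrE ?addr_ge0 ?l2norm_ge0//.
rewrite sqrrD !sqr_l2norm//.
have -> : ip (fun k => f k + g k) (fun k => f k + g k) =
          ip f f + ip f g *+ 2 + ip g g.
  have e : (fun k => f k + g k) = (fun k => 1 * f k + g k).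
    by apply/funext => k; rewrite mul1r.
  rewrite e in hfg *; rewrite ip_comb// !ip_combr// (ipC g f); ring.
rewrite lerD2r lerD2l lerMn2r /=.
exact: le_trans (ler_norm _) (CauchySchwarz hf hg).
Qed.

Lemma l2normZ (a : R) f : l2 f -> l2norm (fun k => a * f k) = `|a| * l2norm f.
Proof.
move=> hf; rewrite /l2norm -sqrtr_sqr -sqrtrM ?sqr_ge0//; congr Num.sqrt.
apply: ip_eq.
have -> : (fun n => \sum_(k < n) a * f k * (a * f k)) =
          (fun n => a ^+ 2 * \sum_(k < n) f k * f k).
  by apply/funext => n; rewrite mulr_sumr; apply: eq_bigr => k _; ring.
by apply: cvgMr; exact: ip_cvg.
Qed.

Lemma l2norm_distC f g : l2 f -> l2 g ->
  l2norm (fun k => f k - g k) = l2norm (fun k => g k - f k).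
Proof.
move=> hf hg; rewrite -[RHS]mul1r -[1]normr1 -normrN -l2normZ; last exact: l2B.
by congr l2norm; apply/funext => k; rewrite mulN1r opprB.
Qed.

Lemma l2norm_le f g : l2 f -> l2 g -> (forall k, `|f k| <= `|g k|) ->
  l2norm f <= l2norm g.
Proof.
move=> hf hg fg; rewrite ler_wsqrtr//; apply: ip_le => // n.
apply: le_trans (ip_ge_sum n hg); apply: ler_sum => k _.
rewrite -(real_normK (num_real (f k))) -(real_normK (num_real (g k))).
by rewrite lerXn2r// nnegrE.
Qed.

Lemma l2norm_leP f (M : R) : 0 <= M -> (forall n, \sum_(k < n) f k ^+ 2 <= M ^+ 2) ->
  l2 f /\ l2norm f <= M.
Proof.
move=> M0 h; have hf : l2 f by exists (M ^+ 2).
split=> //; rewrite -[leRHS]ger0_norm// -sqrtr_sqr ler_wsqrtr//.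
exact: ip_le.
Qed.

Lemma l2_norm f : l2 f <-> l2 (fun k => `|f k|).
Proof. by split; apply: l2_le => k; rewrite normr_id. Qed.

Lemma l2norm_norm f : l2norm (fun k => `|f k|) = l2norm f.
Proof.
rewrite /l2norm /ip; congr (Num.sqrt (lim (_ @ \oo))).
by apply/funext => n; apply: eq_bigr => k _; rewrite -!expr2 real_normK// num_real.
Qed.

End RealL2.

(** * Complex square-summable sequences and their completeness *)

Section ComplexL2.
Variable R : realType.
Implicit Types u v : nat -> R[i].

Definition l2C u := l2 (fun k => normc (u k)).
Definition l2Cnorm u : R := l2norm (fun k => normc (u k)).

Lemma l2C_comb (a : R[i]) u v : l2C u -> l2C v -> l2C (fun k => a * u k + v k).
Proof.
move=> hu hv; apply: l2_le (l2_comb (normc a) hu hv) => k.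
rewrite !ger0_norm ?normc_ge0//; last first.
  by rewrite addr_ge0 ?mulr_ge0 ?normc_ge0.
by rewrite -Normc.normcM normcD.
Qed.

Lemma l2CB u v : l2C u -> l2C v -> l2C (fun k => u k - v k).
Proof.
move=> hu hv; have := l2C_comb (-1) hv hu.
by congr l2C; apply/funext => k; rewrite mulN1r addrC.
Qed.

Lemma l2CD u v : l2C u -> l2C v -> l2C (fun k => u k + v k).
Proof.
move=> hu hv; have := l2C_comb 1 hu hv.
by congr l2C; apply/funext => k; rewrite mul1r.
Qed.

Lemma l2CnormD u v : l2C u -> l2C v ->
  l2Cnorm (fun k => u k + v k) <= l2Cnorm u + l2Cnorm v.
Proof.
move=> hu hv; apply: le_trans (l2normD hu hv).
apply: l2norm_le; [exact: l2CD|exact: l2D|] => k.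
by rewrite !ger0_norm ?normcD// ?addr_ge0 ?normc_ge0.
Qed.

Lemma l2CnormZ (a : R[i]) u : l2C u ->
  l2Cnorm (fun k => a * u k) = normc a * l2Cnorm u.
Proof.
move=> hu; rewrite -[normc a]ger0_norm ?normc_ge0// -l2normZ//.
by congr l2norm; apply/funext => k; rewrite Normc.normcM.
Qed.

Lemma coord_le_l2Cnorm u k : l2C u -> normc (u k) <= l2Cnorm u.
Proof.
by move=> hu; apply: le_trans (coord_le_l2norm k hu); rewrite ler_norm.
Qed.

(** The limit is built coordinate by coordinate from real and imaginary parts. The norm bound passes
    to it on every finite block of coordinates, with a constant independent of the block. *)
Lemma l2C_complete (u : nat -> nat -> R[i]) : (forall m, l2C (u m)) ->
  (forall eps : R, 0 < eps -> exists N, forall m n, (N <= m)%N -> (N <= n)%N ->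
     l2Cnorm (fun k => u m k - u n k) < eps) ->
  exists2 l, l2C l & (forall eps : R, 0 < eps -> exists N, forall m, (N <= m)%N ->
     l2Cnorm (fun k => u m k - l k) <= eps).
Proof.
move=> hu cau.
have coord (p : R[i] -> R) (hp : forall z w, `|p z - p w| <= normc (z - w)) k :
    cvgn (fun m => p (u m k)).
  apply: cauchy_cvg; apply/cauchy_exP => e e0.
  have [N hN] := cau e e0.
  exists (p (u N k)); exists N => // m /= Nm.
  rewrite /ball /=; apply: le_lt_trans (hp _ _) _.
  apply: le_lt_trans (hN N m (leqnn _) Nm).
  exact: (@coord_le_l2Cnorm (fun k => u N k - u m k) k (l2CB (hu _) (hu _))).
have hRe (z w : R[i]) : `|complex.Re z - complex.Re w| <= normc (z - w).
  by have := normc_Re (z - w); case: z => a b; case: w => c d.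
have hIm (z w : R[i]) : `|complex.Im z - complex.Im w| <= normc (z - w).
  by have := normc_Im (z - w); case: z => a b; case: w => c d.
pose l k : R[i] := limn (fun m => complex.Re (u m k)) +i* limn (fun m => complex.Im (u m k)).
have cl m k : (fun n => normc (u m k - u n k) ^+ 2) @ \oo --> normc (u m k - l k) ^+ 2.
  rewrite normc_sqr.
  have -> : (fun n => normc (u m k - u n k) ^+ 2) = (fun n =>
     (complex.Re (u m k) - complex.Re (u n k)) ^+ 2 +
     (complex.Im (u m k) - complex.Im (u n k)) ^+ 2).
    by apply/funext => n; rewrite normc_sqr; case: (u m k) => ? ?; case: (u n k).
  have -> : complex.Re (u m k - l k) = complex.Re (u m k) - complex.Re (l k).
    by case: (u m k).
  have -> : complex.Im (u m k - l k) = complex.Im (u m k) - complex.Im (l k).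
    by case: (u m k).
  have c1 := coord _ hRe k; have c2 := coord _ hIm k.
  apply: cvgD; under eq_fun do rewrite expr2; rewrite expr2;
    apply: cvgM; (apply: cvgB; [exact: cvg_cst|]); assumption.
have lim m e : 0 < e -> (exists N, forall n, (N <= n)%N ->
      l2Cnorm (fun k => u m k - u n k) < e) ->
    l2C (fun k => u m k - l k) /\ l2Cnorm (fun k => u m k - l k) <= e.
  move=> e0 [N hN]; apply: l2norm_leP; first exact: ltW.
  move=> j.
  have cs : (fun n => \sum_(k < j) normc (u m k - u n k) ^+ 2) @ \oo -->
      \sum_(k < j) normc (u m k - l k) ^+ 2.
    elim: j => [|i IH].
      by under eq_fun do rewrite big_ord0; rewrite big_ord0; exact: cvg_cst.
    by under eq_fun do rewrite big_ord_recr /=; rewrite big_ord_recr; exact: cvgD.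
  rewrite -(cvg_lim _ cs)//; apply: limr_le.
  - by apply/cvg_ex; eexists; exact: cs.
  - exists N => // n /= Nn.
    have hB := l2CB (hu m) (hu n).
    apply: le_trans (ip_ge_sum j hB) _; rewrite -sqr_l2norm//.
    by rewrite lerXn2r ?nnegrE ?l2norm_ge0// ltW// hN.
exists l; last first.
  move=> e e0; have [N hN] := cau e e0; exists N => m Nm.
  by apply: (lim m e e0 _).2; exists N => n Nn; exact: hN.
have [N hN] := cau 1 ltr01.
have [h _] := lim N 1 ltr01 (ex_intro _ N (fun n => hN N n (leqnn _))).
have := l2CB (hu N) h; congr l2C; apply/funext => k; ring.
Qed.

Lemma l2C_Re u : l2C u -> l2 (fun k => complex.Re (u k)).
Proof.
by apply: l2_le => k; rewrite (ger0_norm (normc_ge0 _)) normc_Re.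
Qed.

Lemma l2C_Im u : l2C u -> l2 (fun k => complex.Im (u k)).
Proof.
by apply: l2_le => k; rewrite (ger0_norm (normc_ge0 _)) normc_Im.
Qed.

Lemma l2C_ReIm u : l2 (fun k => complex.Re (u k)) -> l2 (fun k => complex.Im (u k)) ->
  l2C u /\ l2Cnorm u <= l2norm (fun k => complex.Re (u k)) + l2norm (fun k => complex.Im (u k)).
Proof.
move=> /[dup] hRe /l2_norm hRe' /[dup] hIm /l2_norm hIm'.
have h := l2D hRe' hIm'.
have le k : `|normc (u k)| <= `| `|complex.Re (u k)| + `|complex.Im (u k)| |.
  rewrite (ger0_norm (normc_ge0 _)).
  by rewrite (ger0_norm (addr_ge0 (normr_ge0 _) (normr_ge0 _))) normc_le_ReIm.
have hu : l2C u by exact: l2_le h.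
split=> //; rewrite -[X in _ <= X + _]l2norm_norm -[X in _ <= _ + X]l2norm_norm.
exact: le_trans (l2norm_le hu h le) (l2normD hRe' hIm').
Qed.

End ComplexL2.

(** * Best approximation in real l^2 *)

Section Projection.
Variable R : realType.
Implicit Types f g : nat -> R.

Lemma l2_complete (u : nat -> nat -> R) : (forall m, l2 (u m)) ->
  (forall eps : R, 0 < eps -> exists N, forall m n, (N <= m)%N -> (N <= n)%N ->
     l2norm (fun k => u m k - u n k) < eps) ->
  exists2 l, l2 l & (forall eps : R, 0 < eps -> exists N, forall m, (N <= m)%N ->
     l2norm (fun k => u m k - l k) <= eps).
Proof.
move=> hu cau.
have e f : (fun k => normc ((f k)%:C)) = (fun k => `|f k|).
  by apply/funext => k; rewrite normcR.
have [||l hl cl] := @l2C_complete R (fun m k => (u m k)%:C).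
- by move=> m; rewrite /l2C e; apply/(l2_norm (u m)).
- move=> eps /cau [N hN]; exists N => m n Nm Nn.
  have -> : (fun k => (u m k)%:C - (u n k)%:C : R[i]) = (fun k => (u m k - u n k)%:C).
    by apply/funext => k; rewrite -raddfB.
  by rewrite /l2Cnorm e l2norm_norm hN.
exists (fun k => complex.Re (l k)); first exact: l2C_Re.
move=> eps /cl [N hN]; exists N => m /hN; apply: le_trans.
have h : l2C (fun k => (u m k)%:C - l k).
  by apply: l2CB => //; rewrite /l2C e; apply/(l2_norm (u m)).
rewrite -l2norm_norm; apply: l2norm_le => //.
  by apply/(l2_norm (fun k => u m k - complex.Re (l k))); apply: l2B => //; exact: l2C_Re.
move=> k; rewrite normr_id (ger0_norm (normc_ge0 _)).
by have := normc_Re ((u m k)%:C - l k); case: (l k).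
Qed.

(** Written with the midpoint: for two residuals of approximants from M, the midpoint is again such
    a residual, hence of norm at least the distance. *)
Lemma parallelogram f g : l2 f -> l2 g ->
  ip (fun k => f k - g k) (fun k => f k - g k) =
  2 * ip f f + 2 * ip g g - 4 * ip (fun k => (f k + g k) / 2) (fun k => (f k + g k) / 2).
Proof.
move=> hf hg.
have -> : (fun k => f k - g k) = (fun k => (-1) * g k + f k).
  by apply/funext => k; ring.
have -> : (fun k => (f k + g k) / 2) = (fun k => 2^-1 * f k + 2^-1 * g k).
  by apply/funext => k; ring.
have h1 := l2_comb (-1) hg hf.
have h2 := l2Z 2^-1 hg; have h3 := l2_comb 2^-1 hf h2.
have e : (fun k => 2^-1 * g k) = (fun k => 2^-1 * g k + 0).
  by apply/funext => k; rewrite addr0.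
have z (h : nat -> R) : l2 h -> ip h (fun=> 0) = 0.
  move=> hh; have := ip_combr (-1) (l2_0 R) (l2_0 R) hh.
  by under eq_fun do rewrite mulr0 addr0; lra.
have ez (h : nat -> R) : l2 h -> ip h (fun k => 2^-1 * g k) = 2^-1 * ip h g.
  by move=> hh; rewrite e ip_combr ?z ?addr0//; exact: l2_0.
have ez' (h : nat -> R) : l2 h -> ip (fun k => 2^-1 * g k) h = 2^-1 * ip g h.
  by move=> hh; rewrite ipC ez// ipC.
rewrite !ip_comb// !ip_combr// !ez'// !ez// (ipC g f).
by field.
Qed.

(* Projection theorem: the residual of the best approximation of [f] in the
   closure of [M] is orthogonal to [M]. *)
Lemma dense_of_orthogonal (M : set (nat -> R)) :
  M `<=` @l2 R -> M (fun=> 0) ->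
  (forall a f g, M f -> M g -> M (fun k => a * f k + g k)) ->
  (forall f, l2 f -> (forall m, M m -> ip f m = 0) -> f = fun=> 0) ->
  forall f (eps : R), l2 f -> 0 < eps ->
    exists2 m, M m & l2norm (fun k => f k - m k) < eps.
Proof.
move=> Ml2 M0 Mcomb orth f eps hf eps0.
pose E := [set l2norm (fun k => f k - m k) | m in M].
pose D := inf E.
have hfm m : M m -> l2 (fun k => f k - m k) by move=> /Ml2 hm; exact: l2B.
have Elb : has_lbound E by exists 0 => _ [m _ <-]; exact: l2norm_ge0.
have Einf : has_inf E.
  by split=> //; exists (l2norm (fun k => f k - 0)); exists (fun=> 0).
have DE m : M m -> D <= l2norm (fun k => f k - m k).
  by move=> hm; apply: ge_inf => //; exists m.
have D0 : 0 <= D by apply: lb_le_inf; [by case: Einf|move=> _ [m _ <-]; exact: l2norm_ge0].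
have min (n : nat) : exists m, M m /\ l2norm (fun k => f k - m k) < D + n.+1%:R^-1.
  have n0 : 0 < n.+1%:R^-1 :> R by [].
  have [_ [m hm <-] h] := inf_adherent n0 Einf.
  by exists m.
have [u hu] := choice min.
have Mu n : M (u n) by case: (hu n).
have lu n : l2 (u n) by exact: Ml2.
have inv_small (e : R) : 0 < e -> exists N, forall n, (N <= n)%N -> n.+1%:R^-1 < e.
  move=> e0; have [N _ hN] := near_infty_natSinv_lt (PosNum e0).
  by exists N => n /hN.
(* With x, y <= 1 the excesses over the distance D, the parallelogram law bounds the square by
   2(D+x)^2 + 2(D+y)^2 - 4D^2 <= (4D + 2)(x + y), so a minimising sequence is Cauchy. *)
have dist m n : (l2norm (fun k => u m k - u n k)) ^+ 2 <=
    (4 * D + 2) * (m.+1%:R^-1 + n.+1%:R^-1).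
  have hB := l2B (lu m) (lu n).
  rewrite sqr_l2norm//.
  have -> : (fun k => u m k - u n k) = (fun k => (f k - u n k) - (f k - u m k)).
    by apply/funext => k; ring.
  rewrite parallelogram; [|exact: hfm..].
  have hmid : M (fun k => (u n k + u m k) / 2).
    have := Mcomb 2^-1 _ _ (Mu n) (Mcomb 2^-1 _ _ (Mu m) M0).
    by congr M; apply/funext => k; field.
  have -> : (fun k => (f k - u n k + (f k - u m k)) / 2) =
            (fun k => f k - (u n k + u m k) / 2).
    by apply/funext => k; field.
  rewrite -!sqr_l2norm; [|exact: hfm..].
  have [_ h1] := hu m; have [_ h2] := hu n; have h3 := DE _ hmid.
  move: h1 h2 h3 (l2norm_ge0 (fun k => f k - u m k)) (l2norm_ge0 (fun k => f k - u n k)).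
  have i1 : (m.+1%:R^-1 : R) <= 1 by rewrite invf_le1// ler1n.
  have i2 : (n.+1%:R^-1 : R) <= 1 by rewrite invf_le1// ler1n.
  have i3 : (0 : R) < m.+1%:R^-1 by [].
  have i4 : (0 : R) < n.+1%:R^-1 by [].
  move: i1 i2 i3 i4; set x := m.+1%:R^-1; set y := n.+1%:R^-1.
  set a := l2norm _; set b := l2norm _; set c := l2norm _.
  move=> x1 y1 x0 y0 hax hby Dc a0 b0.
  have hD2 : D ^+ 2 <= c ^+ 2 by rewrite lerXn2r ?nnegrE ?l2norm_ge0.
  have ha2 : a ^+ 2 <= (D + x) ^+ 2 by rewrite lerXn2r ?nnegrE// ?ltW//; lra.
  have hb2 : b ^+ 2 <= (D + y) ^+ 2 by rewrite lerXn2r ?nnegrE// ?ltW//; lra.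
  nra.
have [g hg cg] : exists2 l, l2 l & (forall eps : R, 0 < eps -> exists N, forall m,
    (N <= m)%N -> l2norm (fun k => u m k - l k) <= eps).
  apply: l2_complete => // e e0.
  have [|N hN] := inv_small (e ^+ 2 / (2 * (4 * D + 2))).
    by rewrite divr_gt0 ?exprn_gt0//; lra.
  exists N => m n /hN h1 /hN h2.
  rewrite -(ltr_pXn2r (_ : 0 < 2)%N)// ?nnegrE ?l2norm_ge0 ?ltW//.
  apply: le_lt_trans (dist m n) _.
  have : (4 * D + 2) * (m.+1%:R^-1 + n.+1%:R^-1) < (4 * D + 2) * (e ^+ 2 / (4 * D + 2)).
    rewrite ltr_pM2l; last lra.
    have E2 (x : R) : e ^+ 2 / (2 * x) = e ^+ 2 / x / 2 by rewrite invfM mulrCA mulrC.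
    by move: h1 h2; rewrite !E2; move: (m.+1%:R^-1) (n.+1%:R^-1) (e ^+ 2 / _) => x y z; lra.
  by rewrite mulrCA divff ?mulr1//; apply/eqP; lra.
pose f0 k := f k - g k.
have hf0 : l2 f0 by exact: l2B.
have f0D : l2norm f0 <= D.
  apply/ler_addgt0Pr => e e0; have e20 : 0 < e / 2 by lra.
  have [N hN] := cg _ e20; have [N' hN'] := inv_small _ e20.
  pose n := maxn N N'.
  have h1 := hN n (leq_maxl _ _); have h2 := hN' n (leq_maxr _ _).
  have := l2normD (hfm _ (Mu n)) (l2B (lu n) hg).
  have -> : (fun k => f k - u n k + (u n k - g k)) = f0.
    by apply/funext => k; rewrite /f0; ring.
  by have [_ ] := hu n; move: h1 h2; move: (n.+1%:R^-1) => x; lra.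
(* g need not lie in M, so f - g + t m is compared with f - (u_N - t m), whose distance to 0 is at
   least D. *)
have Df0 m t : M m -> D <= l2norm (fun k => t * m k + f0 k).
  move=> hm; apply/ler_addgt0Pr => e e0.
  have [N hN] := cg _ e0.
  have h1 := hN N (leqnn N).
  have hc := l2_comb t (Ml2 _ hm) hf0.
  have hgN := l2B hg (lu N).
  have := l2normD hc hgN.
  have -> : (fun k => t * m k + f0 k + (g k - u N k)) =
            (fun k => f k - ((- t) * m k + u N k)).
    by apply/funext => k; rewrite /f0; ring.
  have := DE _ (Mcomb (- t) _ _ hm (Mu N)).
  rewrite (l2norm_distC hg (lu N)); lra.
have f00 : f0 = fun=> 0.
  apply: orth => // m hm; have lm := Ml2 _ hm.
  have q t : 0 <= t ^+ 2 * ip m m + 2 * t * ip f0 m.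
    have h : ip f0 f0 <= ip (fun k => t * m k + f0 k) (fun k => t * m k + f0 k).
      have hc := l2_comb t lm hf0.
      by rewrite -!sqr_l2norm// lerXn2r ?nnegrE ?l2norm_ge0// (le_trans f0D)// Df0.
    move: h; rewrite ip_comb//; last exact: l2_comb.
    rewrite !ip_combr// (ipC m f0); lra.
  have b0 := ip_ge0 lm.
  apply/eqP/negPn/negP => fm0.
  (* Any t of the right sign and small enough would do; the +1 avoids a separate case for m = 0. *)
  have := q (- ip f0 m / (ip m m + 1)).
  have -> : (- ip f0 m / (ip m m + 1)) ^+ 2 * ip m m + 2 * (- ip f0 m / (ip m m + 1)) * ip f0 m
     = - (ip f0 m ^+ 2 * (ip m m + 2) / (ip m m + 1) ^+ 2).
    by field; apply/eqP; lra.
  rewrite oppr_ge0 leNgt => /negP; apply.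
  rewrite divr_gt0//; last by rewrite exprn_gt0//; lra.
  by rewrite mulr_gt0//; [rewrite exprn_even_gt0//|lra].
have e20 : 0 < eps / 2 by lra.
have [N hN] := cg _ e20; exists (u N) => //.
have -> : (fun k => f k - u N k) = (fun k => g k - u N k).
  by apply/funext => k; have := congr1 (@^~ k) f00; rewrite /f0 /=; lra.
rewrite (l2norm_distC hg (lu N)).
by have := hN N (leqnn N); lra.
Qed.

End Projection.

(** * Jacobi operators *)

Section JacobiAlgebra.
Variable F : fieldType.
Implicit Types (w v u f g : nat -> F).

(** w is the superdiagonal and v the subdiagonal. v = 0 gives the weighted backward shift and v = w
    the symmetric Jacobi matrix, so that one model serves both operators. *)
Definition jacobi w v u n : F :=
  w n * u n.+1 + (if n is m.+1 then v m * u m else 0).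

(* Solutions of [jacobi w w u n = 0] for [n >= 1]: even and odd entries decouple. *)
Fixpoint jacobi_sol w (a b : F) n : F :=
  match n with
  | 0 => a
  | 1 => b
  | m.+2 => - (w m / w m.+1) * jacobi_sol w a b m
  end.

(** Solutions of the first and second kind: K lies in the kernel of the matrix and L is mapped to
    the 0-th unit vector; the initial value 1 / w 0 normalises their Wronskian to 1. *)
Local Notation K w := (jacobi_sol w 1 0).
Local Notation L w := (jacobi_sol w 0 (w 0)^-1).

(** Variation of constants, with the integration constants chosen so that the value at 0
    vanishes. *)
Definition jacobi_inv w g n : F :=
  L w n * (\sum_(j < n) K w j * g j) - K w n * (\sum_(j < n) L w j * g j).

(** The n-th equation determines entry n+1 from the earlier ones. *)
Lemma jacobi_inj w v u u' : (forall n, w n != 0) ->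
  jacobi w v u =1 jacobi w v u' -> u 0 = u' 0 -> u = u'.
Proof.
move=> w0 h h0; apply/funext => n.
elim/ltn_ind: n => -[//|n] IH.
have := h n; rewrite /jacobi.
have -> : (if n is m.+1 then v m * u m else 0) = (if n is m.+1 then v m * u' m else 0).
  by case: n {h} IH => // m IH; rewrite IH.
by move=> /addIr /(mulfI (w0 n)).
Qed.

Section Inverse.
Variable w : nat -> F.
Hypothesis w0 : forall n, w n != 0.

Lemma jacobi_solS a b n : jacobi w w (jacobi_sol w a b) n.+1 = 0.
Proof.
rewrite /jacobi /=; move: (w0 n.+1); set x := w n; set y := w n.+1.
by set s := jacobi_sol _ _ _ _ => y0; field.
Qed.

Lemma jacobi_solSS a b n :
  jacobi_sol w a b n.+2 = - (w n / w n.+1) * jacobi_sol w a b n.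
Proof. by []. Qed.

(** The discrete Wronskian is constant in n; in [jacobi_invK] it is the coefficient of the
    right-hand side. *)
Lemma wronskian n : w n * (K w n * L w n.+1 - L w n * K w n.+1) = 1.
Proof.
elim: n => [|n IH]; first by rewrite /= mul1r mul0r subr0 divff.
rewrite !jacobi_solSS -[RHS]IH.
set k := K w n; set l := L w n; set k' := jacobi_sol w 1 0 n.+1.
set l' := jacobi_sol w 0 _ n.+1.
by have := w0 n.+1; move=> y0; field.
Qed.

Lemma jacobi_invK g : jacobi w w (jacobi_inv w g) = g.
Proof.
apply/funext => -[|n]; rewrite /jacobi /jacobi_inv.
  by rewrite !big_ord_recr !big_ord0 /=; have := w0 0 => y0; field.
rewrite [\sum_(j < n.+2) _ * _]big_ord_recr [\sum_(j < n.+2) _ * _]big_ord_recr.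
rewrite [\sum_(j < n.+1) _ * _]big_ord_recr [\sum_(j < n.+1) _ * _]big_ord_recr.
have := jacobi_solS 1 0 n; have := jacobi_solS 0 (w 0)^-1 n.
have := wronskian n.+1; rewrite /jacobi.
set k := K w n; set l := L w n; set k' := jacobi_sol w 1 0 n.+1.
set l' := jacobi_sol w 0 _ n.+1.
set k'' := jacobi_sol w 1 0 n.+2.
set l'' := jacobi_sol w 0 _ n.+2.
set x := w n; set y := w n.+1; set s := \sum_(i < n) _; set t := \sum_(i < n) _ => hw hl hk.
(* The sums may be extended by the term in g n on both sides, as its contributions to x * (l s - k
   t) cancel. Then the recurrences of L and K kill the first two products. *)
transitivity ((y * l'' + x * l) * (s + k * g n) - (y * k'' + x * k) * (t + l * g n)
   + (y * (k' * l'' - l' * k'')) * g n.+1); first by rewrite /=; ring.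
by rewrite hw hl hk !mul0r subr0 add0r mul1r.
Qed.

Lemma jacobi_sol_ker : jacobi w w (K w) = fun=> 0.
Proof.
apply/funext => -[|n]; last exact: jacobi_solS.
by rewrite /jacobi /= mulr0 addr0.
Qed.

Lemma jacobi_inv0 g : jacobi_inv w g 0 = 0.
Proof. by rewrite /jacobi_inv !big_ord0 !mulr0 subrr. Qed.

(* Truncated form of [T - T^* = L K^T - K L^T] for [T = jacobi_inv w]. *)
Lemma jacobi_inv_green f g n :
  \sum_(k < n) f k * jacobi_inv w g k - \sum_(k < n) jacobi_inv w f k * g k =
  (\sum_(k < n) f k * L w k) * (\sum_(k < n) K w k * g k) -
  (\sum_(k < n) f k * K w k) * (\sum_(k < n) L w k * g k).
Proof.
elim: n => [|n IH]; first by rewrite !big_ord0 !mulr0.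
rewrite !big_ord_recr /= opprD addrACA IH /jacobi_inv.
have -> : \sum_(j < n) K w j * f j = \sum_(j < n) f j * K w j.
  by apply: eq_bigr => i _; rewrite mulrC.
have -> : \sum_(j < n) L w j * f j = \sum_(j < n) f j * L w j.
  by apply: eq_bigr => i _; rewrite mulrC.
ring.
Qed.

End Inverse.

End JacobiAlgebra.

(** * Factorial decay under discrete Volterra domination *)

Section Volterra.
Variable R : realType.

Lemma exp_coeff_le (x : R) n : 0 <= x -> x ^+ n / n`!%:R <= expR x.
Proof. case: n => [|n] x0; first by rewrite expr0 fact0 divr1; have := expR_ge1Dx x; lra.
by have := expR_ge1Dxn n x0; move: (_ / _) => y; lra. Qed.

(** The discrete substitute for integrating s^n ds: the increment of s^(n+1) dominates (n+1) s^n
    times the increment of s. *)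
Lemma sub_powers_ge (x y : R) n : 0 <= x -> x <= y ->
  n.+1%:R * x ^+ n * (y - x) <= y ^+ n.+1 - x ^+ n.+1.
Proof.
move=> x0 xy; rewrite subrXX mulrC ler_wpM2l ?subr_ge0//.
rewrite mulr_natl -[X in _ *+ X](card_ord n.+1) -sumr_const.
apply: ler_sum => i _.
rewrite -{1}(subnK (leq_ord i)) exprD ler_wpM2r ?exprn_ge0//.
by rewrite /= lerXn2r// nnegrE (le_trans x0).
Qed.

Variables (a : nat -> R) (x : nat -> nat -> R).
Hypotheses (a0 : forall k, 0 <= a k) (al2 : l2 a).
Hypotheses (x0 : forall n k, 0 <= x n k) (xl2 : l2 (x 0)).
Hypothesis xS : forall n k, x n.+1 k <= a k * \sum_(j < k) a j * x n j.

(** With s_k the sum of a_j^2 over j < k, one more application of the kernel turns s^n / n! into a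
    sum of s_j^n / n! against the increments a_j^2 of s, at most s^(n+1) / (n+1)!. Cauchy-Schwarz
    handles the first application, where nothing is known of x 0 beyond its norm. *)
Lemma volterra_pointwise n k : x n.+1 k <=
  a k * (l2norm a * l2norm (x 0)) * ((\sum_(j < k) a j ^+ 2) ^+ n / n`!%:R).
Proof.
elim: n k => [|n IH] k.
  rewrite expr0 fact0 divr1 mulr1.
  apply: le_trans (xS 0 k) _; rewrite ler_wpM2l//.
  apply: le_trans (CauchySchwarz al2 xl2).
  apply: le_trans (ler_norm _).
  apply: nondecreasing_cvgn_le; last by apply/cvg_ex; eexists; exact: ip_cvg.
  by apply: (@sum_homo _ (fun j => a j * x 0 j)) => j; rewrite mulr_ge0.
apply: le_trans (xS n.+1 k) _; rewrite -mulrA ler_wpM2l//.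
set M := l2norm a * l2norm (x 0).
have M0 : 0 <= M by rewrite mulr_ge0 ?l2norm_ge0.
elim: k => [|k IHk].
  by rewrite !big_ord0 mulr_ge0// divr_ge0// exprn_ge0.
rewrite big_ord_recr /= [\sum_(j < k.+1) a j ^+ 2]big_ord_recr /=.
apply: le_trans (lerD IHk (ler_wpM2l (a0 k) (IH k))) _.
have s0 : 0 <= \sum_(j < k) a j ^+ 2 by apply: sumr_ge0 => j _; exact: sqr_ge0.
have := @sub_powers_ge (\sum_(j < k) a j ^+ 2) (\sum_(j < k) a j ^+ 2 + a k ^+ 2) n s0.
rewrite lerDl sqr_ge0 => /(_ isT).
set s := \sum_(j < k) a j ^+ 2; set t := (s + _) ^+ n.+1 => h.
have fE : (n.+1`!%:R : R) = n.+1%:R * n`!%:R by rewrite factS natrM.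
have f0 : 0 < (n`!%:R : R) by rewrite ltr0n fact_gt0.
have n0 : 0 < (n.+1%:R : R) by rewrite ltr0n.
rewrite fE -/M.
have -> : a k * (a k * M * (s ^+ n / n`!%:R)) =
   M * ((n.+1%:R * s ^+ n * (s + a k ^+ 2 - s)) / (n.+1%:R * n`!%:R)).
  by field; rewrite !gt_eqF.
rewrite -mulrDr -mulrDl ler_wpM2l// ler_wpM2r ?invr_ge0 ?mulr_ge0//; lra.
Qed.

Lemma volterra_norm n : l2 (x n.+1) /\
  l2norm (x n.+1) <= l2norm a ^+ 2 * l2norm (x 0) * ((l2norm a ^+ 2) ^+ n / n`!%:R).
Proof.
set c := l2norm a * l2norm (x 0) * ((l2norm a ^+ 2) ^+ n / n`!%:R).
have c0 : 0 <= c.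
  by apply: mulr_ge0; rewrite ?divr_ge0 ?exprn_ge0 ?mulr_ge0 ?l2norm_ge0.
have le k : `|x n.+1 k| <= `|c * a k|.
  rewrite (ger0_norm (x0 _ _)) (ger0_norm (mulr_ge0 c0 (a0 k))).
  apply: le_trans (volterra_pointwise n k) _.
  rewrite [c * _]mulrC -mulrA ler_wpM2l// /c; apply: ler_wpM2l.
    by rewrite mulr_ge0 ?l2norm_ge0.
  rewrite ler_wpM2r ?invr_ge0//; apply: lerXn2r; rewrite ?nnegrE.
  - by apply: sumr_ge0 => j _; exact: sqr_ge0.
  - by rewrite exprn_ge0 ?l2norm_ge0.
  - by rewrite sqr_l2norm// ip_ge_sum.
have cl2 := l2Z c al2.
have xl := l2_le le cl2; split=> //.
apply: le_trans (l2norm_le xl cl2 le) _.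
rewrite l2normZ// ger0_norm// le_eqVlt; apply/orP; left; apply/eqP; rewrite /c; ring.
Qed.

End Volterra.

(** If y 1 were positive, so would be every term, and the ratios y (n+1) / y n would all be at least
    q = y 1 / y 0. Then y n >= q^n y 0, against decay at rate q / 2. Nothing follows for y 0. *)
Lemma logconvex_small (R : realType) (y : nat -> R) : (forall n, 0 <= y n) ->
  (forall n, y n.+1 ^+ 2 <= y n * y n.+2) ->
  (forall r, 0 < r -> exists C, forall n, y n <= C * r ^+ n) -> y 1 = 0.
Proof.
move=> y0 yS dec; apply/eqP; rewrite eq_le y0 andbT leNgt; apply/negP => y1.
have yp n : 0 < y n.+1.
  elim: n => // n IH; rewrite lt_def y0 andbT; apply/eqP => e.
  by have := yS n; rewrite e mulr0 leNgt exprn_gt0.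
have y00 : 0 < y 0.
  rewrite lt_def y0 andbT; apply/eqP => e.
  by have := yS 0; rewrite e mul0r leNgt exprn_gt0.
have yp' n : 0 < y n by case: n.
pose q := y 1 / y 0.
have q0 : 0 < q by rewrite divr_gt0.
have step n : q * y n <= y n.+1.
  elim: n => [|n IH]; first by rewrite /q divfK// gt_eqF.
  rewrite -(ler_pM2l (yp' n)); apply: le_trans (yS n).
  by rewrite mulrCA mulrA expr2 ler_wpM2r.
have geo n : q ^+ n * y 0 <= y n.
  elim: n => [|n IH]; first by rewrite expr0 mul1r.
  by rewrite exprS -mulrA (le_trans _ (step n))// ler_wpM2l// ltW.
have q20 : 0 < q / 2 by lra.
have [C hC] := dec _ q20.
have h21 : 0 <= (2^-1 : R) < 1 by lra.
have [N hN] := geometric_small C h21 y00.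
have := hN N (leqnn N); rewrite ltNge => /negP; apply.
have qN : 0 < q ^+ N by rewrite exprn_gt0.
rewrite -(ler_pM2l qN) (le_trans (geo N))// (le_trans (hC N))//.
by rewrite exprMn mulrCA.
Qed.

(** * Jacobi matrices with log-concave weights of summable inverse *)

Section JacobiReal.
Variables (R : realType) (w : nat -> R).
Hypothesis w_gt0 : forall n, 0 < w n.
Hypothesis w_logconcave : forall n, w n * w n.+2 <= w n.+1 ^+ 2.
Hypothesis w_summable : exists W, forall n, \sum_(k < n) (w k)^-1 <= W.

Let w0 n : w n != 0. Proof. by rewrite gt_eqF. Qed.

Local Notation K := (jacobi_sol w 1 0).
Local Notation L := (jacobi_sol w 0 (w 0)^-1).
Local Notation T := (jacobi_inv w).

(** By log-concavity s_n^2 w_n does not increase when n grows by 2: the recurrence multiplies it by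
    w_n w_(n+2) / w_(n+1)^2. Hence s_n^2 <= B / w_n, which is summable. *)
Lemma l2_jacobi_sol a b : l2 (jacobi_sol w a b).
Proof.
set s := jacobi_sol w a b.
pose B := Num.max (s 0 ^+ 2 * w 0) (s 1 ^+ 2 * w 1).
have hB n : s n ^+ 2 * w n <= B /\ s n.+1 ^+ 2 * w n.+1 <= B.
  elim: n => [|n [h1 h2]]; first by rewrite !le_max !lexx orbT.
  split=> //; apply: le_trans h1.
  rewrite {1}/s /= -/s exprMn sqrrN expr_div_n.
  have p1 : 0 < w n.+1 ^+ 2 by rewrite exprn_gt0.
  have -> : w n ^+ 2 / w n.+1 ^+ 2 * s n ^+ 2 * w n.+2 =
      w n ^+ 2 * s n ^+ 2 * w n.+2 / w n.+1 ^+ 2 by field.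
  rewrite ler_pdivrMr//.
  have -> : w n ^+ 2 * s n ^+ 2 * w n.+2 = (s n ^+ 2 * w n) * (w n * w n.+2) by ring.
  by rewrite ler_wpM2l// mulr_ge0 ?sqr_ge0// ltW.
have [W hW] := w_summable.
exists (B * W) => n.
have B0 : 0 <= B by apply: le_trans (hB 0).1; rewrite mulr_ge0 ?sqr_ge0// ltW.
apply: le_trans (ler_wpM2l B0 (hW n)).
rewrite mulr_sumr; apply: ler_sum => k _.
by rewrite ler_pdivlMr//; case: (hB k).
Qed.

(** The kernel L_k K_j - K_k L_j of T is bounded by the product of the values at k and j, the form
    required by the Volterra estimate. *)
Definition jacobi_majorant k := `|K k| + `|L k|.

Lemma jacobi_majorant_ge0 k : 0 <= jacobi_majorant k.
Proof. by rewrite addr_ge0. Qed.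

Lemma l2_jacobi_majorant : l2 jacobi_majorant.
Proof. by apply: l2D; apply/(l2_norm (jacobi_sol _ _ _)); exact: l2_jacobi_sol. Qed.

Let majE k j : `|L k| * `|K j| + `|K k| * `|L j| <=
  jacobi_majorant k * jacobi_majorant j.
Proof.
rewrite /jacobi_majorant mulrDl !mulrDr.
have := mulr_ge0 (normr_ge0 (K k)) (normr_ge0 (K j)).
have := mulr_ge0 (normr_ge0 (L k)) (normr_ge0 (L j)); lra.
Qed.

Lemma jacobi_inv_le g k : `|T g k| <=
  jacobi_majorant k * \sum_(j < k) jacobi_majorant j * `|g j|.
Proof.
apply: le_trans (ler_normB _ _) _; rewrite !normrM.
apply: le_trans (lerD (ler_wpM2l (normr_ge0 _) (ler_norm_sum _ _ _))
                      (ler_wpM2l (normr_ge0 _) (ler_norm_sum _ _ _))) _.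
rewrite !mulr_sumr -big_split /=; apply: ler_sum => j _.
by rewrite !normrM !mulrA -mulrDl ler_wpM2r.
Qed.

Lemma jacobi_inv_iter_decay g n : l2 g -> l2 (iter n.+1 T g) /\
  l2norm (iter n.+1 T g) <= l2norm jacobi_majorant ^+ 2 *
     ((l2norm jacobi_majorant ^+ 2) ^+ n / n`!%:R) * l2norm g.
Proof.
move=> hg.
have [|||h1 h2] := @volterra_norm R jacobi_majorant (fun n k => `|iter n T g k|)
  jacobi_majorant_ge0 l2_jacobi_majorant _ _ _ n.
- by [].
- exact/(l2_norm g).
- by move=> m k; exact: jacobi_inv_le.
split; first exact/(l2_norm (iter n.+1 T g)).
by move: h2; rewrite !l2norm_norm /= mulrAC.
Qed.

Lemma l2_jacobi_inv g : l2 g -> l2 (T g).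
Proof. by move=> hg; have [] := jacobi_inv_iter_decay 0 hg. Qed.

Lemma l2_iter_jacobi_inv g n : l2 g -> l2 (iter n T g).
Proof. by move=> hg; elim: n => //= n IH; exact: l2_jacobi_inv. Qed.

Let lK : l2 K. Proof. exact: l2_jacobi_sol. Qed.
Let lL : l2 L. Proof. exact: l2_jacobi_sol. Qed.

Lemma ip_jacobi_inv f g : l2 f -> l2 g ->
  ip f (T g) - ip (T f) g = ip f L * ip K g - ip f K * ip L g.
Proof.
move=> hf hg; have hTf := l2_jacobi_inv hf; have hTg := l2_jacobi_inv hg.
apply: (@cvg_unique _ (@norm_hausdorff _ R) (fmap (fun n =>
   \sum_(k < n) f k * T g k - \sum_(k < n) T f k * g k) \oo)).
  by apply: cvgB; exact: ip_cvg.
rewrite (_ : (fun n => _) = (fun n =>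
  (\sum_(k < n) f k * L k) * (\sum_(k < n) K k * g k) -
  (\sum_(k < n) f k * K k) * (\sum_(k < n) L k * g k))).
  by apply: cvgB; apply: cvgM; exact: ip_cvg.
by apply/funext => n; exact: jacobi_inv_green.
Qed.

Definition jacobi_orth f := l2 f /\ forall j, ip f (iter j T K) = 0.

(* [T^*] on the orthogonal complement of [K]. *)
Definition jacobi_adj (f : nat -> R) k : R := ip f L * K k + T f k.

Lemma l2_jacobi_adj f : l2 f -> l2 (jacobi_adj f).
Proof. by move=> hf; apply: l2_comb => //; exact: l2_jacobi_inv. Qed.

Lemma ip_jacobi_adj f g : jacobi_orth f -> l2 g -> ip (jacobi_adj f) g = ip f (T g).
Proof.
move=> [hf fK] hg; rewrite ip_comb//; last exact: l2_jacobi_inv.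
have := ip_jacobi_inv hf hg; have := fK 0; rewrite /= => ->; lra.
Qed.

Lemma jacobi_orth_adj f : jacobi_orth f -> jacobi_orth (jacobi_adj f).
Proof.
move=> hf; split; first by apply: l2_jacobi_adj; case: hf.
by move=> j; rewrite ip_jacobi_adj//; [case: hf => _ /(_ j.+1)|exact: l2_iter_jacobi_inv].
Qed.

Lemma jacobi_orth_iter f n : jacobi_orth f -> jacobi_orth (iter n jacobi_adj f).
Proof. by move=> hf; elim: n => //= n; exact: jacobi_orth_adj. Qed.

(** The adjoint differs from T by a multiple of K, which is orthogonal to the other argument. *)
Lemma jacobi_adj_sym f g : jacobi_orth f -> jacobi_orth g ->
  ip (jacobi_adj f) g = ip f (jacobi_adj g).
Proof.
move=> hf hg; have [lf fK] := hf; have [lg _] := hg.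
rewrite ip_jacobi_adj// ip_combr//; last exact: l2_jacobi_inv.
by have := fK 0; rewrite /= => ->; rewrite mulr0 add0r.
Qed.

Lemma ip_iter_jacobi_adj f g n : jacobi_orth f -> l2 g ->
  ip (iter n jacobi_adj f) g = ip f (iter n T g).
Proof.
move=> hf; elim: n g => //= n IH g hg.
rewrite ip_jacobi_adj//; last exact: jacobi_orth_iter.
by rewrite IH -?iterSr//; exact: l2_jacobi_inv.
Qed.

(* On the orthogonal complement of all [T^j K] the adjoint of the quasi-nilpotent
   operator [T] is symmetric, and a symmetric quasi-nilpotent operator vanishes. *)
Lemma jacobi_orth_eq0 f : jacobi_orth f -> f = fun=> 0.
Proof.
move=> hf; have [lf _] := hf.
pose S := l2norm jacobi_majorant ^+ 2.
have S0 : 0 <= S by rewrite exprn_ge0 ?l2norm_ge0.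
pose y n := l2norm (iter n jacobi_adj f).
have lS n : l2 (iter n jacobi_adj f) by case: (jacobi_orth_iter n hf).
(* The square of y (n+1) is the inner product of f with T^(n+1) applied to the (n+1)-st adjoint
   iterate. The decay of T^(n+1) leaves a factor y (n+1) on the right, which is divided out. *)
have yS n : y n.+1 <= l2norm f * (S * (S ^+ n / n`!%:R)).
  have [->|p] := eqVneq (y n.+1) 0.
    apply: mulr_ge0 (l2norm_ge0 _) _; apply: mulr_ge0 => //.
    by apply: divr_ge0 => //; exact: exprn_ge0.
  have p0 : 0 < y n.+1 by rewrite lt_def p l2norm_ge0.
  rewrite -(ler_pM2r p0) -{1}expr2 /y sqr_l2norm// ip_iter_jacobi_adj//.
  apply: le_trans (ler_norm _) _.
  apply: le_trans (CauchySchwarz lf (l2_iter_jacobi_inv _ (lS _))) _.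
  rewrite -mulrA ler_wpM2l ?l2norm_ge0//.
  by have [_] := jacobi_inv_iter_decay n (lS n.+1).
have y1 : y 1 = 0.
  (* Symmetry moves one adjoint across the inner product, so Cauchy-Schwarz gives log-convexity of
     the norms of the iterates. *)
  apply: logconvex_small => [n|n|r r0]; first exact: l2norm_ge0.
    rewrite /y sqr_l2norm// /= jacobi_adj_sym; last 2 first.
    - exact: jacobi_orth_iter.
    - by apply: jacobi_orth_adj; exact: jacobi_orth_iter.
    apply: le_trans (ler_norm _) _.
    exact: (CauchySchwarz (lS n) (lS n.+2)).
  exists (l2norm f + l2norm f * S * expR (S / r) / r) => -[|n].
    rewrite expr0 mulr1 lerDl; apply: divr_ge0 (ltW r0).
    by apply: mulr_ge0 (expR_ge0 _); apply: mulr_ge0 => //; exact: l2norm_ge0.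
  apply: le_trans (yS n) _.
  have h := @exp_coeff_le R (S / r) n (divr_ge0 S0 (ltW r0)).
  rewrite mulrDl; apply: le_trans (_ : _ <= l2norm f * S * expR (S / r) / r * r ^+ n.+1) _; last first.
    by rewrite lerDr mulr_ge0 ?l2norm_ge0// exprn_ge0// ltW.
  have -> : l2norm f * S * expR (S / r) / r * r ^+ n.+1 =
      l2norm f * (S * (expR (S / r) * r ^+ n)).
    by rewrite exprS; field; rewrite gt_eqF.
  apply: ler_wpM2l; first exact: l2norm_ge0.
  apply: ler_wpM2l => //.
  by rewrite -ler_pdivrMr ?exprn_gt0//; move: h; rewrite expr_div_n mulrAC.
(* So <f, L> K + T f = 0; applying the Jacobi matrix, which kills K and inverts T, leaves f = 0. *)
have e := l2norm_eq0 (lS 1) y1; rewrite /= in e.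
have : jacobi w w (jacobi_adj f) = jacobi w w (fun=> 0) by rewrite e.
move=> h; apply/funext => n.
have h2 := congr1 (@^~ n) (jacobi_invK w0 f); have h3 := congr1 (@^~ n) (jacobi_sol_ker w0).
have := congr1 (@^~ n) h; rewrite /= in h2 h3 *.
rewrite -h2.
have -> : jacobi w w (jacobi_adj f) n = ip f L * jacobi w w K n + jacobi w w (T f) n.
  by rewrite /jacobi /jacobi_adj; case: (n) => [|m]; ring.
rewrite h3 mulr0 add0r => ->.
by rewrite /jacobi; case: (n) => [|m]; rewrite !mulr0 addr0.
Qed.

Lemma jacobi_dense f (eps : R) : l2 f -> 0 < eps -> exists n (c : nat -> R),
  l2norm (fun k => f k - \sum_(i < n) c i * iter i T K k) < eps.
Proof.
pose M := [set m : nat -> R | exists n (c : nat -> R),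
  m = fun k => \sum_(i < n) c i * iter i T K k].
move=> hf e0.
have pad n (c : nat -> R) N : (n <= N)%N -> (fun k => \sum_(i < n) c i * iter i T K k) =
    (fun k => \sum_(i < N) (if (i < n)%N then c i else 0) * iter i T K k).
  move=> nN; apply/funext => k.
  rewrite (big_ord_widen N (fun i => c i * iter i T K k) nN) [LHS]big_mkcond /=.
  by apply: eq_bigr => i _; case: ifP; rewrite ?mul0r.
have Ml2 : M `<=` @l2 R.
  move=> _ [n [c ->]]; elim: n => [|n IH].
    by under eq_fun do rewrite big_ord0; exact: l2_0.
  under eq_fun do rewrite big_ord_recr /=.
  by apply: l2D => //; apply: l2Z; exact: l2_iter_jacobi_inv.
have M0 : M (fun=> 0) by exists 0%N, (fun=> 0); apply/funext => k; rewrite big_ord0.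
have Mc a (m1 m2 : nat -> R) : M m1 -> M m2 -> M (fun k => a * m1 k + m2 k).
  move=> [n1 [c1 E1]] [n2 [c2 E2]].
  rewrite (pad _ _ _ (leq_maxl n1 n2)) in E1.
  rewrite (pad _ _ _ (leq_maxr n1 n2)) in E2.
  rewrite {}E1 {}E2.
  eexists; exists (fun i => a * (if (i < n1)%N then c1 i else 0) +
                          (if (i < n2)%N then c2 i else 0)).
  apply/funext => k; rewrite mulr_sumr -big_split /=.
  by apply: eq_bigr => i _; rewrite mulrDl mulrA.
have [|m [n [c ->]] h] := dense_of_orthogonal Ml2 M0 Mc _ hf e0; last by exists n, c.
move=> g hg orth; apply: jacobi_orth_eq0; split=> // j; apply: orth.
exists j.+1, (fun i => (i == j)%:R); apply/funext => k.
rewrite big_ord_recr /= eqxx mul1r big1 ?add0r// => i _.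
by rewrite ltn_eqF ?mul0r.
Qed.

End JacobiReal.

(** * Entire functions are power series *)

Section ComplexDerivative.
Variable R : realType.
Implicit Types (f g : R[i] -> R[i]) (z w : R[i]).

Lemma complex_gt0 (e : R[i]) : 0 < e -> exists2 r : R, 0 < r & e = r%:C.
Proof.
case: e => x y; rewrite ltcE /= => /andP[/eqP -> x0]; exists x => //.
Qed.

Lemma nbhs_normcP (z : R[i]) (P : set R[i]) :
  nbhs z P <-> exists2 d : R, 0 < d & forall w, normc (w - z) < d -> P w.
Proof.
split.
  move=> /nbhs_ballP[e /= /complex_gt0[r r0 ->] h]; exists r => // w wz.
  apply: h; rewrite -ball_normE /ball_ /= distrC.
  by rewrite [X in X < _](_ : _ = (normc (w - z))%:C)// ltcR.
move=> [d d0 h]; apply/nbhs_ballP; exists (d%:C) => /=; first by rewrite ltcR.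
move=> w; rewrite -ball_normE /ball_ /= distrC.
by rewrite [X in X < _](_ : _ = (normc (w - z))%:C)// ltcR => /h.
Qed.

Lemma cvg_normcP (u : nat -> R[i]) (l : R[i]) : u @ \oo --> l <->
  forall eps : R, 0 < eps -> exists N, forall n, (N <= n)%N -> normc (u n - l) < eps.
Proof.
split.
  move=> h eps e0.
  have : nbhs l [set w | normc (w - l) < eps] by apply/nbhs_normcP; exists eps.
  by move=> /h [N _ hN]; exists N => n /hN.
move=> h P /nbhs_normcP[d d0 hP]; have [N hN] := h d d0.
by exists N => // n /hN /hP.
Qed.

(** The norm underlying derivability on R[i] is itself complex-valued; this form has real bounds and
    no division. *)
Definition cderiv f z (d : R[i]) := forall eps : R, 0 < eps -> exists2 delta : R,
  0 < delta & forall h, normc h < delta -> normc (f (z + h) - f z - d * h) <= eps * normc h.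

Lemma is_derive_cderivP f z d : is_derive z 1 f d <-> cderiv f z d.
Proof.
have key : ((fun h : R[i] => h^-1 *: ((f \o shift z) (h *: (1 : R[i])) - f z)) @ 0^' --> d)
    <-> cderiv f z d.
  split.
    move=> h eps e0.
    have : nbhs d [set w | normc (w - d) < eps] by apply/nbhs_normcP; exists eps.
    move=> /h; rewrite /= => /nbhs_normcP[delta d0 hd]; exists delta => // k kd.
    have [->|k0] := eqVneq k 0.
      by rewrite addr0 mulr0 subrr subr0 Normc.normc0 mulr0.
    have := hd k; rewrite subr0 => /(_ kd k0).
    rewrite /shift /= [k *: _]mulr1 => hk.
    have -> : f (z + k) - f z - d * k = (k^-1 *: (f (k + z) - f z) - d) * k.
      rewrite [_ *: _](_ : _ = k^-1 * (f (k + z) - f z))//.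
      by rewrite mulrBl mulrAC mulVf// mul1r (addrC z).
    by rewrite Normc.normcM ler_wpM2r ?normc_ge0// ltW.
  move=> h P /nbhs_normcP[e e0 hP].
  have e20 : 0 < e / 2 by lra.
  have [delta d0 hd] := h _ e20.
  apply/nbhs_normcP; exists delta => // k; rewrite subr0 => kd k0 /=.
  apply: hP; rewrite /shift /= [k *: _]mulr1.
  have nk : 0 < normc k.
    by rewrite lt_def normc_ge0 andbT; apply: contra_neq k0; exact: Normc.eq0_normc.
  have -> : k^-1 *: (f (k + z) - f z) - d = k^-1 * (f (z + k) - f z - d * k).
    rewrite [_ *: _](_ : _ = k^-1 * (f (k + z) - f z))//.
    by rewrite [RHS]mulrBr [X in _ = _ - X]mulrCA mulVf// mulr1 (addrC z).
  rewrite Normc.normcM Normc.normcV -(ltr_pM2l nk) mulrA divff ?gt_eqF// mul1r.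
  apply: le_lt_trans (hd _ kd) _.
  by rewrite mulrC ltr_pM2l//; lra.
split=> [[h1 h2]|h].
  apply/key; have := h1; rewrite /derivable => /cvg_ex[l hl].
  have e : l = d by rewrite -h2; apply/esym/cvg_lim.
  by rewrite -e.
have hk := key.2 h.
apply: DeriveDef; first by apply/cvg_ex; exists d.
exact: cvg_lim hk.
Qed.

Definition holomorphic f := forall z, exists d, cderiv f z d.

Lemma entireP f : entire f <-> holomorphic f.
Proof.
split=> h z.
  exists ('D_1 f z); apply/is_derive_cderivP; apply: DeriveDef => //; exact: h.
by have [d /is_derive_cderivP[]] := h z.
Qed.

Lemma cderiv_derive1 f z d : cderiv f z d -> f^`()%classic z = d.
Proof. by move=> /is_derive_cderivP[h1 h2]; rewrite derive1E. Qed.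

Lemma cderiv_cont f z d : cderiv f z d -> forall eps : R, 0 < eps ->
  exists2 delta : R, 0 < delta & forall h, normc h < delta -> normc (f (z + h) - f z) <= eps.
Proof.
move=> hf eps e0; have [delta d0 hd] := hf 1 ltr01.
have p : 0 < 1 + normc d by have := normc_ge0 d; lra.
exists (Num.min delta (eps / (1 + normc d))).
  by rewrite lt_min d0 divr_gt0.
move=> h; rewrite lt_min => /andP[h1 h2].
have -> : f (z + h) - f z = (f (z + h) - f z - d * h) + d * h by rewrite subrK.
apply: le_trans (normcD _ _) _.
apply: le_trans (lerD (hd _ h1) (lexx _)) _.
by rewrite Normc.normcM -mulrDl mulrC -ler_pdivlMr// ltW.
Qed.

Lemma cderiv_ext f g z d : (forall w, f w = g w) -> cderiv f z d -> cderiv g z d.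
Proof. by move=> fg; have -> : f = g by apply/funext. Qed.

Lemma cderiv_near f g z d (r : R) : 0 < r ->
  (forall h, normc h < r -> f (z + h) = g (z + h)) -> cderiv f z d -> cderiv g z d.
Proof.
move=> r0 fg hf eps e0; have [delta d0 hd] := hf eps e0.
exists (Num.min delta r); first by rewrite lt_min d0.
move=> h; rewrite lt_min => /andP[h1 h2].
have := fg 0; rewrite Normc.normc0 addr0 => /(_ r0) <-.
by rewrite -fg// hd.
Qed.

Lemma cderiv_comp f g z a b : cderiv g z b -> cderiv f (g z) a ->
  cderiv (f \o g) z (a * b).
Proof.
move=> hg hf eps e0.
have pb : 0 < normc b + 1 by have := normc_ge0 b; lra.
have pa : 0 < normc a + 1 by have := normc_ge0 a; lra.
have e1 : 0 < eps / 2 / (normc b + 1) by rewrite divr_gt0//; lra.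
have e2 : 0 < eps / 2 / (normc a + 1) by rewrite divr_gt0//; lra.
have [d1 d10 h1] := hf _ e1.
have [d2 d20 h2] := hg _ e2.
have [d3 d30 h3] := hg _ ltr01.
exists (Num.min (Num.min d2 d3) (d1 / (normc b + 1))).
  by rewrite !lt_min d20 d30 divr_gt0.
move=> h; rewrite !lt_min => /andP[/andP[hd2 hd3] hd1] /=.
set k := g (z + h) - g z.
have kE : g (z + h) = g z + k by rewrite /k addrCA subrr addr0.
have kle : normc k <= (normc b + 1) * normc h.
  have -> : k = (k - b * h) + b * h by rewrite subrK.
  apply: le_trans (normcD _ _) _; rewrite Normc.normcM.
  by have := h3 _ hd3; rewrite -/k; lra.
have kd : normc k < d1.
  by apply: le_lt_trans kle _; rewrite mulrC -ltr_pdivlMr.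
rewrite kE.
have -> : f (g z + k) - f (g z) - a * b * h =
    (f (g z + k) - f (g z) - a * k) + a * (k - b * h) by ring.
apply: le_trans (normcD _ _) _.
have i1 : normc (f (g z + k) - f (g z) - a * k) <= eps / 2 * normc h.
  apply: le_trans (h1 _ kd) _.
  apply: le_trans (ler_wpM2l (ltW e1) kle) _.
  by rewrite mulrA divfK// gt_eqF.
have i2 : normc (a * (k - b * h)) <= eps / 2 * normc h.
  rewrite Normc.normcM.
  apply: le_trans (ler_wpM2l (normc_ge0 _) (h2 _ hd2)) _.
  rewrite mulrA ler_wpM2r ?normc_ge0// mulrCA ler_piMr//; first lra.
  by rewrite ler_pdivrMr// mul1r; lra.
by have := lerD i1 i2; rewrite -mulrDl -splitr.
Qed.

Lemma cderiv_cst (c z : R[i]) : cderiv (fun=> c) z 0.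
Proof. by apply/is_derive_cderivP; exact: is_derive_cst. Qed.

Lemma cderiv_id z : cderiv id z 1.
Proof. by apply/is_derive_cderivP; exact: is_derive_id. Qed.

Lemma cderivD f g z a b : cderiv f z a -> cderiv g z b ->
  cderiv (fun w => f w + g w) z (a + b).
Proof.
by move=> /is_derive_cderivP hf /is_derive_cderivP hg; apply/is_derive_cderivP;
   exact: is_deriveD.
Qed.

Lemma cderivM f g z a b : cderiv f z a -> cderiv g z b ->
  cderiv (fun w => f w * g w) z (f z * b + g z * a).
Proof.
by move=> /is_derive_cderivP hf /is_derive_cderivP hg; apply/is_derive_cderivP;
   exact: is_deriveM.
Qed.

Lemma cderivZ (c : R[i]) f z a : cderiv f z a -> cderiv (fun w => c * f w) z (c * a).
Proof.
by move=> hf; have := cderivM (cderiv_cst c z) hf; rewrite mulr0 addr0.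
Qed.

Lemma cderiv_inv z : z != 0 -> cderiv (fun w => w^-1) z (- z ^- 2).
Proof.
move=> z0 eps e0.
have nz : 0 < normc z.
  by rewrite lt_def normc_ge0 andbT; apply: contra_neq z0; exact: Normc.eq0_normc.
exists (Num.min (normc z / 2) (eps * normc z ^+ 3 / 2)).
  by rewrite lt_min; apply/andP; split; [lra|rewrite divr_gt0 ?mulr_gt0 ?exprn_gt0].
move=> h; rewrite lt_min => /andP[h1 h2].
have zh : normc z / 2 <= normc (z + h).
  have := normcD (z + h) (- h); rewrite addrK normcNE; lra.
have zh0 : z + h != 0.
  by apply/eqP => e; move: zh; rewrite e Normc.normc0; lra.
have -> : (z + h)^-1 - z^-1 - - z ^- 2 * h = h ^+ 2 / (z ^+ 2 * (z + h)).
  by field; rewrite z0 zh0.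
rewrite Normc.normcM normcX Normc.normcV Normc.normcM normcX.
rewrite ler_pdivrMr; last by rewrite mulr_gt0 ?exprn_gt0//; lra.
rewrite expr2 mulrAC ler_wpM2r ?normc_ge0//.
apply: le_trans (ltW h2) _.
have -> : eps * normc z ^+ 3 / 2 = eps * (normc z ^+ 2 * (normc z / 2)) by field.
by rewrite !ler_wpM2l// ?exprn_ge0 ?normc_ge0// ltW.
Qed.

Lemma cderiv_unique f z a b : cderiv f z a -> cderiv f z b -> a = b.
Proof. by move=> /cderiv_derive1 <- /cderiv_derive1 <-. Qed.

End ComplexDerivative.

(** * Primitives of continuous real functions *)

Section RealPrimitive.
Variable R : realType.
Implicit Types g G : R -> R.

Lemma is_derive_eps g (x d : R) : (forall eps : R, 0 < eps -> exists2 delta : R,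
    0 < delta & forall h, `|h| < delta -> `|g (x + h) - g x - d * h| <= eps * `|h|) ->
  is_derive x 1 g d.
Proof.
move=> H.
have key : (fun h : R => h^-1 *: ((g \o shift x) (h *: (1 : R)) - g x)) @ 0^' --> d.
  apply/cvgrPdist_le => e e0; have [delta d0 hd] := H _ e0.
  near=> k.
  have k0 : k != 0 by near: k; exact: nbhs_dnbhs_neq.
  have kd : `|k| < delta.
    near: k; apply: nbhs_dnbhs; exists delta => //= t.
    by rewrite /ball_/= sub0r normrN.
  have nk : 0 < `|k| by rewrite normr_gt0.
  rewrite /shift /= [k *: _]mulr1 distrC.
  have -> : k^-1 *: (g (k + x) - g x) - d = k^-1 * (g (x + k) - g x - d * k).
    by rewrite mulrBr mulrCA mulVf// mulr1 (addrC x).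
  rewrite normrM normfV -(ler_pM2l nk) mulrA divff ?gt_eqF// mul1r.
  by rewrite [leRHS]mulrC hd.
apply: DeriveDef; first by apply/cvg_ex; exists d.
exact: cvg_lim key.
Unshelve. all: by end_near.
Qed.

(** The integral over an interval with reversed ends is 0, so the two signs are treated separately
    in the witness; near x both branches agree with an integral from a point to the left. *)
Lemma ex_primitive g : continuous g -> exists G, forall x : R, is_derive x 1 G (g x).
Proof.
move=> cg.
pose I a b := \int[lebesgue_measure]_(t in `[a, b]) g t.
have ig a b : lebesgue_measure.-integrable `[a, b] (EFin \o g).
  apply: continuous_compact_integrable; first exact: segment_compact.
  exact: continuous_subspaceT.
have IB a b c : a <= b -> b <= c -> I a c = I a b + I b c.
  move=> ab bc; rewrite /I.
  have := @Rintegral_itvB R g (BLeft a) (BRight c) b (ig a c).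
  rewrite !bnd_simp => /(_ ab bc).
  rewrite Rintegral_itv_obnd_cbnd; last first.
    apply: integrableS (ig b c) => //.
    by move=> t /=; rewrite !in_itv /= => /andP[/ltW -> ->].
  by move/eqP; rewrite subr_eq addrC => /eqP.
exists (fun x => if 0 <= x then I 0 x else - I x 0) => x.
(* Strictly left of both x and 0, so one formula covers a whole neighbourhood of x, even at x =
   0. *)
pose c := Num.min x 0 - 1.
have cx : c < x by rewrite /c; have := ge_min x x 0; rewrite lexx /=; lra.
have c0 : c < 0 by rewrite /c; have := ge_min 0 x 0; rewrite lexx orbT /=; lra.
have [h1 h2] := @continuous_FTC1_closed R g c x (x + 1) ltac:(lra) (ig _ _) cx (cg x).
have hI : is_derive x 1 (fun y => I c y - I c 0) (g x).
  have h : is_derive x 1 (I c) (g x).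
    by apply: (DeriveDef h1); rewrite -derive1E; exact: h2.
  by rewrite -[g x]subr0; apply: is_deriveB.
apply: (near_eq_is_derive _ hI); near=> y.
have cy : c < y by near: y; exact: lt_nbhsr.
case: (leP 0 y) => y0.
  have := @IB c 0 y (ltW c0) y0; lra.
by have := @IB c y 0 (ltW cy) (ltW y0); lra.
Unshelve. all: by end_near.
Qed.

(** A chosen primitive makes integrals differences G b - G a: additive and antisymmetric in the end
    points whether or not a <= b. *)
Definition primitive g : R -> R := xget (fun=> 0) [set G | forall x : R, is_derive x 1 G (g x)].

Lemma primitiveP g : continuous g -> forall x : R, is_derive x 1 (primitive g) (g x).
Proof.
move=> cg; have [G hG] := ex_primitive cg.
by rewrite /primitive; case: xgetP => [G' _ h|/(_ G)].
Qed.

Lemma is_derive_continuous g g' : (forall x : R, is_derive x 1 g (g' x)) -> continuous g.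
Proof.
move=> h x; apply: differentiable_continuous; apply/derivable1_diffP.
by case: (h x).
Qed.

Lemma primitive_sub g G (a b : R) : (forall x : R, is_derive x 1 G (g x)) -> continuous g ->
  primitive g b - primitive g a = G b - G a.
Proof.
move=> hG cg.
have h (x : R) : is_derive x 1 (fun y => primitive g y - G y) (0 : R).
  by rewrite -[0](subrr (g x)); apply: is_deriveB; exact: primitiveP.
have /= := is_derive_0_is_cst a b h; lra.
Qed.

Lemma primitive_bound g (a b M : R) : continuous g ->
  (forall x, Num.min a b <= x <= Num.max a b -> `|g x| <= M) ->
  `|primitive g b - primitive g a| <= M * `|b - a|.
Proof.
move=> cg.
wlog ab : a b / a <= b.
  move=> W; case/orP: (le_total a b) => h; first exact: W.
  by rewrite minC maxC distrC (distrC b) => hM; exact: W.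
rewrite min_l// max_r// => hM.
move: ab; rewrite le_eqVlt => /predU1P[->|ab].
  by rewrite !subrr normr0 mulr0.
have [c cab ->] := MVT ab (fun x _ => primitiveP cg x)
  (continuous_subspaceT (is_derive_continuous (primitiveP cg))).
rewrite normrM ler_wpM2r// hM//.
by move: cab; rewrite in_itv /= => /andP[/ltW -> /ltW ->].
Qed.

End RealPrimitive.

(** * Integrals of complex functions of a real variable *)

Section ComplexIntegral.
Variable R : realType.
Implicit Types (g : R -> R[i]) (f F : R[i] -> R[i]).
Local Notation Re := (@complex.Re R).
Local Notation Im := (@complex.Im R).

Definition rcont g := continuous (Re \o g) /\ continuous (Im \o g).

Definition rderive (G : R -> R[i]) (x : R) (d : R[i]) :=
  is_derive x 1 (Re \o G) (Re d) /\ is_derive x 1 (Im \o G) (Im d).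

(* Integral of a continuous [g] from [a] to [b], for either order of [a] and [b]. *)
Definition cint g (a b : R) : R[i] :=
  (primitive (Re \o g) b - primitive (Re \o g) a) +i*
  (primitive (Im \o g) b - primitive (Im \o g) a).

Lemma complexE (z : R[i]) : z = Re z +i* Im z.
Proof. by case: z. Qed.

Lemma ReM (z w : R[i]) : Re (z * w) = Re z * Re w - Im z * Im w.
Proof. by case: z; case: w. Qed.

Lemma ImM (z w : R[i]) : Im (z * w) = Re z * Im w + Im z * Re w.
Proof. by case: z => ? ?; case: w. Qed.

Lemma ReD (z w : R[i]) : Re (z + w) = Re z + Re w.
Proof. by case: z; case: w. Qed.

Lemma ImD (z w : R[i]) : Im (z + w) = Im z + Im w.
Proof. by case: z => ? ?; case: w. Qed.

Lemma ReN (z : R[i]) : Re (- z) = - Re z. Proof. by case: z. Qed.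
Lemma ImN (z : R[i]) : Im (- z) = - Im z. Proof. by case: z. Qed.

Lemma cint_cat g a b c : cint g a b + cint g b c = cint g a c.
Proof. by apply/eqP; rewrite eq_complex /=; apply/andP; split; apply/eqP; ring. Qed.

Lemma rderive_cont (G g : R -> R[i]) : (forall x, rderive G x (g x)) -> rcont G.
Proof.
move=> h; split.
  by apply: (@is_derive_continuous R _ (Re \o g)) => x; case: (h x).
by apply: (@is_derive_continuous R _ (Im \o g)) => x; case: (h x).
Qed.

Lemma cint_primitive (G g : R -> R[i]) a b : rcont g ->
  (forall x, rderive G x (g x)) -> cint g a b = G b - G a.
Proof.
move=> [c1 c2] h; rewrite /cint.
have e1 := primitive_sub a b (fun x => proj1 (h x)) c1.
have e2 := primitive_sub a b (fun x => proj2 (h x)) c2.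
rewrite e1 e2 /=.
by case: (G a) (G b) => [? ?] [].
Qed.

Lemma rcontM g1 g2 : rcont g1 -> rcont g2 -> rcont (fun x => g1 x * g2 x).
Proof.
move=> [a1 b1] [a2 b2]; split.
  have -> : Re \o (fun x => g1 x * g2 x) =
      (fun x => (Re \o g1) x * (Re \o g2) x - (Im \o g1) x * (Im \o g2) x).
    by apply/funext => x; rewrite /= ReM.
  by move=> x; apply: cvgB; apply: cvgM; [exact: a1|exact: a2|exact: b1|exact: b2].
have -> : Im \o (fun x => g1 x * g2 x) =
    (fun x => (Re \o g1) x * (Im \o g2) x + (Im \o g1) x * (Re \o g2) x).
  by apply/funext => x; rewrite /= ImM.
by move=> x; apply: cvgD; apply: cvgM; [exact: a1|exact: b2|exact: b1|exact: a2].
Qed.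

Lemma rcontD g1 g2 : rcont g1 -> rcont g2 -> rcont (fun x => g1 x + g2 x).
Proof.
move=> [a1 b1] [a2 b2]; split.
  have -> : Re \o (fun x => g1 x + g2 x) = (fun x => (Re \o g1) x + (Re \o g2) x).
    by apply/funext => x; rewrite /= ReD.
  by move=> x; apply: cvgD; [exact: a1|exact: a2].
have -> : Im \o (fun x => g1 x + g2 x) = (fun x => (Im \o g1) x + (Im \o g2) x).
  by apply/funext => x; rewrite /= ImD.
by move=> x; apply: cvgD; [exact: b1|exact: b2].
Qed.

Lemma rcont_cst (c : R[i]) : rcont (fun=> c).
Proof. by split=> x; exact: cvg_cst. Qed.

Lemma rcontZ (c : R[i]) g : rcont g -> rcont (fun x => c * g x).
Proof. by move=> hg; apply: rcontM => //; exact: rcont_cst. Qed.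

Lemma rcontB g1 g2 : rcont g1 -> rcont g2 -> rcont (fun x => g1 x - g2 x).
Proof.
move=> h1 h2; have := rcontD h1 (rcontZ (-1) h2).
by congr rcont; apply/funext => x; rewrite mulN1r.
Qed.

Let cprim g x : R[i] := primitive (Re \o g) x +i* primitive (Im \o g) x.

Let cprimP g x : rcont g -> rderive (cprim g) x (g x).
Proof.
move=> [h1 h2]; split.
  exact: (primitiveP h1 x).
exact: (primitiveP h2 x).
Qed.

Let cintE g a b : cint g a b = cprim g b - cprim g a.
Proof. by []. Qed.

Lemma rderiveD (G1 G2 : R -> R[i]) x d1 d2 : rderive G1 x d1 -> rderive G2 x d2 ->
  rderive (fun y => G1 y + G2 y) x (d1 + d2).
Proof.
move=> [a1 b1] [a2 b2]; split.
  have -> : Re \o (fun y => G1 y + G2 y) = (fun y => (Re \o G1) y + (Re \o G2) y).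
    by apply/funext => y; rewrite /= ReD.
  by rewrite ReD; exact: is_deriveD.
have -> : Im \o (fun y => G1 y + G2 y) = (fun y => (Im \o G1) y + (Im \o G2) y).
  by apply/funext => y; rewrite /= ImD.
by rewrite ImD; exact: is_deriveD.
Qed.

Lemma rderiveZ (c : R[i]) (G : R -> R[i]) x d : rderive G x d ->
  rderive (fun y => c * G y) x (c * d).
Proof.
move=> [a b]; split.
  have -> : Re \o (fun y => c * G y) =
     (fun y => Re c * (Re \o G) y - Im c * (Im \o G) y).
    by apply/funext => y; rewrite /= ReM.
  by rewrite ReM; apply: is_deriveB; exact: is_deriveZ.
have -> : Im \o (fun y => c * G y) =
     (fun y => Re c * (Im \o G) y + Im c * (Re \o G) y).
  by apply/funext => y; rewrite /= ImM.
by rewrite ImM; apply: is_deriveD; exact: is_deriveZ.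
Qed.

Lemma cint_comb (c : R[i]) g1 g2 a b : rcont g1 -> rcont g2 ->
  cint (fun x => c * g1 x + g2 x) a b = c * cint g1 a b + cint g2 a b.
Proof.
move=> h1 h2.
rewrite (@cint_primitive (fun x => c * cprim g1 x + cprim g2 x)); last 2 first.
- by apply: rcontD => //; exact: rcontZ.
- by move=> x; apply: rderiveD; [apply: rderiveZ|]; exact: cprimP.
rewrite !cintE; ring.
Qed.

Lemma cintZ (c : R[i]) g a b : rcont g -> cint (fun x => c * g x) a b = c * cint g a b.
Proof.
move=> h; rewrite (@cint_primitive (fun x => c * cprim g x)); last 2 first.
- exact: rcontZ.
- by move=> x; apply: rderiveZ; exact: cprimP.
by rewrite cintE mulrBr.
Qed.

Lemma cintD g1 g2 a b : rcont g1 -> rcont g2 ->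
  cint (fun x => g1 x + g2 x) a b = cint g1 a b + cint g2 a b.
Proof.
move=> h1 h2; have := cint_comb 1 a b h1 h2.
by rewrite mul1r => <-; congr cint; apply/funext => x; rewrite mul1r.
Qed.

Lemma cintB g1 g2 a b : rcont g1 -> rcont g2 ->
  cint (fun x => g1 x - g2 x) a b = cint g1 a b - cint g2 a b.
Proof.
move=> h1 h2; have := cint_comb (-1) a b h2 h1.
rewrite mulN1r addrC => <-; congr cint.
by apply/funext => x; rewrite mulN1r addrC.
Qed.

Lemma cint_sum (n : nat) (g : nat -> R -> R[i]) a b : (forall k, rcont (g k)) ->
  rcont (fun x => \sum_(k < n) g k x) /\
  cint (fun x => \sum_(k < n) g k x) a b = \sum_(k < n) cint (g k) a b.
Proof.
move=> h; elim: n => [|n [IH1 IH2]].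
  split; first by under eq_fun do rewrite big_ord0; exact: rcont_cst.
  under eq_fun do rewrite big_ord0; rewrite big_ord0.
  transitivity (cint (fun=> 0 * (0 : R[i])) a b).
    by congr cint; apply/funext => x; rewrite mul0r.
  by rewrite (cintZ 0 a b (rcont_cst 0)) mul0r.
split.
  by under eq_fun do rewrite big_ord_recr /=; exact: rcontD.
by under eq_fun do rewrite big_ord_recr /=; rewrite big_ord_recr /= cintD// IH2.
Qed.

(** The factor 2 comes from bounding real and imaginary parts separately, and is harmless in all
    later estimates. *)
Lemma cint_bound g (a b M : R) : rcont g ->
  (forall x, Num.min a b <= x <= Num.max a b -> normc (g x) <= M) ->
  normc (cint g a b) <= 2 * M * `|b - a|.
Proof.
move=> [h1 h2] hM.
apply: le_trans (normc_le_ReIm _) _ => /=.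
have i1 : `|primitive (Re \o g) b - primitive (Re \o g) a| <= M * `|b - a|.
  by apply: primitive_bound => // x /hM; apply: le_trans; exact: normc_Re.
have i2 : `|primitive (Im \o g) b - primitive (Im \o g) a| <= M * `|b - a|.
  by apply: primitive_bound => // x /hM; apply: le_trans; exact: normc_Im.
have -> : 2 * M * `|b - a| = M * `|b - a| + M * `|b - a| by ring.
exact: lerD.
Qed.

Lemma cderiv_line f (u v : R[i]) (t : R) d : cderiv f (u + v * t%:C) d ->
  rderive (fun s => f (u + v * s%:C)) t (v * d).
Proof.
move=> hf.
(* Real and imaginary parts are treated at once as real-linear functionals bounded by the
   modulus. *)
have key (p : R[i] -> R) : (forall z w, p (z + w) = p z + p w) ->
    (forall z, p (- z) = - p z) -> (forall (z : R[i]) (h : R), p (z * h%:C) = p z * h) ->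
    (forall z, `|p z| <= normc z) ->
    is_derive t 1 (p \o (fun s => f (u + v * s%:C))) (p (v * d)).
  move=> pD pN pZ pn; apply: is_derive_eps => eps e0.
  have pv : 0 < normc v + 1 by have := normc_ge0 v; lra.
  have e1 : 0 < eps / (normc v + 1) by rewrite divr_gt0.
  have [delta d0 hd] := hf _ e1.
  exists (delta / (normc v + 1)); first by rewrite divr_gt0.
  move=> h hlt /=.
  have nvh : normc (v * h%:C) <= (normc v + 1) * `|h|.
    by rewrite Normc.normcM normcR ler_wpM2r//; lra.
  have vhd : normc (v * h%:C) < delta.
    by apply: le_lt_trans nvh _; rewrite mulrC -ltr_pdivlMr.
  have -> : p (f (u + v * (t + h)%:C)) - p (f (u + v * t%:C)) - p (v * d) * h =
      p (f (u + v * t%:C + v * h%:C) - f (u + v * t%:C) - d * (v * h%:C)).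
    rewrite !pD !pN -pZ; congr (p (f _) - _ - p _); last by ring.
    by rewrite rmorphD /=; ring.
  apply: le_trans (pn _) _; apply: le_trans (hd _ vhd) _.
  apply: le_trans (ler_wpM2l (ltW e1) nvh) _.
  by rewrite mulrA divfK// gt_eqF.
split; apply: key.
- exact: ReD.
- exact: ReN.
- by move=> z h; rewrite ReM /= mulr0 subr0.
- exact: normc_Re.
- exact: ImD.
- exact: ImN.
- by move=> z h; rewrite ImM /= mulr0 add0r.
- exact: normc_Im.
Qed.

Lemma holomorphic_rcont_line f (u v : R[i]) : holomorphic f ->
  rcont (fun s => f (u + v * s%:C)).
Proof.
move=> hf; have [d hd] := choice hf.
by apply: (@rderive_cont _ (fun t => v * d (u + v * t%:C))) => t; exact: cderiv_line.
Qed.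

End ComplexIntegral.

(** * Goursat's theorem on rectangles *)

Section Goursat.
Variable R : realType.
Implicit Types (f F : R[i] -> R[i]) (z w h a d : R[i]) (x y : R).
Local Notation Re := (@complex.Re R).
Local Notation Im := (@complex.Im R).

Definition iC : R[i] := 0 +i* 1.

Lemma normc_iC : normc iC = 1.
Proof. by rewrite /= expr0n /= add0r expr1n sqrtr1. Qed.

Lemma complexRI (x y : R) : x +i* y = x%:C + iC * y%:C.
Proof. by apply/eqP; rewrite eq_complex /=; apply/andP; split; apply/eqP; ring. Qed.

Lemma horizE (x y : R) : (0 +i* y) + 1 * x%:C = x +i* y.
Proof. by rewrite mul1r; apply/eqP; rewrite eq_complex /= add0r addr0 !eqxx. Qed.

Definition hint f y (a b : R) := cint (fun t => f ((0 +i* y) + 1 * t%:C)) a b.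
Definition vint f x (a b : R) := cint (fun t => f (x%:C + iC * t%:C)) a b.

(** Integrals from one corner to the opposite one along the two pairs of sides, named by the order
    of horizontal and vertical sides. Their difference is the integral around the rectangle, whose
    corners may come in any order. *)
Definition path_hv f (x1 y1 x2 y2 : R) := hint f y1 x1 x2 + iC * vint f x2 y1 y2.
Definition path_vh f (x1 y1 x2 y2 : R) := iC * vint f x1 y1 y2 + hint f y2 x1 x2.

Definition affine_prim a d z0 w := a * w + d / 2 * ((w - z0) * (w - z0)).

Lemma cderiv_affine_prim a d z0 z :
  cderiv (affine_prim a d z0) z (a + d * (z - z0)).
Proof.
have h1 : cderiv (fun w => a * w) z (a * 1) by apply: cderivZ; exact: cderiv_id.
have h2 : cderiv (fun w => w - z0) z (1 + 0).
  by apply: cderivD; [exact: cderiv_id|exact: cderiv_cst].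
have := cderivD h1 (cderivZ (d / 2) (cderivM h2 h2)).
by congr cderiv; field.
Qed.

Lemma line_affine_estimate f a d z0 (u v : R[i]) (s t M : R) : holomorphic f ->
  (forall r, Num.min s t <= r <= Num.max s t ->
     normc (f (u + v * r%:C) - a - d * (u + v * r%:C - z0)) <= M) ->
  normc (v * cint (fun r => f (u + v * r%:C)) s t -
    (affine_prim a d z0 (u + v * t%:C) - affine_prim a d z0 (u + v * s%:C))) <=
  normc v * (2 * M * `|t - s|).
Proof.
move=> hf hM; pose P := affine_prim a d z0.
have cf := holomorphic_rcont_line u v hf.
pose A (w : R[i]) := a + d * (w - z0).
have hA : holomorphic A.
  move=> w; exists (0 + d * (1 + 0)); apply: cderivD; first exact: cderiv_cst.
  by apply: cderivZ; apply: cderivD; [exact: cderiv_id|exact: cderiv_cst].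
have cA := holomorphic_rcont_line u v hA.
have eP : v * cint (fun r => A (u + v * r%:C)) s t = P (u + v * t%:C) - P (u + v * s%:C).
  rewrite -cintZ//; apply: (@cint_primitive R (fun r => P (u + v * r%:C))).
    exact: rcontZ.
  by move=> r; apply: cderiv_line; exact: cderiv_affine_prim.
rewrite -/P -eP -mulrBr Normc.normcM ler_wpM2l ?normc_ge0// -cintB//.
apply: cint_bound; first exact: rcontB.
by move=> r /hM; rewrite /A opprD addrA.
Qed.

Local Notation P := affine_prim.

(** The affine part of f integrates exactly through [affine_prim], so only the remainder, at most M,
    contributes. The estimate serves both for Goursat's theorem and for the second-order expansion
    of the primitive. *)
Lemma path_affine_estimate f a d z0 (x1 y1 x2 y2 M : R) : holomorphic f ->
  (forall x y, Num.min x1 x2 <= x <= Num.max x1 x2 ->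
     Num.min y1 y2 <= y <= Num.max y1 y2 ->
     normc (f (x +i* y) - a - d * ((x +i* y) - z0)) <= M) ->
  let D := P a d z0 (x2 +i* y2) - P a d z0 (x1 +i* y1) in
  normc (path_hv f x1 y1 x2 y2 - D) <= 2 * M * (`|x2 - x1| + `|y2 - y1|) /\
  normc (path_vh f x1 y1 x2 y2 - D) <= 2 * M * (`|x2 - x1| + `|y2 - y1|).
Proof.
move=> hf hM D.
have mx1 : Num.min x1 x2 <= x1 <= Num.max x1 x2 by rewrite ge_min le_max lexx.
have mx2 : Num.min x1 x2 <= x2 <= Num.max x1 x2 by rewrite ge_min le_max lexx !orbT.
have my1 : Num.min y1 y2 <= y1 <= Num.max y1 y2 by rewrite ge_min le_max lexx.
have my2 : Num.min y1 y2 <= y2 <= Num.max y1 y2 by rewrite ge_min le_max lexx !orbT.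
have eh y : Num.min y1 y2 <= y <= Num.max y1 y2 ->
    normc (hint f y x1 x2 - (P a d z0 (x2 +i* y) - P a d z0 (x1 +i* y))) <= 2 * M * `|x2 - x1|.
  move=> hy.
  have := @line_affine_estimate f a d z0 (0 +i* y) 1 x1 x2 M hf.
  rewrite mul1r !horizE Normc.normc1 mul1r; apply => r hr.
  by rewrite horizE; exact: hM.
have ev x : Num.min x1 x2 <= x <= Num.max x1 x2 ->
    normc (iC * vint f x y1 y2 - (P a d z0 (x +i* y2) - P a d z0 (x +i* y1))) <= 2 * M * `|y2 - y1|.
  move=> hx.
  have := @line_affine_estimate f a d z0 (x%:C) iC y1 y2 M hf.
  rewrite -!complexRI normc_iC mul1r; apply => r hr.
  by rewrite -complexRI; exact: hM.
split.
  have -> : path_hv f x1 y1 x2 y2 - D =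
    (hint f y1 x1 x2 - (P a d z0 (x2 +i* y1) - P a d z0 (x1 +i* y1))) +
    (iC * vint f x2 y1 y2 - (P a d z0 (x2 +i* y2) - P a d z0 (x2 +i* y1))).
    by rewrite /path_hv /D; ring.
  by apply: le_trans (normcD _ _) _; rewrite mulrDr; apply: lerD; [exact: eh|exact: ev].
have -> : path_vh f x1 y1 x2 y2 - D =
  (iC * vint f x1 y1 y2 - (P a d z0 (x1 +i* y2) - P a d z0 (x1 +i* y1))) +
  (hint f y2 x1 x2 - (P a d z0 (x2 +i* y2) - P a d z0 (x1 +i* y2))).
  by rewrite /path_vh /D; ring.
apply: le_trans (normcD _ _) _; rewrite mulrDr [leRHS]addrC.
by apply: lerD; [exact: ev|exact: eh].
Qed.

Definition rect_int f (x1 y1 x2 y2 : R) := path_hv f x1 y1 x2 y2 - path_vh f x1 y1 x2 y2.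

Lemma rect_splitx f (x1 y1 x2 y2 m : R) :
  rect_int f x1 y1 x2 y2 = rect_int f x1 y1 m y2 + rect_int f m y1 x2 y2.
Proof.
rewrite /rect_int /path_hv /path_vh /hint.
rewrite -(cint_cat _ x1 m x2) -(cint_cat (fun t => f (0 +i* y2 + _)) x1 m x2); ring.
Qed.

Lemma rect_splity f (x1 y1 x2 y2 m : R) :
  rect_int f x1 y1 x2 y2 = rect_int f x1 y1 x2 m + rect_int f x1 m x2 y2.
Proof.
rewrite /rect_int /path_hv /path_vh /vint.
rewrite -(cint_cat _ y1 m y2) -(cint_cat (fun t => f (x1%:C + _)) y1 m y2); ring.
Qed.

Lemma between_dist (a b s t : R) : Num.min a b <= s <= Num.max a b ->
  Num.min a b <= t <= Num.max a b -> `|s - t| <= `|b - a|.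
Proof.
wlog ab : a b / a <= b.
  move=> W; case/orP: (le_total a b) => h; first exact: W.
  by rewrite minC maxC (distrC b); exact: W.
rewrite min_l// max_r// => /andP[? ?] /andP[? ?].
rewrite (ger0_norm (_ : 0 <= b - a)) ?subr_ge0// ler_norml; apply/andP; split; lra.
Qed.

Lemma normc_dist_le (x y x' y' : R) :
  normc ((x +i* y) - (x' +i* y')) <= `|x - x'| + `|y - y'|.
Proof. exact: (normc_le_ReIm ((x +i* y) - (x' +i* y'))). Qed.

(** On a small rectangle of the nest, f differs from its affine part at the common point by at most
    eps q with q = D 2^-N, so the integral is at most 4 eps q^2 = 4 eps D^2 4^-N, against the lower
    bound c 4^-N. *)
Lemma goursat_local f (c D xs ys : R) (x y dx dy : nat -> R) : holomorphic f ->
  0 < c ->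
  (forall n, c * 4^-1 ^+ n <= normc (rect_int f (x n) (y n) (x n + dx n) (y n + dy n))) ->
  (forall n, `|dx n| + `|dy n| <= D * 2^-1 ^+ n) ->
  (forall n, Num.min (x n) (x n + dx n) <= xs <= Num.max (x n) (x n + dx n)) ->
  (forall n, Num.min (y n) (y n + dy n) <= ys <= Num.max (y n) (y n + dy n)) -> False.
Proof.
move=> hf c0 big small hx hy.
have D0 : 0 <= D.
  by have := small 0; rewrite expr0 mulr1; apply: le_trans; rewrite addr_ge0.
pose zs := xs +i* ys : R[i].
have [d hd] := hf zs.
(* Makes 4 eps D^2 smaller than c, also when D = 0. *)
pose eps := c / (4 * D ^+ 2 + 1) / 2.
have p : 0 < 4 * D ^+ 2 + 1 by have := sqr_ge0 D; lra.
have eps0 : 0 < eps by rewrite !divr_gt0.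
have [delta d0 hdelta] := hd _ eps0.
have h21 : 0 <= (2^-1 : R) < 1 by lra.
have [N hN] := geometric_small D h21 d0.
have hNN := hN N (leqnn N).
set q := D * 2^-1 ^+ N in hNN.
have q0 : 0 <= q by rewrite mulr_ge0// exprn_ge0//; lra.
have est : forall s t, Num.min (x N) (x N + dx N) <= s <= Num.max (x N) (x N + dx N) ->
     Num.min (y N) (y N + dy N) <= t <= Num.max (y N) (y N + dy N) ->
     normc (f (s +i* t) - f zs - d * ((s +i* t) - zs)) <= eps * q.
  move=> s t hs ht.
  have l1 := between_dist hs (hx N); have l2 := between_dist ht (hy N).
  have lq : normc ((s +i* t) - zs) <= q.
    apply: le_trans (normc_dist_le _ _ _ _) _.
    apply: le_trans (lerD l1 l2) _.
    by rewrite ![_ + _ - _]addrAC !subrr !add0r; exact: small.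
  have := hdelta ((s +i* t) - zs) (le_lt_trans lq hNN).
  rewrite [zs + _]addrC subrK => /le_trans; apply.
  by rewrite ler_wpM2l// ltW.
have [e1 e2] := path_affine_estimate hf est.
have := big N.
have -> : rect_int f (x N) (y N) (x N + dx N) (y N + dy N) =
  (path_hv f (x N) (y N) (x N + dx N) (y N + dy N) -
    (P (f zs) d zs ((x N + dx N) +i* (y N + dy N)) - P (f zs) d zs (x N +i* y N))) -
  (path_vh f (x N) (y N) (x N + dx N) (y N + dy N) -
    (P (f zs) d zs ((x N + dx N) +i* (y N + dy N)) - P (f zs) d zs (x N +i* y N))).
  by rewrite /rect_int; ring.
move=> h; have h' := le_trans h (normcD _ _); rewrite normcNE in h'.
have := le_trans h' (lerD e1 e2).
rewrite ![_ + _ - _]addrAC !subrr !add0r => h3.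
have sq : `|dx N| + `|dy N| <= q by exact: small.
have l4 : 2 * (eps * q) * (`|dx N| + `|dy N|) <= 2 * (eps * q) * q.
  by rewrite ler_wpM2l// mulr_ge0// mulr_ge0// ltW.
have : c * 4^-1 ^+ N <= 4 * eps * q ^+ 2 by rewrite expr2; lra.
have -> : q ^+ 2 = D ^+ 2 * 4^-1 ^+ N.
  by rewrite /q exprMn -exprM mulnC exprM; congr (_ * _ ^+ _); rewrite expr2; lra.
have p4 : 0 < (4^-1 : R) ^+ N by rewrite exprn_gt0//; lra.
rewrite mulrA ler_pM2r// leNgt => /negP; apply.
rewrite /eps.
have -> : 4 * (c / (4 * D ^+ 2 + 1) / 2) * D ^+ 2 = c * (2 * D ^+ 2 / (4 * D ^+ 2 + 1)).
  by field; rewrite gt_eqF.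
rewrite -[ltRHS]mulr1 ltr_pM2l// ltr_pdivrMr// mul1r; have := sqr_ge0 D; lra.
Qed.

Lemma dyadic_limit (s : nat -> R) : (forall n, s n <= s n.+1 <= s n + 2^-1 ^+ n.+1) ->
  exists l, forall n, s n <= l <= s n + 2^-1 ^+ n.
Proof.
move=> hs.
have nd : {homo s : n m / (n <= m)%N >-> n <= m}.
  by apply/nondecreasing_seqP => n; case/andP: (hs n).
have ub n m : (n <= m)%N -> s m <= s n + 2^-1 ^+ n - 2^-1 ^+ m.
  move=> nm; rewrite -(subnKC nm); elim: (m - n)%N => [|k IH].
    by rewrite addn0 addrK.
  rewrite addnS; have /andP[_ h] := hs (n + k)%N; apply: le_trans h _.
  have := IH; rewrite exprS; set u := 2^-1 ^+ (n + k); lra.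
have q0 n : 0 <= (2^-1 : R) ^+ n by rewrite exprn_ge0//; lra.
have ub' n m : s m <= s n + 2^-1 ^+ n.
  have := q0 m; case/orP: (leq_total n m) => nm.
    by have := ub n m nm; lra.
  by have := nd _ _ nm; have := q0 n; lra.
have cs : cvgn s.
  by apply: nondecreasing_is_cvgn => //; exists (s 0 + 2^-1 ^+ 0) => _ [m _ <-].
exists (limn s) => n; apply/andP; split; first exact: nondecreasing_cvgn_le.
by apply: limr_le => //; apply: nearW => m; exact: ub'.
Qed.

Theorem goursat f (x1 y1 x2 y2 : R) : holomorphic f -> rect_int f x1 y1 x2 y2 = 0.
Proof.
move=> hf; apply: Normc.eq0_normc; apply/eqP.
rewrite eq_le normc_ge0 andbT leNgt; apply/negP => c0.
set c := normc _ in c0.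
pose W := x2 - x1; pose H := y2 - y1.
(* Subrectangles are parametrised by the unit square, so the bisection runs on increasing dyadic
   numbers whatever the signs of W and H. *)
pose Q n (p : R * R) := rect_int f (x1 + W * p.1) (y1 + H * p.2)
   (x1 + W * p.1 + W * 2^-1 ^+ n) (y1 + H * p.2 + H * 2^-1 ^+ n).
pose ok n p := c * 4^-1 ^+ n <= normc (Q n p).
pose near1 n (s s' : R) := s' = s \/ s' = s + 2^-1 ^+ n.+1.
have step n p : ok n p -> exists p', [/\ ok n.+1 p', near1 n p.1 p'.1 & near1 n p.2 p'.2].
  move=> hp; apply: contrapT => no.
  have sm p' : near1 n p.1 p'.1 -> near1 n p.2 p'.2 -> normc (Q n.+1 p') < c * 4^-1 ^+ n.+1.
    move=> n1 n2; rewrite ltNge; apply/negP => k; apply: no; by exists p'.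
  have e2 : 2^-1 ^+ n = 2^-1 ^+ n.+1 + 2^-1 ^+ n.+1 :> R by rewrite exprS; lra.
  have eQ : Q n p = (Q n.+1 p + Q n.+1 (p.1, p.2 + 2^-1 ^+ n.+1)) +
     (Q n.+1 (p.1 + 2^-1 ^+ n.+1, p.2) + Q n.+1 (p.1 + 2^-1 ^+ n.+1, p.2 + 2^-1 ^+ n.+1)).
    rewrite /Q /= (rect_splitx _ _ _ _ _ (x1 + W * p.1 + W * 2^-1 ^+ n.+1)).
    congr (_ + _).
      rewrite (rect_splity _ _ _ _ _ (y1 + H * p.2 + H * 2^-1 ^+ n.+1)).
      by congr (_ + rect_int _ _ _ _ _); rewrite ?e2; ring.
    rewrite (rect_splity _ _ _ _ _ (y1 + H * p.2 + H * 2^-1 ^+ n.+1)).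
    by congr (rect_int _ _ _ _ _ + rect_int _ _ _ _ _); rewrite ?e2; ring.
  have l1 := sm p (or_introl erefl) (or_introl erefl).
  have l2 := sm (p.1, p.2 + 2^-1 ^+ n.+1) (or_introl erefl) (or_intror erefl).
  have l3 := sm (p.1 + 2^-1 ^+ n.+1, p.2) (or_intror erefl) (or_introl erefl).
  have l4 := sm (p.1 + 2^-1 ^+ n.+1, p.2 + 2^-1 ^+ n.+1) (or_intror erefl) (or_intror erefl).
  move: hp; rewrite /ok eQ leNgt => /negP; apply.
  apply: le_lt_trans (normcD _ _) _.
  apply: le_lt_trans (lerD (normcD _ _) (normcD _ _)) _.
  have -> : c * 4^-1 ^+ n = 4 * (c * 4^-1 ^+ n.+1) by rewrite exprS; field.
  lra.
pose nxt n p := xget p [set p' | [/\ ok n.+1 p', near1 n p.1 p'.1 & near1 n p.2 p'.2]].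
pose fix ps n := if n is m.+1 then nxt m (ps m) else (0, 0) : R * R.
have ok0 : ok 0 (0, 0).
  have ex2 : x1 + W * 0 + W * 2^-1 ^+ 0 = x2 by rewrite expr0 /W; ring.
  have ey2 : y1 + H * 0 + H * 2^-1 ^+ 0 = y2 by rewrite expr0 /H; ring.
  have ex1 : x1 + W * 0 = x1 by ring.
  have ey1 : y1 + H * 0 = y1 by ring.
  change (c * 4^-1 ^+ 0 <= normc (rect_int f (x1 + W * 0) (y1 + H * 0)
    (x1 + W * 0 + W * 2^-1 ^+ 0) (y1 + H * 0 + H * 2^-1 ^+ 0))).
  by rewrite ex2 ey2 ex1 ey1 expr0 mulr1.
have nxtP n p : ok n p -> [/\ ok n.+1 (nxt n p), near1 n p.1 (nxt n p).1 & near1 n p.2 (nxt n p).2].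
  by move=> /step [p' hp']; rewrite /nxt; case: xgetP => [? _ //|/(_ p')].
have okn n : ok n (ps n) by elim: n => //= n /nxtP[].
have q0 n : 0 <= (2^-1 : R) ^+ n by rewrite exprn_ge0//; lra.
have [s1 h1] : exists l, forall n, (ps n).1 <= l <= (ps n).1 + 2^-1 ^+ n.
  apply: dyadic_limit => n; have [_ + _] := nxtP n _ (okn n).
  by rewrite /= => -[->|->]; have := q0 n.+1; rewrite ?lexx ?lerDl; lra.
have [s2 h2] : exists l, forall n, (ps n).2 <= l <= (ps n).2 + 2^-1 ^+ n.
  apply: dyadic_limit => n; have [_ _] := nxtP n _ (okn n).
  by rewrite /= => -[->|->]; have := q0 n.+1; rewrite ?lexx ?lerDl; lra.
have betw (u V s l e : R) : s <= l <= s + e ->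
    Num.min (u + V * s) (u + V * s + V * e) <= u + V * l
      <= Num.max (u + V * s) (u + V * s + V * e).
  move=> /andP[sl le]; case: (leP 0 V) => V0.
    have a1 := ler_wpM2l V0 sl; have a2 := ler_wpM2l V0 le; rewrite mulrDr in a2.
    by rewrite ge_min le_max; apply/andP; split; apply/orP; [left|right]; lra.
  have a1 := ler_wnM2l (ltW V0) sl; have a2 := ler_wnM2l (ltW V0) le; rewrite mulrDr in a2.
  by rewrite ge_min le_max; apply/andP; split; apply/orP; [right|left]; lra.
apply: (@goursat_local f c (`|W| + `|H|) (x1 + W * s1) (y1 + H * s2)
  (fun n => x1 + W * (ps n).1) (fun n => y1 + H * (ps n).2)
  (fun n => W * 2^-1 ^+ n) (fun n => H * 2^-1 ^+ n)) => // n.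
- by rewrite !normrM (ger0_norm (q0 n)) -mulrDl.
- exact: betw.
- exact: betw.
Qed.

End Goursat.

(** * The complex exponential *)

Section ComplexExp.
Variable R : realType.
Implicit Types z w h : R[i].
Local Notation Re := (@complex.Re R).
Local Notation Im := (@complex.Im R).

Definition cexp z : R[i] :=
  (expR (Re z) * cos (Im z)) +i* (expR (Re z) * sin (Im z)).

Lemma cexpD z w : cexp (z + w) = cexp z * cexp w.
Proof.
apply/eqP; rewrite eq_complex ReM ImM /= ReD ImD expRD cosD sinD.
by apply/andP; split; apply/eqP; ring.
Qed.

Lemma cexp0 : cexp 0 = 1.
Proof. by apply/eqP; rewrite eq_complex /= expR0 cos0 sin0 mulr0 mulr1 !eqxx. Qed.

Lemma normc_cexp z : normc (cexp z) = expR (Re z).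
Proof.
rewrite /= !exprMn -mulrDr cos2Dsin2 mulr1 sqrtr_sqr ger0_norm// expR_ge0.
Qed.

Lemma cexp_neq0 z : cexp z != 0.
Proof.
apply/eqP => h; have := normc_cexp z; rewrite h Normc.normc0.
by have := expR_gt0 (Re z); move=> /[swap] <-; rewrite ltxx.
Qed.

Lemma cexpN z : cexp (- z) = (cexp z)^-1.
Proof.
apply: (mulfI (cexp_neq0 z)); by rewrite -cexpD subrr cexp0 divff ?cexp_neq0.
Qed.

Lemma cexp_periodic z : cexp (z + iC R * (pi *+ 2)%:C) = cexp z.
Proof.
rewrite /cexp.
have -> : Re (z + iC R * (pi *+ 2)%:C) = Re z.
  by rewrite ReD ReM /= mul0r mulr0 subr0 addr0.
have -> : Im (z + iC R * (pi *+ 2)%:C) = Im z + pi *+ 2.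
  by rewrite ImD ImM /= mul0r mul1r add0r.
by rewrite cosD2pi sinD2pi.
Qed.

Lemma cexpMn z n : cexp (n%:R * z) = cexp z ^+ n.
Proof.
elim: n => [|n IH]; first by rewrite mul0r expr0 cexp0.
by rewrite -natr1 mulrDl mul1r cexpD IH exprSr.
Qed.

Lemma is_derive_epsP (g : R -> R) (x d : R) : is_derive x 1 g d ->
  forall eps : R, 0 < eps -> exists2 delta : R,
    0 < delta & forall h : R, `|h| < delta -> `|g (x + h) - g x - d * h| <= eps * `|h|.
Proof.
move=> [h1 h2] eps e0.
have key : (fun h : R => h^-1 *: ((g \o shift x) (h *: (1 : R)) - g x)) @ 0^' --> d.
  by rewrite -h2; exact: h1.
move/cvgrPdist_le/(_ _ e0): key => -[delta /= d0 hd].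
exists delta => // k kd.
have [->|k0] := eqVneq k 0.
  by rewrite addr0 mulr0 subrr subr0 normr0 mulr0.
have := hd k; rewrite /ball_/= sub0r normrN => /(_ kd k0).
rewrite /shift /= [k *: _]mulr1 distrC => hk.
have -> : g (x + k) - g x - d * k = (k^-1 *: (g (k + x) - g x) - d) * k.
  rewrite [_ *: _](_ : _ = k^-1 * (g (k + x) - g x))//.
  by rewrite mulrBl mulrAC mulVf// mul1r (addrC x).
by rewrite normrM ler_wpM2r.
Qed.

Lemma cderiv_cexp0 : cderiv cexp 0 1.
Proof.
move=> eps e0.
(* The four error terms below add up to at most 9 e times the modulus of h. *)
pose e := eps / 16.
have ep : 0 < e by rewrite /e; lra.
have [d1 d10 h1] := is_derive_epsP (is_derive_expR 0) ep.
have [d2 d20 h2] := is_derive_epsP (is_derive_expR 0) ltr01.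
have [d3 d30 h3] := is_derive_epsP (is_derive_cos 0) ep.
have [d4 d40 h4] := is_derive_epsP (is_derive_sin 0) ep.
exists (Num.min (Num.min (Num.min d1 d2) (Num.min d3 d4)) (Num.min e 1)).
  by rewrite !lt_min d10 d20 d30 d40 ep ltr01.
move=> h; rewrite !lt_min => /andP[/andP[/andP[hd1 hd2] /andP[hd3 hd4]] /andP[he h1']].
set r := Re h; set t := Im h.
have rh : `|r| <= normc h by exact: normc_Re.
have th : `|t| <= normc h by exact: normc_Im.
have := h1 r (le_lt_trans rh hd1); have := h2 r (le_lt_trans rh hd2).
have := h3 t (le_lt_trans th hd3); have := h4 t (le_lt_trans th hd4).
rewrite !add0r expR0 cos0 sin0 oppr0 !mul0r !mul1r !subr0 !addr0 => s4 s3 s2 s1.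
rewrite cexp0; apply: le_trans (normc_le_ReIm _) _.
have eR : expR r <= 3.
  have := ler_norm (expR r - 1 - r); have := ler_norm r; lra.
have eR0 := expR_gt0 r.
have eR1 : `|expR r - 1| <= 2 * normc h.
  have -> : expR r - 1 = (expR r - 1 - r) + r by rewrite subrK.
  by apply: le_trans (ler_normD _ _) _; lra.
have -> : Re (cexp h - 1 - h) = (expR r - 1 - r) + expR r * (cos t - 1).
  by rewrite !ReD !ReN /=; ring.
have -> : Im (cexp h - 1 - h) = expR r * (sin t - t) + (expR r - 1) * t.
  by rewrite !ImD !ImN /=; ring.
have i1 : `|expR r * (cos t - 1)| <= 3 * (e * normc h).
  rewrite normrM (gtr0_norm eR0); apply: ler_pM => //.
  by apply: le_trans s3 _; rewrite ler_wpM2l// ltW.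
have i2 : `|expR r * (sin t - t)| <= 3 * (e * normc h).
  rewrite normrM (gtr0_norm eR0); apply: ler_pM => //.
  by apply: le_trans s4 _; rewrite ler_wpM2l// ltW.
have i3 : `|(expR r - 1) * t| <= 2 * e * normc h.
  rewrite normrM; apply: ler_pM => //.
  by apply: le_trans eR1 _; rewrite ler_wpM2l// ltW.
have i4 : `|expR r - 1 - r| <= e * normc h.
  by apply: le_trans s1 _; rewrite ler_wpM2l// ltW.
apply: le_trans (lerD (ler_normD _ _) (ler_normD _ _)) _.
have n0 := normc_ge0 h.
have e16 : eps * normc h = 16 * (e * normc h) by rewrite /e; field.
have en0 : 0 <= e * normc h by rewrite mulr_ge0// ltW.
rewrite e16; rewrite -mulrA in i3; lra.
Qed.

Lemma cderiv_cexp z : cderiv cexp z (cexp z).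
Proof.
have h1 : cderiv (fun w => w - z) z (1 + 0).
  by apply: cderivD; [exact: cderiv_id|exact: cderiv_cst].
have h0 : cderiv cexp ((fun w => w - z) z) 1 by rewrite /= subrr; exact: cderiv_cexp0.
have := cderivZ (cexp z) (cderiv_comp h1 h0).
rewrite addr0 !mulr1; apply: cderiv_ext => w /=.
by rewrite -cexpD addrC subrK.
Qed.

End ComplexExp.

(** * The primitive of an entire function and its difference quotient *)

Section EntirePrimitive.
Variables (R : realType) (f f' : R[i] -> R[i]).
Hypothesis ff' : forall z, cderiv f z (f' z).
Implicit Types z w h : R[i].
Local Notation Re := (@complex.Re R).
Local Notation Im := (@complex.Im R).

Let holf : holomorphic f. Proof. by move=> z; exists (f' z). Qed.

Definition entire_prim z := path_hv f 0 0 (Re z) (Im z).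

(** Goursat's theorem on the rectangle with opposite corners (Re z, 0) and (Re w, Im z) moves the
    horizontal step up to height Im z, so the difference depends only on a path from z to w. *)
Lemma entire_primB z w : entire_prim w - entire_prim z =
  path_hv f (Re z) (Im z) (Re w) (Im w).
Proof.
have := goursat (Re z) 0 (Re w) (Im z) holf.
rewrite /rect_int /entire_prim /path_hv /path_vh /hint /vint => /eqP.
rewrite subr_eq0 => /eqP g.
rewrite -(cint_cat _ 0 (Re z) (Re w)) -(cint_cat _ 0 (Im z) (Im w)).
set a := cint _ 0 (Re z); set b := cint _ (Re z) (Re w) in g *.
set c := cint _ 0 (Im z) in g *; set e := cint _ (Im z) (Im w).
set u := cint _ 0 (Im z) in g *; set v := cint _ (Re z) (Re w) in g *.
have -> : a + b + iC R * (c + e) - (a + iC R * u) = (b + iC R * c) + iC R * e - iC R * u by ring.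
by rewrite g; ring.
Qed.

(** Only the derivative of f at z enters, through its affine part. The rectangle spanned by z and z
    + h lies within 2 |h| of z, whence delta / 2 in the proof, and eps / 8 since 2 (eps/8) (2|h|)
    (2|h|) = eps |h|^2. *)
Lemma entire_prim_peano z (eps : R) : 0 < eps -> exists2 delta : R, 0 < delta &
  forall h, normc h < delta -> normc (entire_prim (z + h) - entire_prim z -
    f z * h - f' z / 2 * h ^+ 2) <= eps * normc h ^+ 2.
Proof.
move=> e0; have e80 : 0 < eps / 8 by lra.
have [delta d0 hd] := ff' z e80.
exists (delta / 2); first lra.
move=> h hlt; rewrite entire_primB.
have n0 := normc_ge0 h.
have := @path_affine_estimate R f (f z) (f' z) z (Re z) (Im z) (Re (z + h)) (Im (z + h))
  (eps / 8 * (2 * normc h)) holf.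
have eRe : Re (z + h) - Re z = Re h by rewrite ReD; ring.
have eIm : Im (z + h) - Im z = Im h by rewrite ImD; ring.
rewrite eRe eIm -!complexE => H.
have [|H1 _] := H.
  move=> x y hx hy.
  have mx : Num.min (Re z) (Re (z + h)) <= Re z <= Num.max (Re z) (Re (z + h)).
    by rewrite ge_min le_max lexx.
  have my : Num.min (Im z) (Im (z + h)) <= Im z <= Num.max (Im z) (Im (z + h)).
    by rewrite ge_min le_max lexx.
  have := between_dist hx mx; have := between_dist hy my.
  rewrite eRe eIm => l2 l1.
  have lw : normc ((x +i* y) - z) <= 2 * normc h.
    rewrite [in X in normc X](complexE z); apply: le_trans (normc_dist_le _ _ _ _) _.
    have := normc_Re h; have := normc_Im h; lra.
  have lt' : normc ((x +i* y) - z) < delta by lra.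
  have := hd _ lt'; rewrite [z + _]addrC subrK => /le_trans; apply.
  by rewrite ler_wpM2l// ltW.
move: H1.
have -> : affine_prim (f z) (f' z) z (z + h) - affine_prim (f z) (f' z) z z =
    f z * h + f' z / 2 * h ^+ 2.
  by rewrite /affine_prim expr2; ring.
rewrite opprD addrA => /le_trans; apply.
have l : `|Re h| + `|Im h| <= 2 * normc h by have := normc_Re h; have := normc_Im h; lra.
apply: (@le_trans _ _ (2 * (eps / 8 * (2 * normc h)) * (2 * normc h))).
  rewrite ler_wpM2l// mulr_ge0// mulr_ge0 ?mulr_ge0//; lra.
by rewrite le_eqVlt; apply/orP; left; apply/eqP; field.
Qed.

Lemma cderiv_entire_prim z : cderiv entire_prim z (f z).
Proof.
move=> eps e0; have [delta d0 hd] := entire_prim_peano z ltr01.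
pose B := 1 + normc (f' z / 2).
have B0 : 0 < B by have := normc_ge0 (f' z / 2); rewrite /B; lra.
exists (Num.min delta (eps / B)); first by rewrite lt_min d0 divr_gt0.
move=> h; rewrite lt_min => /andP[h1 h2].
have -> : entire_prim (z + h) - entire_prim z - f z * h =
  (entire_prim (z + h) - entire_prim z - f z * h - f' z / 2 * h ^+ 2) + f' z / 2 * h ^+ 2.
  by rewrite subrK.
apply: le_trans (normcD _ _) _.
apply: le_trans (lerD (hd _ h1) (lexx _)) _.
rewrite Normc.normcM normcX -mulrDl -/B expr2 mulrA ler_wpM2r ?normc_ge0//.
by rewrite mulrC -ler_pdivlMr// ltW.
Qed.

Definition diff_quot z w : R[i] :=
  if w == z then f z else (entire_prim w - entire_prim z) / (w - z).

Lemma diff_quotE z w : diff_quot z w * (w - z) = entire_prim w - entire_prim z.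
Proof.
rewrite /diff_quot; case: eqP => [->|/eqP wz]; first by rewrite !subrr mulr0.
by rewrite divfK// subr_eq0.
Qed.

(* Differentiability at [z] itself is the second-order expansion of the primitive. *)
Lemma holomorphic_diff_quot z : holomorphic (diff_quot z).
Proof.
move=> w; have [->|wz] := eqVneq w z.
  exists (f' z / 2) => eps e0; have [delta d0 hd] := entire_prim_peano z e0.
  exists delta => // h hh.
  have [->|h0] := eqVneq h 0.
    by rewrite addr0 mulr0 subrr subr0 Normc.normc0 mulr0.
  have nh : 0 < normc h.
    by rewrite lt_def normc_ge0 andbT; apply: contra_neq h0; exact: Normc.eq0_normc.
  rewrite -(ler_pM2r nh) -Normc.normcM -[leRHS]mulrA -expr2; apply: le_trans (hd h hh).
  rewrite le_eqVlt; apply/orP; left; apply/eqP; congr (normc _).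
  have := diff_quotE z (z + h); rewrite [X in diff_quot _ _ * X]addrC addKr => e.
  rewrite !mulrBl e /diff_quot eqxx; ring.
have h1 : cderiv (fun u => u - z) w (1 + 0).
  by apply: cderivD; [exact: cderiv_id|exact: cderiv_cst].
have wz0 : w - z != 0 by rewrite subr_eq0.
have h2 := cderiv_comp h1 (cderiv_inv wz0).
have h3 : cderiv (fun u => entire_prim u - entire_prim z) w (f w + 0).
  by apply: cderivD; [exact: cderiv_entire_prim|exact: cderiv_cst].
have nw : 0 < normc (w - z).
  by rewrite lt_def normc_ge0 andbT; apply: contra_neq wz0; exact: Normc.eq0_normc.
eexists; apply: cderiv_near nw _ (cderivM h3 h2) => h hh /=.
rewrite /diff_quot; case: eqP => // e; exfalso; move: hh.
have -> : w - z = - h by rewrite -e; ring.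
by rewrite normcNE ltxx.
Qed.

End EntirePrimitive.

(** * Power series of infinite radius of convergence *)

Section PowerSeries.
Variable R : realType.
Implicit Types (a : nat -> R[i]) (z w h : R[i]).
Local Notation Re := (@complex.Re R).
Local Notation Im := (@complex.Im R).

(** Equivalent to an infinite radius of convergence, in a form that is easily preserved by
    differentiation and by index shifts. *)
Definition fast_decay a := forall r : R, 0 < r ->
  exists C, forall n, normc (a n) <= C * r ^+ n.

Definition psum a n z : R[i] := \sum_(k < n) a k * z ^+ k.

Definition power_series a z : R[i] := limn (fun n => psum a n z).

Lemma complex_cauchy (u : nat -> R[i]) (B q : R) : 0 <= q < 1 ->
  (forall m n, (m <= n)%N -> normc (u n - u m) <= B * q ^+ m) ->
  exists l, (u @ \oo --> l) /\ forall n, normc (l - u n) <= B * q ^+ n.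
Proof.
move=> q01 hu.
have small (eps : R) (e0 : 0 < eps) := geometric_small B q01 e0.
have cvg1 (p : R[i] -> R) : (forall z w, `|p z - p w| <= normc (z - w)) ->
    cvgn (p \o u).
  move=> hp; apply: cauchy_cvg; apply/cauchy_exP => e e0.
  have [N hN] := small e e0; exists (p (u N)); exists N => // n /= Nn.
  rewrite /ball /= distrC; apply: le_lt_trans (hp _ _) _.
  exact: le_lt_trans (hu _ _ Nn) (hN N (leqnn N)).
have hRe (z w : R[i]) : `|Re z - Re w| <= normc (z - w).
  by have := normc_Re (z - w); rewrite ReD ReN.
have hIm (z w : R[i]) : `|Im z - Im w| <= normc (z - w).
  by have := normc_Im (z - w); rewrite ImD ImN.
have c1 := cvg1 _ hRe; have c2 := cvg1 _ hIm.
pose l : R[i] := limn (Re \o u) +i* limn (Im \o u).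
have ul : u @ \oo --> l.
  apply/cvg_normcP => e e0; have e20 : 0 < e / 2 by lra.
  move/cvgrPdist_lt/(_ _ e20): c1 => -[N1 _ h1].
  move/cvgrPdist_lt/(_ _ e20): c2 => -[N2 _ h2].
  exists (maxn N1 N2) => n; rewrite geq_max => /andP[/h1 {}h1 /h2 {}h2].
  apply: le_lt_trans (normc_le_ReIm _) _; rewrite ReD ImD ReN ImN distrC.
  by rewrite [X in _ + X]distrC (splitr e) ltrD.
exists l; split=> // n; apply/ler_addgt0Pr => e e0.
have /cvg_normcP/(_ e e0)[N hN] := ul.
have h1 := hN (maxn N n) (leq_maxl _ _); have h2 := hu n _ (leq_maxr N n).
have -> : l - u n = (l - u (maxn N n)) + (u (maxn N n) - u n) by ring.
by apply: le_trans (normcD _ _) _; rewrite normc_distC in h1; lra.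
Qed.

(** The rate 1/(2B) makes the terms at most C 2^-k throughout the disc of radius B. The bound is
    uniform on that disc, as needed for averages over circles. *)
Lemma power_series_tail a (B C : R) : 0 < B ->
  (forall n, normc (a n) <= C * (2 * B)^-1 ^+ n) -> forall z, normc z <= B ->
  (fun n => psum a n z) @ \oo --> power_series a z /\
  forall n, normc (power_series a z - psum a n z) <= 2 * C * 2^-1 ^+ n.
Proof.
move=> B0 ha z zB.
have C0 : 0 <= C by have := ha 0; rewrite expr0 mulr1; apply: le_trans; exact: normc_ge0.
have q0 n : 0 <= (2^-1 : R) ^+ n by rewrite exprn_ge0//; lra.
have term k : normc (a k * z ^+ k) <= C * 2^-1 ^+ k.
  rewrite Normc.normcM normcX.
  have h : normc z ^+ k <= B ^+ k by rewrite lerXn2r ?nnegrE ?normc_ge0// ltW.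
  apply: le_trans (ler_pM (normc_ge0 _) (exprn_ge0 _ (normc_ge0 _)) (ha k) h) _.
  rewrite -mulrA -exprMn (_ : (2 * B)^-1 * B = 2^-1)//.
  by rewrite invfM -mulrA mulVf ?mulr1// gt_eqF.
have dist m n : normc (psum a (m + n) z - psum a m z) <= 2 * C * (2^-1 ^+ m - 2^-1 ^+ (m + n)).
  elim: n => [|n IH]; first by rewrite addn0 !subrr Normc.normc0 mulr0.
  rewrite addnS {1}/psum big_ord_recr /= -/(psum a (m + n) z) addrAC.
  apply: le_trans (normcD _ _) _.
  apply: le_trans (lerD IH (term _)) _; rewrite exprS.
  by set u := 2^-1 ^+ (m + n); lra.
have [|l [hl1 hl2]] := @complex_cauchy (fun n => psum a n z) (2 * C) 2^-1 ltac:(lra).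
  move=> m n mn; rewrite -(subnKC mn); apply: le_trans (dist _ _) _.
  by rewrite ler_wpM2l ?mulr_ge0// gerBl.
have e : power_series a z = l by exact: cvg_lim hl1.
by rewrite e.
Qed.

Lemma power_series_cvg a z : fast_decay a ->
  (fun n => psum a n z) @ \oo --> power_series a z.
Proof.
move=> ha; have B0 : 0 < 1 + normc z by have := normc_ge0 z; lra.
have [|C hC] := ha (2 * (1 + normc z))^-1; first by rewrite invr_gt0; lra.
by apply: (power_series_tail B0 hC _).1; lra.
Qed.

Lemma power_series_unique a z (l : R[i]) : (fun n => psum a n z) @ \oo --> l ->
  power_series a z = l.
Proof. by move=> h; exact: cvg_lim h. Qed.

Definition diff_coef a n : R[i] := n.+1%:R * a n.+1.

Lemma natr_le_exp2 n : n%:R <= 2 ^+ n :> R.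
Proof. by rewrite -natrX ler_nat ltnW// ltn_expl. Qed.

Lemma normc_natr n : normc (n%:R : R[i]) = n%:R.
Proof.
have -> : (n%:R : R[i]) = (n%:R : R)%:C by rewrite rmorph_nat.
by rewrite normcR ger0_norm.
Qed.

Lemma fast_decay_diff a : fast_decay a -> fast_decay (diff_coef a).
Proof.
move=> ha r r0; have r20 : 0 < r / 2 by lra.
have [C hC] := ha _ r20; exists (C * r) => n.
rewrite /diff_coef Normc.normcM normc_natr.
have C0 : 0 <= C by have := hC 0; rewrite expr0 mulr1; apply: le_trans; exact: normc_ge0.
apply: le_trans (ler_pM (ler0n _ _) (normc_ge0 _) (natr_le_exp2 n.+1) (hC n.+1)) _.
rewrite mulrCA -exprMn (_ : 2 * (r / 2) = r); last lra.
by rewrite exprS mulrA.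
Qed.

Lemma psum_diff a n z : psum (diff_coef a) n z = \sum_(k < n.+1) k%:R * a k * z ^+ k.-1.
Proof. by rewrite big_ord_recl /= !mul0r add0r. Qed.

(** A crude second-order remainder: the base 1 + B >= 1 absorbs the missing powers, so no case
    distinction on small n is needed. *)
Lemma power_taylor2 (B : R) z h n : 0 <= B -> normc z <= B -> normc (z + h) <= B ->
  normc ((z + h) ^+ n - z ^+ n - n%:R * z ^+ n.-1 * h) <= n%:R ^+ 2 * (1 + B) ^+ n * normc h ^+ 2.
Proof.
move=> B0 zB zhB.
have B1 : 1 <= 1 + B by lra.
have diff m : normc ((z + h) ^+ m - z ^+ m) <= m%:R * (1 + B) ^+ m * normc h.
  elim: m => [|m IH]; first by rewrite !expr0 subrr Normc.normc0 !mul0r.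
  have -> : (z + h) ^+ m.+1 - z ^+ m.+1 = (z + h) * ((z + h) ^+ m - z ^+ m) + h * z ^+ m.
    by rewrite !exprS; ring.
  apply: le_trans (normcD _ _) _; rewrite !Normc.normcM normcX.
  have i1 : normc (z + h) * normc ((z + h) ^+ m - z ^+ m) <= (1 + B) * (m%:R * (1 + B) ^+ m * normc h).
    by apply: ler_pM; rewrite ?normc_ge0//; lra.
  have i2 : normc h * normc z ^+ m <= (1 + B) * ((1 + B) ^+ m * normc h).
    rewrite mulrC mulrA ler_wpM2r ?normc_ge0// -exprS.
    apply: le_trans (_ : (1 + B) ^+ m <= _); last by rewrite exprS ler_peMl// exprn_ge0; lra.
    by rewrite lerXn2r ?nnegrE ?normc_ge0//; lra.
  apply: le_trans (lerD i1 i2) _.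
  by rewrite exprS -(natr1 m) le_eqVlt; apply/orP; left; apply/eqP; ring.
elim: n => [|n IH].
  by rewrite !expr0 subrr sub0r mul0r mul0r oppr0 Normc.normc0 expr0n /= !mul0r.
have -> : (z + h) ^+ n.+1 - z ^+ n.+1 - n.+1%:R * z ^+ n.+1.-1 * h =
    z * ((z + h) ^+ n - z ^+ n - n%:R * z ^+ n.-1 * h) + h * ((z + h) ^+ n - z ^+ n).
  case: n {IH} => [|m] /=; first by rewrite !expr0 !expr1; ring.
  by rewrite !exprS -!(natr1 _); ring.
apply: le_trans (normcD _ _) _; rewrite !Normc.normcM.
have i1 : normc z * normc ((z + h) ^+ n - z ^+ n - n%:R * z ^+ n.-1 * h)
   <= (1 + B) * (n%:R ^+ 2 * (1 + B) ^+ n * normc h ^+ 2).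
  by apply: ler_pM; rewrite ?normc_ge0//; lra.
have i2 : normc h * normc ((z + h) ^+ n - z ^+ n) <= (1 + B) * (n%:R * (1 + B) ^+ n * normc h ^+ 2).
  apply: le_trans (ler_wpM2l (normc_ge0 _) (diff n)) _.
  have -> : normc h * (n%:R * (1 + B) ^+ n * normc h) = 1 * (n%:R * (1 + B) ^+ n * normc h ^+ 2).
    by ring.
  by rewrite ler_wpM2r// mulr_ge0 ?sqr_ge0// mulr_ge0// exprn_ge0; lra.
apply: le_trans (lerD i1 i2) _.
have -> : (1 + B) * (n%:R ^+ 2 * (1 + B) ^+ n * normc h ^+ 2) +
  (1 + B) * (n%:R * (1 + B) ^+ n * normc h ^+ 2) =
  (1 + B) ^+ n.+1 * normc h ^+ 2 * (n%:R ^+ 2 + n%:R) by rewrite (exprS (1 + B) n); ring.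
rewrite -[leRHS]mulrA [leRHS]mulrC; apply: ler_wpM2l.
  by rewrite mulr_ge0 ?sqr_ge0// exprn_ge0//; lra.
by rewrite -(natr1 n); have := ler0n R n; nra.
Qed.

Lemma sum_half_le n : \sum_(k < n) (2^-1 : R) ^+ k <= 2.
Proof.
suff h : \sum_(k < n) (2^-1 : R) ^+ k <= 2 - 2 * 2^-1 ^+ n.
  have : 0 <= (2^-1 : R) ^+ n by rewrite exprn_ge0.
  by move: h; set u := 2^-1 ^+ n; lra.
elim: n => [|n IH]; first by rewrite big_ord0 expr0; lra.
rewrite big_ord_recr /= exprS; move: IH.
by move: (2^-1 ^+ n) (\sum_(k < n) _) => u s; lra.
Qed.

Lemma psum_taylor2 a (B C : R) z h n : 0 <= B -> 0 <= C ->
  (forall n, normc (a n) <= C * (8 * (1 + B))^-1 ^+ n) ->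
  normc z <= B -> normc (z + h) <= B ->
  normc (psum a n.+1 (z + h) - psum a n.+1 z - psum (diff_coef a) n z * h)
    <= 2 * C * normc h ^+ 2.
Proof.
move=> B0 C0 hC zB zhB.
have -> : psum a n.+1 (z + h) - psum a n.+1 z - psum (diff_coef a) n z * h =
    \sum_(k < n.+1) a k * ((z + h) ^+ k - z ^+ k - k%:R * z ^+ k.-1 * h).
  by rewrite psum_diff /psum mulr_suml -!sumrB; apply: eq_bigr => k _; ring.
apply: le_trans (normc_sum _ _ _) _.
(* The factor 4^-k absorbs k^2 <= 4^k, and 2^-k remains to be summed. *)
have e84 : (8^-1 : R) = 4^-1 * 2^-1 by lra.
have B1 : 1 + B != 0 by rewrite gt_eqF// ltr_pwDl.
have tb (k : nat) : normc (a k * ((z + h) ^+ k - z ^+ k - k%:R * z ^+ k.-1 * h)) <=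
    C * normc h ^+ 2 * 2^-1 ^+ k.
  rewrite Normc.normcM.
  apply: le_trans (ler_pM (normc_ge0 _) (normc_ge0 _) (hC k) (power_taylor2 k B0 zB zhB)) _.
  have k4 : k%:R ^+ 2 * 4^-1 ^+ k <= 1 :> R.
    rewrite exprVn ler_pdivrMr ?exprn_gt0// mul1r.
    apply: le_trans (_ : (2 ^+ k) ^+ 2 <= _).
      by rewrite lerXn2r ?nnegrE ?exprn_ge0// natr_le_exp2.
    by rewrite -exprM mulnC exprM -natrX.
  have -> : C * (8 * (1 + B))^-1 ^+ k * (k%:R ^+ 2 * (1 + B) ^+ k * normc h ^+ 2) =
      C * normc h ^+ 2 * (k%:R ^+ 2 * 4^-1 ^+ k * 2^-1 ^+ k).
    by rewrite invfM exprMn e84 exprMn (exprVn (1 + B)); field; rewrite expf_neq0.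
  apply: ler_wpM2l; first by rewrite mulr_ge0 ?sqr_ge0.
  by rewrite -[leRHS]mul1r ler_wpM2r// exprn_ge0.
apply: (@le_trans _ _ (\sum_(k < n.+1) C * normc h ^+ 2 * 2^-1 ^+ k)).
  by apply: ler_sum => k _; exact: tb.
rewrite -mulr_sumr [leRHS](_ : _ = C * normc h ^+ 2 * 2); last by ring.
by apply: ler_wpM2l (sum_half_le _); rewrite mulr_ge0 ?sqr_ge0.
Qed.

Lemma power_series_taylor2 a (B C : R) z h : fast_decay a -> 0 <= B -> 0 <= C ->
  (forall n, normc (a n) <= C * (8 * (1 + B))^-1 ^+ n) ->
  normc z <= B -> normc (z + h) <= B -> normc h <= 1 ->
  normc (power_series a (z + h) - power_series a z -
    power_series (diff_coef a) z * h) <= 2 * C * normc h ^+ 2.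
Proof.
move=> ha B0 C0 hC zB zhB h1; apply/ler_addgt0Pr => e e0.
have e40 : 0 < e / 4 by rewrite divr_gt0.
have /cvg_normcP/(_ _ e40)[N1 hN1] := @power_series_cvg a (z + h) ha.
have /cvg_normcP/(_ _ e40)[N2 hN2] := @power_series_cvg a z ha.
have /cvg_normcP/(_ _ e40)[N3 hN3] := @power_series_cvg _ z (fast_decay_diff ha).
have [N [k1 k2 k3]] : exists N, [/\ (N1 <= N.+1)%N, (N2 <= N.+1)%N & (N3 <= N)%N].
  by exists (maxn N1 (maxn N2 N3)); split; lia.
have split3 (u1 u0 u' p1 p0 p' : R[i]) : u1 - u0 - u' * h =
    (p1 - p0 - p' * h) + ((u1 - p1) + ((p0 - u0) + (p' - u') * h)) by ring.
rewrite (split3 _ _ _ (psum a N.+1 (z + h)) (psum a N.+1 z) (psum (diff_coef a) N z)).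
apply: le_trans (normcD _ _) _; apply: lerD; first exact: psum_taylor2 hC zB zhB.
apply: le_trans (normcD _ _) _.
have j1 : normc (power_series a (z + h) - psum a N.+1 (z + h)) <= e / 4.
  by rewrite normc_distC ltW// hN1.
have j2 : normc (psum a N.+1 z - power_series a z) <= e / 4 by rewrite ltW// hN2.
have j3 : normc ((psum (diff_coef a) N z - power_series (diff_coef a) z) * h) <= e / 4.
  rewrite Normc.normcM -[leRHS]mulr1; apply: ler_pM; rewrite ?normc_ge0//.
  by rewrite ltW// hN3.
have := normcD (psum a N.+1 z - power_series a z)
  ((psum (diff_coef a) N z - power_series (diff_coef a) z) * h).
move: j1 j2 j3 e0; clear.
move: (normc _) (normc _) (normc _) (normc (_ + _)) => u v w s; lra.
Qed.

Lemma cderiv_power_series a z : fast_decay a ->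
  cderiv (power_series a) z (power_series (diff_coef a) z).
Proof.
move=> ha.
have nz := normc_ge0 z.
have B0 : 0 <= 1 + normc z by rewrite addr_ge0.
have [|C hC] := ha (8 * (1 + (1 + normc z)))^-1.
  by rewrite invr_gt0 mulr_gt0// ltr_pwDl.
have C0 : 0 <= C by have := hC 0; rewrite expr0 mulr1; apply: le_trans; exact: normc_ge0.
move=> eps e0.
have p : 0 < 2 * C + 1 by rewrite ltr_wpDl// mulr_ge0.
exists (Num.min 1 (eps / (2 * C + 1))); first by rewrite lt_min ltr01 divr_gt0.
move=> h; rewrite lt_min => /andP[h1 h2].
have nh := normc_ge0 h.
apply: le_trans (power_series_taylor2 ha B0 C0 hC _ _ (ltW h1)) _.
- by rewrite lerDr.
- by apply: le_trans (normcD _ _) _; rewrite addrC lerD2r ltW.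
rewrite expr2 mulrA ler_wpM2r//.
move: h2; rewrite ltr_pdivlMr// mulrDr mulr1 [normc h * _]mulrC => h2.
by apply: le_trans (ltW h2); rewrite lerDl.
Qed.

Lemma derive_power_series a n z : fast_decay a ->
  (power_series a)^`(n)%classic z = power_series (iter n diff_coef a) z.
Proof.
move=> ha; elim: n z => [//|n IH] z.
have ha' : fast_decay (iter n diff_coef a).
  by elim: n {IH} => //= n; exact: fast_decay_diff.
rewrite derive1nS.
have -> : (power_series a)^`(n)%classic = power_series (iter n diff_coef a).
  by apply/funext => w.
exact: cderiv_derive1 (cderiv_power_series _ ha').
Qed.

Lemma iter_diff_coef a n k :
  iter n diff_coef a k = ((k + n) ^_ n)%:R * a (k + n)%N.
Proof.
elim: n k => [|n IH] k; first by rewrite addn0 ffactn0 mul1r.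
rewrite iterS /diff_coef IH mulrA -natrM addSnnS; congr (_%:R * _).
by rewrite ffactnSr mulnC -addSnnS addnK.
Qed.

Lemma power_series0 a : fast_decay a -> power_series a 0 = a 0.
Proof.
move=> ha; apply: power_series_unique; apply/cvg_normcP => e e0.
exists 1%N => -[//|n] _; rewrite /psum big_ord_recl /= expr0 mulr1 big1 ?addr0.
  by rewrite subrr Normc.normc0.
by move=> i _; rewrite /bump /= exprS mul0r mulr0.
Qed.

Lemma derive_power_series0 a n : fast_decay a ->
  (power_series a)^`(n)%classic 0 = n`!%:R * a n.
Proof.
move=> ha; rewrite derive_power_series// power_series0; last first.
  by elim: n => //= n; exact: fast_decay_diff.
by rewrite iter_diff_coef add0n ffactnn.
Qed.

End PowerSeries.

(** * Cauchy's expansion of an entire function *)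

Section CauchyCircle.
Variable R : realType.
Implicit Types (f F : R[i] -> R[i]) (z w h : R[i]).
Local Notation Re := (@complex.Re R).
Local Notation Im := (@complex.Im R).
Local Notation iC := (iC R).
Let twopi : R := pi *+ 2.

Let twopi_gt0 : 0 < twopi. Proof. by rewrite mulrn_wgt0// pi_gt0. Qed.

(* [\int_0^(2 pi) f (r + i t) dt] *)
Definition circle_int f (r : R) : R[i] := vint f r 0 twopi.

(** Goursat's theorem on a rectangle of height 2 pi: the horizontal sides cancel by periodicity. In
    the variable exp s the vertical sides are concentric circles of radii exp r1 and exp r2. *)
Lemma circle_int_const f (r1 r2 : R) : holomorphic f ->
  (forall s, f (s + iC * twopi%:C) = f s) -> circle_int f r1 = circle_int f r2.
Proof.
move=> hf per; have := goursat r1 0 r2 twopi hf.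
rewrite /rect_int /path_hv /path_vh -/(circle_int f r1) -/(circle_int f r2).
have -> : hint f twopi r1 r2 = hint f 0 r1 r2.
  rewrite /hint; congr cint; apply/funext => t.
  by rewrite -[RHS]per; congr f; rewrite !horizE (complexRI t twopi) (complexRI t 0); ring.
move=> /eqP; rewrite subr_eq0 [X in _ == X]addrC => /eqP /addrI e.
have i0 : iC != 0.
  by apply/eqP => /(congr1 (@Normc.normc R)); rewrite normc_iC Normc.normc0 => /eqP; rewrite oner_eq0.
by apply/esym; exact: (mulfI i0).
Qed.

Lemma rcont_bounded (g : R -> R[i]) (a b : R) : a <= b -> rcont g ->
  exists M, forall t, Num.min a b <= t <= Num.max a b -> normc (g t) <= M.
Proof.
move=> ab [c1 c2].
have c t : {for t, continuous (fun t => `|(Re \o g) t| + `|(Im \o g) t|)}.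
  by apply: cvgD; apply: cvg_norm; [exact: c1|exact: c2].
have [m _ hm] := EVT_max ab (continuous_subspaceT c).
exists (`|Re (g m)| + `|Im (g m)|) => t; rewrite min_l// max_r// => tab.
apply: le_trans (normc_le_ReIm _) _; apply: hm.
by rewrite in_itv.
Qed.

Lemma holomorphicM f g : holomorphic f -> holomorphic g -> holomorphic (fun w => f w * g w).
Proof.
by move=> hf hg w; have [a ha] := hf w; have [b hb] := hg w; eexists; exact: cderivM ha hb.
Qed.

Lemma holomorphic_comp f g : holomorphic f -> holomorphic g -> holomorphic (f \o g).
Proof.
by move=> hf hg w; have [b hb] := hg w; have [a ha] := hf (g w); eexists; exact: cderiv_comp hb ha.
Qed.

Lemma holomorphic_cst (c : R[i]) : holomorphic (fun=> c).
Proof. by move=> w; eexists; exact: cderiv_cst. Qed.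

Lemma holomorphic_cexp : holomorphic (@cexp R).
Proof. by move=> w; eexists; exact: cderiv_cexp. Qed.

Lemma holomorphicX f n : holomorphic f -> holomorphic (fun w => f w ^+ n).
Proof.
move=> hf; elim: n => [|n IH].
  by under eq_fun do rewrite expr0; exact: holomorphic_cst.
by under eq_fun do rewrite exprS; exact: holomorphicM.
Qed.

Lemma holomorphic_cexpN n : holomorphic (fun s : R[i] => (cexp s)^-1 ^+ n).
Proof.
apply: holomorphicX => w; eexists.
exact: cderiv_comp (cderiv_cexp w) (cderiv_inv (cexp_neq0 w)).
Qed.

Lemma circle_int_cexpN n (r : R) : circle_int (fun s => (cexp s)^-1 ^+ n) r =
  if n is 0 then twopi%:C else 0.
Proof.
case: n => [|n].
  rewrite /circle_int /vint.
  have -> : (fun t : R => (cexp (r%:C + iC * t%:C))^-1 ^+ 0) = (fun=> 1).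
    by apply/funext => t; rewrite expr0.
  rewrite (@cint_primitive _ (fun t : R => t%:C)); last 2 first.
  - exact: rcont_cst.
  - move=> t; split; last by rewrite /=; exact: is_derive_cst.
    by rewrite /=; exact: is_derive_id.
  by rewrite -raddfB subr0.
pose m : R[i] := - n.+1%:R.
have m0 : m != 0 by rewrite oppr_eq0 pnatr_eq0.
have E s : (cexp s)^-1 ^+ n.+1 = cexp (m * s).
  by rewrite exprVn -cexpMn -cexpN mulNr.
have dG s : cderiv (fun w => m^-1 * cexp (m * w)) s (cexp (m * s)).
  have h1 : cderiv (fun w => m * w) s (m * 1) by apply: cderivZ; exact: cderiv_id.
  have := cderivZ m^-1 (cderiv_comp h1 (cderiv_cexp (m * s))).
  by rewrite mulr1 mulrCA mulVf// mulr1.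
apply: (mulfI (_ : iC != 0)).
  by apply/eqP => /(congr1 (@Normc.normc R)); rewrite normc_iC Normc.normc0 => /eqP; rewrite oner_eq0.
rewrite mulr0 /circle_int /vint -cintZ; last first.
  exact: (@holomorphic_rcont_line _ (fun s => (cexp s)^-1 ^+ n.+1) _ _ (holomorphic_cexpN n.+1)).
rewrite (@cint_primitive _ (fun t : R => m^-1 * cexp (m * (r%:C + iC * t%:C)))); last 2 first.
- apply: rcontZ.
  exact: (@holomorphic_rcont_line _ (fun s => (cexp s)^-1 ^+ n.+1) _ _ (holomorphic_cexpN n.+1)).
- by move=> t; rewrite E; apply: (cderiv_line (dG _)).
rewrite -!E mulr0 addr0 cexp_periodic subrr//.
Qed.

Section Cauchy.
Variables (f f' : R[i] -> R[i]).
Hypothesis ff' : forall z, cderiv f z (f' z).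
Let F := entire_prim f.

Let holF : holomorphic F.
Proof. by move=> z; eexists; exact: (cderiv_entire_prim ff'). Qed.

(** Taylor coefficients of the primitive F, taken on the unit circle; any other radius gives the
    same value. *)
Definition cauchy_coef n : R[i] :=
  twopi%:C^-1 * circle_int (fun s => F (cexp s) * (cexp s)^-1 ^+ n) 0.

Let holFN n : holomorphic (fun s => F (cexp s) * (cexp s)^-1 ^+ n).
Proof.
apply: holomorphicM; last exact: holomorphic_cexpN.
exact: holomorphic_comp holF holomorphic_cexp.
Qed.

Lemma cauchy_coefE n r : circle_int (fun s => F (cexp s) * (cexp s)^-1 ^+ n) r =
  twopi%:C * cauchy_coef n.
Proof.
rewrite mulrA divff ?mul1r; last first.
  by rewrite (_ : 0 = 0%:C)// (inj_eq (@complexI R)) gt_eqF.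
by apply: circle_int_const; [exact: holFN|move=> s; rewrite cexp_periodic].
Qed.

Lemma circle_int_bound g (r M : R) : holomorphic g ->
  (forall s, Re s = r -> normc (g s) <= M) ->
  normc (circle_int g r) <= 2 * M * twopi.
Proof.
move=> hg hM.
have := @cint_bound _ (fun t => g (r%:C + iC * t%:C)) 0 twopi M
  (holomorphic_rcont_line _ _ hg).
rewrite subr0 (gtr0_norm twopi_gt0); apply => t _; apply: hM.
by rewrite ReD ReM /= mul0r mulr0 subr0 addr0.
Qed.

Lemma circle_bounded g (r : R) : holomorphic g ->
  (forall s, g (s + iC * twopi%:C) = g s) ->
  exists M, 0 <= M /\ forall t, Num.min 0 twopi <= t <= Num.max 0 twopi ->
    normc (g (r%:C + iC * t%:C)) <= M.
Proof.
move=> hg per.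
have [M hM] := rcont_bounded (ltW twopi_gt0) (holomorphic_rcont_line r%:C iC hg).
exists M; split=> //.
apply: le_trans (normc_ge0 _) (hM 0 _).
by rewrite ge_min le_max lexx.
Qed.

(** The integrand of Cauchy's formula in the coordinate s: the factor [cexp s] comes from d zeta = i
    zeta dt on a circle. *)
Let qz z s := diff_quot f z (cexp s) * cexp s.

Let hol_qz z : holomorphic (qz z).
Proof.
apply: holomorphicM; last exact: holomorphic_cexp.
exact: holomorphic_comp (holomorphic_diff_quot ff' z) holomorphic_cexp.
Qed.

(** The integral does not depend on the radius, and on a circle of small radius m it is O(m), since
    the difference quotient is bounded near 0. The centre itself has no preimage under exp, so it is
    only approached. *)
Lemma circle_int_diff_quot z (r : R) : circle_int (qz z) r = 0.
Proof.
apply: Normc.eq0_normc; apply/eqP; rewrite eq_le normc_ge0 andbT.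
have per s : qz z (s + iC * twopi%:C) = qz z s by rewrite /qz cexp_periodic.
have [d hd] := holomorphic_diff_quot ff' z 0.
have [delta d0 hdelta] := cderiv_cont hd ltr01.
pose B := normc (diff_quot f z 0) + 1.
have B0 : 0 < B by rewrite /B ltr_wpDl// normc_ge0.
apply/ler_addgt0Pr => e e0; rewrite add0r.
pose m := Num.min (delta / 2) (e / (2 * B * twopi)).
have m0 : 0 < m by rewrite lt_min !divr_gt0// mulr_gt0// mulr_gt0.
rewrite (circle_int_const r (ln m) (hol_qz z) per).
apply: le_trans (@circle_int_bound (qz z) (ln m) (B * m) (hol_qz z) _) _.
  move=> s hs; rewrite /qz Normc.normcM normc_cexp hs lnK ?posrE//.
  apply: ler_wpM2r; first exact: ltW.
  have := hdelta (cexp s); rewrite normc_cexp hs lnK ?posrE// add0r => h.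
  have -> : diff_quot f z (cexp s) =
     (diff_quot f z (cexp s) - diff_quot f z 0) + diff_quot f z 0 by rewrite subrK.
  apply: le_trans (normcD _ _) _; rewrite /B addrC lerD2l; apply: h.
  by rewrite gt_min; apply/orP; left; rewrite ltr_pdivrMr// ltr_pMr// ltr1n.
have -> : 2 * (B * m) * twopi = m * (2 * B * twopi) by ring.
rewrite -ler_pdivlMr ?mulr_gt0//.
by rewrite ge_min lexx orbT.
Qed.

(** Writing zeta for exp s, iterates qz = (F zeta - F z) + (z / zeta) qz. This is the geometric
    series of Cauchy's kernel with an exact remainder. *)
Lemma cauchy_expansion z n (s : R[i]) : qz z s =
  \sum_(k < n) z ^+ k * (F (cexp s) * (cexp s)^-1 ^+ k + - F z * (cexp s)^-1 ^+ k) +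
  z ^+ n * ((cexp s)^-1 ^+ n * qz z s).
Proof.
have s0 := cexp_neq0 s.
have e : F (cexp s) - F z = diff_quot f z (cexp s) * (cexp s - z).
  by rewrite diff_quotE.
elim: n => [|n IH]; first by rewrite big_ord0 !expr0 !mul1r add0r.
rewrite big_ord_recr /= {1}IH -addrA; congr (_ + _).
rewrite -mulrDl e /qz [z ^+ n.+1]exprS exprS.
move: ((cexp s)^-1 ^+ n) (z ^+ n) (diff_quot f z _) => u v q.
by field.
Qed.

(** Integrating the finite expansion: the left-hand side gives 0, the powers of 1/zeta pick out the
    coefficients, and the terms in F z survive for k = 0 only. *)
Lemma cauchy_power_series z : (fun n => psum cauchy_coef n z) @ \oo --> F z.
Proof.
(* On this circle |z / zeta| <= 1/2, so the remainder decays like 2^-n; the +1 keeps the radius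
   positive at z = 0. *)
pose r : R := ln (2 * (normc z + 1)).
have nz := normc_ge0 z.
have er : expR r = 2 * (normc z + 1) by rewrite lnK// posrE mulr_gt0// ltr_wpDl.
have [M [M0 hM]] : exists M, 0 <= M /\ forall t, Num.min 0 twopi <= t <= Num.max 0 twopi ->
    normc (qz z (r%:C + iC * t%:C)) <= M.
  by apply: circle_bounded (hol_qz z) _ => s; rewrite /qz cexp_periodic.
have tp0 : twopi%:C != 0 by rewrite (_ : 0 = 0%:C)// (inj_eq (@complexI R)) gt_eqF.
have h1 k : rcont (fun t : R => F (cexp (r%:C + iC * t%:C)) * (cexp (r%:C + iC * t%:C))^-1 ^+ k).
  exact: (@holomorphic_rcont_line _ (fun s => F (cexp s) * (cexp s)^-1 ^+ k) _ _ (holFN k)).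
have h2 k : rcont (fun t : R => (cexp (r%:C + iC * t%:C))^-1 ^+ k).
  exact: (@holomorphic_rcont_line _ (fun s => (cexp s)^-1 ^+ k) _ _ (holomorphic_cexpN k)).
have h3 : rcont (fun t : R => qz z (r%:C + iC * t%:C)) by exact: holomorphic_rcont_line.
pose rem n := cint (fun t : R => (cexp (r%:C + iC * t%:C))^-1 ^+ n * qz z (r%:C + iC * t%:C)) 0 twopi.
have h4 n : rcont (fun t : R => (cexp (r%:C + iC * t%:C))^-1 ^+ n * qz z (r%:C + iC * t%:C)).
  exact: rcontM.
have key n : twopi%:C * (F z - psum cauchy_coef n.+1 z) = z ^+ n.+1 * rem n.+1.
  have h5 k : rcont (fun t : R => z ^+ k * (F (cexp (r%:C + iC * t%:C)) * (cexp (r%:C + iC * t%:C))^-1 ^+ k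
       + - F z * (cexp (r%:C + iC * t%:C))^-1 ^+ k)).
    by apply: rcontZ; apply: rcontD => //; exact: rcontZ.
  have [h6 e6] := @cint_sum _ n.+1 _ 0 twopi h5.
  have := circle_int_diff_quot z r; rewrite /circle_int /vint.
  have -> : (fun t : R => qz z (r%:C + iC * t%:C)) = (fun t : R =>
    \sum_(k < n.+1) z ^+ k * (F (cexp (r%:C + iC * t%:C)) * (cexp (r%:C + iC * t%:C))^-1 ^+ k
       + - F z * (cexp (r%:C + iC * t%:C))^-1 ^+ k) +
    z ^+ n.+1 * ((cexp (r%:C + iC * t%:C))^-1 ^+ n.+1 * qz z (r%:C + iC * t%:C))).
    by apply/funext => t; exact: cauchy_expansion.
  rewrite cintD//; last exact: rcontZ.
  rewrite e6 cintZ// -/(rem _).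
  have -> : \sum_(k < n.+1) cint (fun t : R => z ^+ k * (F (cexp (r%:C + iC * t%:C)) * (cexp (r%:C + iC * t%:C))^-1 ^+ k
       + - F z * (cexp (r%:C + iC * t%:C))^-1 ^+ k)) 0 twopi =
     twopi%:C * psum cauchy_coef n.+1 z - twopi%:C * F z.
    transitivity (\sum_(k < n.+1) (twopi%:C * (cauchy_coef k * z ^+ k) -
       (if (k : nat) is 0 then twopi%:C * F z else 0))).
      apply: eq_bigr => k _; rewrite cintZ; last by apply: rcontD => //; exact: rcontZ.
      rewrite cintD//; last exact: rcontZ.
      rewrite cintZ//.
      have := cauchy_coefE k r; rewrite /circle_int /vint => ->.
      have := circle_int_cexpN k r; rewrite /circle_int /vint => ->.
      case: k => -[|k] kn /=; first by rewrite expr0 /twopi; ring.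
      by ring.
    rewrite sumrB -mulr_sumr -/(psum _ _ _); congr (_ - _).
    by rewrite big_ord_recl /= big1 ?addr0.
  by move=> /eqP; rewrite addrC addr_eq0 => /eqP ->; rewrite opprB mulrBr.
have rb n : normc (rem n) <= 2 * (M * (2 * (normc z + 1))^-1 ^+ n) * twopi.
  have := @cint_bound _ _ 0 twopi (M * (2 * (normc z + 1))^-1 ^+ n) (h4 n).
  rewrite subr0 (gtr0_norm twopi_gt0); apply => t ht.
  rewrite Normc.normcM normcX Normc.normcV normc_cexp.
  have -> : Re (r%:C + iC * t%:C) = r by rewrite ReD ReM /= mul0r mulr0 subr0 addr0.
  by rewrite er mulrC ler_wpM2r ?hM// exprn_ge0// invr_ge0 mulr_ge0// addr_ge0.
apply/cvg_normcP => e e0.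
have h21 : 0 <= (2^-1 : R) < 1 by lra.
have [N hN] := geometric_small (2 * M) h21 e0.
exists N.+1 => -[//|n] nN; rewrite normc_distC.
apply: le_lt_trans (hN n.+1 (ltnW nN)).
rewrite -(ler_pM2l twopi_gt0).
have -> : twopi * normc (F z - psum cauchy_coef n.+1 z) =
    normc (twopi%:C * (F z - psum cauchy_coef n.+1 z)).
  by rewrite [RHS]Normc.normcM normcR gtr0_norm.
rewrite key Normc.normcM normcX.
apply: le_trans (ler_wpM2l (exprn_ge0 _ nz) (rb _)) _.
have -> : normc z ^+ n.+1 * (2 * (M * (2 * (normc z + 1))^-1 ^+ n.+1) * twopi) =
   twopi * (2 * M * (normc z ^+ n.+1 * (2 * (normc z + 1))^-1 ^+ n.+1)) by ring.
rewrite ler_pM2l//; apply: ler_wpM2l; first by rewrite mulr_ge0.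
rewrite -exprMn lerXn2r ?nnegrE//.
  by rewrite divr_ge0// mulr_ge0// addr_ge0.
rewrite ler_pdivrMr ?mulr_gt0 ?ltr_wpDl//; lra.
Qed.

(** Cauchy's estimate on the circle of radius 1 / r. *)
Lemma fast_decay_cauchy : fast_decay cauchy_coef.
Proof.
move=> r r0.
have [M hM] := rcont_bounded (ltW twopi_gt0)
  (holomorphic_rcont_line (ln r^-1)%:C iC (holomorphic_comp holF holomorphic_cexp)).
have M0 : 0 <= M.
  by apply: le_trans (normc_ge0 _) (hM 0 _); rewrite ge_min le_max lexx.
exists (2 * M) => n.
rewrite -(ler_pM2l twopi_gt0).
have -> : twopi * normc (cauchy_coef n) = normc (twopi%:C * cauchy_coef n).
  by rewrite [RHS]Normc.normcM normcR gtr0_norm.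
rewrite -(cauchy_coefE n (ln r^-1)).
have := @cint_bound _ (fun t => F (cexp ((ln r^-1)%:C + iC * t%:C)) * (cexp ((ln r^-1)%:C + iC * t%:C))^-1 ^+ n)
  0 twopi (M * r ^+ n)
  (@holomorphic_rcont_line _ (fun s => F (cexp s) * (cexp s)^-1 ^+ n) _ _ (holFN n)).
rewrite subr0 (gtr0_norm twopi_gt0) => h.
have -> : twopi * (2 * M * r ^+ n) = 2 * (M * r ^+ n) * twopi by ring.
apply: h => t ht.
rewrite Normc.normcM normcX Normc.normcV normc_cexp.
have -> : Re ((ln r^-1)%:C + iC * t%:C) = ln r^-1.
  by rewrite ReD ReM /= mul0r mulr0 subr0 addr0.
rewrite lnK ?posrE ?invr_gt0// invrK; apply: ler_wpM2r.
  by rewrite exprn_ge0// ltW.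
exact: hM.
Qed.

End Cauchy.

Theorem entire_power_series f : holomorphic f ->
  exists2 a, fast_decay a & forall z, f z = power_series a z.
Proof.
move=> hf; have [f' ff'] := choice hf.
have fd := fast_decay_cauchy ff'.
exists (diff_coef (cauchy_coef f)) => [|z]; first exact: fast_decay_diff.
apply: (cderiv_unique (cderiv_entire_prim ff' z)).
have := cderiv_power_series z fd; apply: cderiv_ext => w.
by rewrite (power_series_unique (cauchy_power_series ff' (z := w))).
Qed.

End CauchyCircle.

(** * Gaussian integrals *)

Section Rotation.
Variable R : realType.
Local Notation mu := (@lebesgue_measure R).
Local Notation mu2 := (mu \x mu)%E.

Lemma measurable_shift (t : R) :
  measurable_fun setT ((fun x => x + t) : measurableTypeR R -> measurableTypeR R).
Proof. exact: measurable_funD. Qed.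

Lemma lebesgue_measure_shift (t : R) (A : set R) : measurable A ->
  pushforward mu ((fun x => x + t) : _ -> measurableTypeR R) A = mu A.
Proof.
move=> mA; apply/esym/lebesgue_measure_unique => //=; first exact: measurable_shift.
move=> _ _ [[a b]] _ <-; rewrite /fst /snd.
rewrite [RHS](_ : _ = mu `]a - t, b - t]%classic); last first.
  by rewrite /pushforward; congr (mu _); apply/seteqP; split=> x /=;
    rewrite !in_itv /= => /andP[? ?]; apply/andP; split; lra.
rewrite !lebesgue_measure_itv/= !lte_fin.
have -> : (a - t < b - t) = (a < b) by rewrite ltrD2r.
by case: ifP => // _; rewrite -!EFinB; congr (_%:E); lra.
Qed.

Local Open Scope ereal_scope.

Lemma integral_shift (f : R -> \bar R) (t : R) : measurable_fun setT f ->
  (forall x, 0 <= f x) -> \int[mu]_x f (x + t)%R = \int[mu]_x f x.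
Proof.
move=> mf f0.
have mt : measurable_fun setT ((fun x => x + t)%R : measurableTypeR R -> measurableTypeR R).
  by apply: measurable_funD.
have := @ge0_integral_pushforward _ _ (measurableTypeR R) (measurableTypeR R) R
  (fun x => x + t)%R mt mu setT f measurableT mf (fun x _ => f0 x).
rewrite preimage_setT => <-.
apply: eq_measure_integral => //= A mA _; exact: lebesgue_measure_shift.
Qed.

Definition shear1 (t : R) (w : R * R) : R * R := (w.1 + t * w.2, w.2)%R.
Definition shear2 (t : R) (w : R * R) : R * R := (w.1, w.2 + t * w.1)%R.

Lemma measurable_shear1 t : measurable_fun setT (shear1 t).
Proof.
apply: measurable_fun_pair => /=; last exact: measurable_snd.
by apply: measurable_funD => //; apply: measurable_funM.
Qed.

Lemma measurable_shear2 t : measurable_fun setT (shear2 t).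
Proof.
apply: measurable_fun_pair => /=; first exact: measurable_fst.
by apply: measurable_funD => //; apply: measurable_funM.
Qed.

(** For fixed second coordinate a shear is a translation of the first; Tonelli's theorem integrates
    the translated one first. *)
Lemma integral_shear1 (f : R * R -> \bar R) (t : R) : measurable_fun setT f ->
  (forall x, 0 <= f x) -> \int[mu2]_w f (shear1 t w) = \int[mu2]_w f w.
Proof.
move=> mf f0; have mg := measurableT_comp mf (measurable_shear1 t).
rewrite (@fubini_tonelli2 _ _ _ _ _ mu mu _ mf f0) (@fubini_tonelli2 _ _ _ _ _ mu mu _ mg (fun w => f0 _)).
apply: eq_integral => y _; rewrite /fubini_G /=.
rewrite -(@integral_shift (fun x => f (x, y)) (t * y)%R)//.
exact: measurableT_comp.
Qed.

Lemma integral_shear2 (f : R * R -> \bar R) (t : R) : measurable_fun setT f ->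
  (forall x, 0 <= f x) -> \int[mu2]_w f (shear2 t w) = \int[mu2]_w f w.
Proof.
move=> mf f0; have mg := measurableT_comp mf (measurable_shear2 t).
rewrite (@fubini_tonelli1 _ _ _ _ _ mu mu _ mf f0) (@fubini_tonelli1 _ _ _ _ _ mu mu _ mg (fun w => f0 _)).
apply: eq_integral => y _; rewrite /fubini_F /=.
rewrite -(@integral_shift (fun x => f (y, x)) (t * y)%R)//.
exact: measurableT_comp.
Qed.

Definition rotate (c : R[i]) (w : R * R) : R * R :=
  (complex.Re c * w.1 - complex.Im c * w.2, complex.Im c * w.1 + complex.Re c * w.2)%R.

Lemma to_complex_rotate c w : to_complex (rotate c w) = (c * to_complex w)%R.
Proof. by case: c w => a b [x y]; apply/eqP; rewrite eq_complex /= !eqxx ?[(b * x + _)%R]addrC eqxx. Qed.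

Lemma measurable_rotate c : measurable_fun setT (rotate c).
Proof.
by apply: measurable_fun_pair => /=; [apply: measurable_funB|apply: measurable_funD];
  apply: measurable_funM.
Qed.

(* A rotation by [a + ib], [b <> 0], is a product of three shears. *)
Lemma integral_rotate (f : R * R -> \bar R) (c : R[i]) : measurable_fun setT f ->
  (forall x, 0 <= f x) -> Normc.normc c = 1%R ->
  \int[mu2]_w f (rotate c w) = \int[mu2]_w f w.
Proof.
have gen g (d : R[i]) : measurable_fun setT g -> (forall x, 0 <= g x) ->
    Normc.normc d = 1%R -> complex.Im d != 0%R ->
    \int[mu2]_w g (rotate d w) = \int[mu2]_w g w.
  move=> mg g0 d1 b0; case: d d1 b0 => a b /= d1 b0.
  have ab1 : (a ^+ 2 + b ^+ 2 = 1)%R.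
    by rewrite -[RHS](expr1n _ 2) -d1 sqr_sqrtr// addr_ge0 ?sqr_ge0.
  (* Equals - tan (theta / 2) for the angle theta of d; the middle shear has factor sin theta. *)
  pose t := ((a - 1) / b)%R.
  have mg1 : measurable_fun setT (fun w : R * R => g (shear1 t w)).
    by apply: measurableT_comp => //; exact: measurable_shear1.
  have mg2 : measurable_fun setT (fun w : R * R => g (shear1 t (shear2 b w))).
    by apply: (measurableT_comp mg1); exact: measurable_shear2.
  rewrite -(integral_shear1 t mg g0).
  rewrite -(@integral_shear2 (fun w => g (shear1 t w)) b)//=.
  rewrite -(@integral_shear1 (fun w => g (shear1 t (shear2 b w))) t)//=.
  apply: eq_integral => -[x y] _; congr g; rewrite /rotate /shear1 /shear2 /= /t; congr pair.
    transitivity (a * x + ((a - 1) + (a - 1) * (a - 1 + 1)) / b * y)%R; last by field.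
    have -> : ((a - 1) + (a - 1) * (a - 1 + 1) = - b ^+ 2)%R by rewrite -[(b ^+ 2)%R](addKr (a ^+ 2)%R) ab1; ring.
    by field.
  by field.
move=> mf f0 c1; have [b0|] := eqVneq (complex.Im c) 0%R; last exact: gen.
case: c b0 c1 => a _ /= -> ; rewrite expr0n /= addr0 sqrtr_sqr => a1.
have ni : Normc.normc (0%R +i* 1%R : R[i]) = 1%R by rewrite /= expr0n expr1n add0r sqrtr1.
have i0 : complex.Im (0%R +i* 1%R : R[i]) != 0%R by rewrite /= oner_eq0.
(* A real c of modulus 1 is 1, the identity, or -1, a quarter turn performed twice. *)
have [|] := leP 0%R a => a0.
  rewrite (ger0_norm a0) in a1; apply: eq_integral => -[x y] _.
  by rewrite /rotate /= a1 !mul1r !mul0r subr0 add0r.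
rewrite (ltr0_norm a0) in a1.
have mg := measurableT_comp mf (measurable_rotate (0%R +i* 1%R)).
rewrite -[RHS](gen f (0%R +i* 1%R) mf)// -[RHS](gen _ (0%R +i* 1%R) mg)//; last first.
  by move=> w; exact: f0.
apply: eq_integral => -[x y] _; congr f; rewrite /rotate /=; congr pair;
  have -> : a = (-1)%R by [rewrite -a1 opprK | rewrite -a1 opprK]; ring.
Qed.

End Rotation.

(** * Moments of the Gaussian weight *)

Section GaussMoments.
Variable R : realType.
Local Notation mu := (@lebesgue_measure R).
Local Notation mu2 := (mu \x mu)%E.

Lemma is_derive_pow (x : R) n : is_derive x 1 (fun y : R => y ^+ n) (n%:R * x ^+ n.-1).
Proof.
have := is_deriveX n (is_derive_id x (1:R)).
rewrite (_ : id ^+ n = fun y : R => y ^+ n); last by rewrite exprfctE.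
by move=> h; apply: is_derive_eq; rewrite /GRing.scale /= mulr1.
Qed.

Lemma is_derive_gauss_fun (x : R) :
  is_derive x 1 (@gauss_fun R) (- (2 * x) * gauss_fun x).
Proof.
have h := is_deriveN (is_derive_pow x 2).
have h' := @is_derive1_comp R expR (- (fun y : R => y ^+ 2)) x _ _ (is_derive_expR _) h.
by apply: (is_derive_eq h'); rewrite /gauss_fun expr1 mulrC.
Qed.

Definition gmono k (x : R) : R := (x ^+ 2) ^+ k * gauss_fun x.

Lemma gmono_ge0 k x : 0 <= gmono k x.
Proof. by rewrite mulr_ge0 ?gauss_fun_ge0// exprn_ge0 ?sqr_ge0. Qed.

Lemma continuous_gmono k : continuous (gmono k).
Proof.
move=> x; apply: cvgM; last exact: continuous_gauss_fun.
by rewrite -exprM; under eq_fun do rewrite -exprM; exact: exprn_continuous.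
Qed.

Lemma measurable_gmono k : measurable_fun setT (gmono k).
Proof. exact: continuous_measurable_fun (@continuous_gmono k). Qed.

(* [Gamma (k + 1/2)] *)
Fixpoint gmoment k : R :=
  if k is k'.+1 then (k'%:R + 2^-1) * gmoment k' else Num.sqrt pi.

Lemma gmoment_ge0 k : 0 <= gmoment k.
Proof. by elim: k => [|k IH] /=; rewrite ?sqrtr_ge0// mulr_ge0// addr_ge0. Qed.

(** Integration by parts: the derivative of x^(2k+1) exp(-x^2) is the combination on the left. *)
Lemma gmono_parts k (N : nat) :
  (2 * k%:R + 1) * (\int[mu]_(x in `[0%R, N%:R]) gmono k x)%R
  - 2 * (\int[mu]_(x in `[0%R, N%:R]) gmono k.+1 x)%R = N%:R * gmono k N%:R.
Proof.
have int j (M : R) : mu.-integrable `[0, M] (EFin \o gmono j).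
  apply: continuous_compact_integrable; first exact: segment_compact.
  by apply: continuous_subspaceT; exact: continuous_gmono.
case: N => [|N].
  by rewrite set_itv1 !Rintegral_set1 mul0r !mulr0 subr0.
have N0 : 0 < N.+1%:R :> R by [].
pose F x := x * gmono k x.
pose f x := (2 * k%:R + 1) * gmono k x - 2 * gmono k.+1 x.
have dF (x : R) : is_derive x 1 F (f x).
  rewrite (_ : F = (fun y : R => y ^+ (2 * k).+1) * @gauss_fun R); last first.
    by apply/funext => y; rewrite /F /gmono mulrA -exprM -exprS.
  have d1 := is_derive_pow x (2 * k).+1; have d2 := is_derive_gauss_fun x.
  apply: is_derive_eq; rewrite /f /GRing.scale /= /gmono -!exprM.
  by rewrite -(@natr1 R (2 * k)%N) natrM mulnS !exprS; move: (_ ^+ _) (gauss_fun x) => u e; ring.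
have cf : continuous f.
  by move=> x; apply: cvgB; apply: cvgM; (exact: cvg_cst || exact: continuous_gmono).
have := @continuous_FTC2 R f F 0 N.+1%:R N0 _ _ _.
have F0 : F 0 = 0 by rewrite /F mul0r.
rewrite F0 => h.
have : (\int[mu]_(x in `[0%R, N.+1%:R]) (f x)%:E = (F N.+1%:R)%:E)%E.
  rewrite h ?sube0//.
  - exact: continuous_subspaceT.
  - split.
    + by move=> x _; case: (dF x).
    + apply: cvg_at_right_filter; apply: differentiable_continuous; apply/derivable1_diffP; by case: (dF 0).
    + apply: cvg_at_left_filter; apply: differentiable_continuous; apply/derivable1_diffP; by case: (dF N.+1%:R).
  - by move=> x _; rewrite derive1E; case: (dF x).
move=> /(congr1 fine); rewrite -[fine _]/(\int[mu]_(x in `[0%R, N.+1%:R]) f x)%R => IF.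
rewrite -[RHS]IF.
rewrite RintegralB//; last 2 first.
- by apply: continuous_compact_integrable; [exact: segment_compact|apply: continuous_subspaceT => x; apply: cvgM; [exact: cvg_cst|exact: continuous_gmono]].
- by apply: continuous_compact_integrable; [exact: segment_compact|apply: continuous_subspaceT => x; apply: cvgM; [exact: cvg_cst|exact: continuous_gmono]].
by rewrite !RintegralZl.
Qed.

Lemma gmono_boundary k : (fun N : nat => N%:R * gmono k N%:R) @ \oo --> (0 : R).
Proof.
(* From exp(x^2) >= x^(2k+2) / (k+1)! the value at N >= 1 is at most (k+1)! / N; the factor 2 passes
   from 1/N to the harmonic 1/(N+1). *)
apply: (@squeeze_cvgr _ _ _ _ (cst 0) (fun N : nat => k.+1`!%:R * N.+1%:R^-1 * 2)).
- apply: nearW => -[|N] /=; first by rewrite mul0r lexx /= !mulr_ge0.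
  rewrite mulr_ge0 ?gmono_ge0//=.
  have h := exp_coeff_le k.+1 (sqr_ge0 (N.+1%:R : R)).
  rewrite /gmono /gauss_fun expRN.
  have e0 := expR_gt0 ((N.+1%:R : R) ^+ 2).
  rewrite mulrA ler_pdivrMr// ler_pdivrMr// in h *.
  have f0 : 0 < k.+1`!%:R :> R by rewrite ltr0n fact_gt0.
  apply: (@le_trans _ _ ((N.+1%:R ^+ 2) ^+ k.+1 / N.+2%:R * 2)).
    have -> : (N.+1%:R ^+ 2 : R) ^+ k.+1 / N.+2%:R * 2 =
        (N.+1%:R * (N.+1%:R * 2 / N.+2%:R)) * (N.+1%:R ^+ 2) ^+ k.
      by rewrite exprS; move: (_ ^+ k) (_^-1) => u v; ring.
    rewrite ler_wpM2r ?exprn_ge0// ler_peMr// ler_pdivlMr// mul1r.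
    by rewrite -natrM ler_nat; lia.
  rewrite [leRHS]mulrC 2!mulrA ler_wpM2r// ler_wpM2r ?invr_ge0//.
- exact: cvg_cst.
- rewrite -[X in _ --> X](mul0r 2); apply: cvgM; last exact: cvg_cst.
  rewrite -(mulr0 k.+1`!%:R); apply: cvgM; first exact: cvg_cst.
  exact: cvg_harmonic.
Qed.

Local Open Scope ereal_scope.

Lemma integral_gmono0y k :
  \int[mu]_(x in `[0%R, +oo[) (gmono k x)%:E = (gmoment k / 2)%:E.
Proof.
elim: k => [|k IH].
  rewrite -integral0y_gauss; apply: eq_integral => x _.
  by rewrite /gmono expr0 mul1r.
have cv j := @ge0_cvgn_integral R mu _ (gmono_ge0 j) (measurable_gmono j).
have fin j n : \int[mu]_(x in `[0%R, n%:R]) (gmono j x)%:E =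
    (\int[mu]_(x in `[0%R, n%:R]) gmono j x)%R%:E.
  rewrite /Rintegral fineK//; apply: integrable_fin_num => //.
  apply: continuous_compact_integrable; first exact: segment_compact.
  by apply: continuous_subspaceT; exact: continuous_gmono.
have cvk := cv k; rewrite IH in cvk.
have cvk1 := cv k.+1.
apply: (cvg_unique _ cvk1) => //=.
rewrite [X in X @ _](_ : _ = fun n : nat =>
    (\int[mu]_(x in `[0%R, n%:R]) gmono k.+1 x)%R%:E); last exact/funext.
apply: cvg_EFin; first exact: nearW.
rewrite [X in X @ _](_ : _ = fun n : nat => (2^-1 * ((2 * k%:R + 1) *
   (\int[mu]_(x in `[0%R, n%:R]) gmono k x)%R - n%:R * gmono k n%:R))%R); last first.
  by apply/funext => n /=; have := gmono_parts k n; move: (Rintegral _ _ _) (Rintegral _ _ _) => a b; lra.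
have -> : (gmoment k.+1 / 2 = 2^-1 * ((2 * k%:R + 1) * (gmoment k / 2) - 0))%R.
  by rewrite /=; field.
apply: cvgM; first exact: cvg_cst.
apply: cvgB; last exact: gmono_boundary.
apply: cvgM; first exact: cvg_cst.
move: cvk; rewrite [X in X @ _](_ : _ = fun n : nat =>
    (\int[mu]_(x in `[0%R, n%:R]) gmono k x)%R%:E); last exact/funext.
by move/fine_cvg.
Qed.

Lemma integral_gmono k : \int[mu]_x (gmono k x)%:E = (gmoment k)%:E.
Proof.
rewrite ge0_symfun_integralT//=.
- rewrite (_ : [set x | _] = `[0%R, +oo[%classic); last first.
    by apply/seteqP; split => x/=; rewrite in_itv/= andbT.
  by rewrite integral_gmono0y -EFinM; congr (_%:E); field.
- exact: gmono_ge0.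
- exact: continuous_gmono.
- by move=> x/=; rewrite /gmono /gauss_fun sqrrN.
Qed.

Lemma measurable_gmono2 i j : measurable_fun setT
  (fun w : R * R => (gmono i w.1 * gmono j w.2)%R%:E).
Proof.
apply/measurable_EFinP; apply: measurable_funM => /=.
  by apply: (measurableT_comp (measurable_gmono i)).
by apply: (measurableT_comp (measurable_gmono j)).
Qed.

Lemma integral_gmono2 i j :
  \int[mu2]_w (gmono i w.1 * gmono j w.2)%:E = (gmoment i * gmoment j)%:E.
Proof.
rewrite (@fubini_tonelli1 _ _ _ _ _ mu mu _ (measurable_gmono2 i j)); last first.
  by move=> w; rewrite lee_fin mulr_ge0 ?gmono_ge0.
rewrite /fubini_F /=.
under eq_integral => x _.
  under eq_integral => y _ do rewrite EFinM.
  rewrite ge0_integralZl_EFin ?gmono_ge0//; last 2 first.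
  - by move=> y _; rewrite lee_fin gmono_ge0.
  - by apply/measurable_EFinP; exact: measurable_gmono.
  rewrite integral_gmono muleC.
  over.
rewrite ge0_integralZl_EFin ?gmoment_ge0//; last 2 first.
- by move=> y _; rewrite lee_fin gmono_ge0.
- by apply/measurable_EFinP; exact: measurable_gmono.
by rewrite integral_gmono -EFinM mulrC.
Qed.

Definition radial n (w : R * R) : R :=
  ((w.1 ^+ 2 + w.2 ^+ 2) ^+ n * expR (- (w.1 ^+ 2 + w.2 ^+ 2)))%R.

Lemma radialE n w : radial n w =
  (\sum_(i < n.+1) 'C(n, i)%:R * (gmono (n - i) w.1 * gmono i w.2))%R.
Proof.
rewrite /radial exprDn mulr_suml; apply: eq_bigr => i _.
by rewrite opprD expRD /gmono /gauss_fun -mulr_natl; ring.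
Qed.

Lemma radialSE n w : radial n.+1 w =
  (\sum_(i < n.+1) 'C(n, i)%:R * (gmono (n - i).+1 w.1 * gmono i w.2 + gmono (n - i) w.1 * gmono i.+1 w.2))%R.
Proof.
rewrite /radial exprS -mulrA -/(radial n w) radialE mulr_sumr; apply: eq_bigr => i _.
rewrite /gmono !exprS; ring.
Qed.

(** No polar coordinates: in the binomial expansion one extra factor x^2 + y^2 raises the moment
    index in x or in y, and the recurrence of the moments contributes (n - i + 1/2) + (i + 1/2) = n
    + 1 in every term. *)
Lemma integral_radial n : \int[mu2]_w (radial n w)%:E = (pi * n`!%:R)%:E.
Proof.
have g2 i j w : 0 <= (gmono i w.1 * gmono j w.2)%:E by rewrite lee_fin mulr_ge0 ?gmono_ge0.
have g3 c i j w : 0 <= (c%:R * (gmono i w.1 * gmono j w.2))%:E.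
  by rewrite lee_fin; exact: mulr_ge0 (ler0n _ _) (mulr_ge0 (gmono_ge0 _ _) (gmono_ge0 _ _)).
have mg c i j : measurable_fun setT (fun w : R * R => (c%:R * (gmono i w.1 * gmono j w.2))%R%:E).
  by under eq_fun do rewrite EFinM; apply: measurable_funeM; exact: measurable_gmono2.
elim: n => [|n IH].
  rewrite fact0 mulr1.
  transitivity (\int[mu2]_w (gmono 0 w.1 * gmono 0 w.2)%:E).
    by apply: eq_integral => w _; rewrite radialE big_ord1 /= mul1r.
  by rewrite integral_gmono2 /= -expr2 sqr_sqrtr ?pi_ge0.
rewrite factS natrM mulrCA EFinM -IH.
transitivity (\sum_(i < n.+1) ('C(n, i)%:R * (gmoment (n - i).+1 * gmoment i + gmoment (n - i) * gmoment i.+1))%:E).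
  under eq_integral => w _.
    rewrite radialSE -sumEFin; under eq_bigr do rewrite mulrDr EFinD; over.
  rewrite ge0_integral_sum//; last 2 first.
  - by move=> i; apply: emeasurable_funD; exact: mg.
  - by move=> i w _; exact: adde_ge0.
  apply: eq_bigr => i _; rewrite ge0_integralD//; [|exact: mg..].
  under eq_integral do rewrite EFinM.
  under [X in _ + X]eq_integral do rewrite EFinM.
  rewrite !ge0_integralZl_EFin//; try exact: measurable_gmono2.
  by rewrite !integral_gmono2 mulrDr EFinD !EFinM.
under [in RHS]eq_integral => w _ do rewrite radialE -sumEFin.
rewrite ge0_integral_sum//; last by move=> i; exact: mg.
rewrite ge0_sume_distrr; last first.
  by move=> i _; apply: integral_ge0 => w _; exact: g3.
apply: eq_bigr => i _.
under [in RHS]eq_integral do rewrite EFinM.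
rewrite ge0_integralZl_EFin//; last exact: measurable_gmono2.
rewrite integral_gmono2 -!EFinM; congr (_%:E) => /=.
have lein : (i <= n)%N by rewrite -ltnS.
rewrite (natrB _ lein) -(@natr1 R n).
by move: ('C(n, i)%:R%R) (gmoment _) (gmoment _) => a b c; field.
Qed.

End GaussMoments.

Section Fatou.
Context d (T : measurableType d) (R : realType) (m : {measure set T -> \bar R}).
Local Open Scope ereal_scope.

Lemma fatou_le (f : nat -> T -> R) (g : T -> R) (B : \bar R) :
  (forall n, measurable_fun setT (f n)) -> measurable_fun setT g ->
  (forall n x, (0 <= f n x)%R) -> (forall x, (0 <= g x)%R) ->
  (forall x eps, (0 < eps)%R -> exists N, forall n, (N <= n)%N -> (g x <= f n x + eps)%R) ->
  (forall n, \int[m]_x (f n x)%:E <= B) -> \int[m]_x (g x)%:E <= B.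
Proof.
move=> mf mg f0 g0 hg hB.
have mf' n : measurable_fun setT (fun x => (f n x)%:E) by exact/measurable_EFinP.
apply: (@le_trans _ _ (\int[m]_x limn_einf (fun n => (f n x)%:E))).
  apply: ge0_le_integral => //.
  - by move=> x _; rewrite lee_fin.
  - exact/measurable_EFinP.
  - rewrite (_ : (fun x => _) = (fun x => limn (einfs (fun n => (f n x)%:E)))).
      apply: (@emeasurable_fun_cvg _ _ _ _ (fun n x => einfs (fun n => (f n x)%:E) n)).
        by move=> n; exact: (@measurable_fun_einfs _ _ _ _ (fun n x => (f n x)%:E)).
      by move=> x _; exact: is_cvg_einfs.
    by apply/funext => x; rewrite limn_einf_lim.
  - move=> x _; apply/lee_addgt0Pr => e e0.
    have [N hN] := hg x e e0.
    rewrite limn_einf_lim -leeBlDr//.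
    apply: lime_ge; first exact: is_cvg_einfs.
    exists N => // n /= Nn; apply: le_ereal_inf_tmp => _ [k /= nk <-].
    by rewrite -EFinB lee_fin lerBlDr; apply: hN; exact: leq_trans nk.
apply: le_trans (fatou m measurableT mf' _) _; first by move=> n x _; rewrite lee_fin.
rewrite limn_einf_lim; apply: lime_le; first exact: is_cvg_einfs.
by apply: nearW => n; apply: le_trans (hB n); apply: ereal_inf_lbound; exists n => /=.
Qed.

End Fatou.

(** * Parseval's identity on roots of unity *)

Section RootsOfUnity.
Variable R : realType.
Implicit Types (z w c : R[i]) (a : nat -> R[i]).

Lemma normc_conj z : ((normc z) ^+ 2)%:C = z * conjc z.
Proof.
by rewrite normc_sqr; case: z => x y; apply/eqP; rewrite eq_complex /=; apply/andP; split; apply/eqP; ring.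
Qed.

(** Orders are restricted to powers of 2 because iterated square roots of -1 then supply the
    roots. *)
Lemma ex_prim_root_pow2 n : exists2 c : R[i], (2 ^ n.+1).-primitive_root c & normc c = 1.
Proof.
have [c cN] : exists c : R[i], c ^+ (2 ^ n) = -1.
  elim: n => [|n [c cN]]; first by exists (-1); rewrite expn0 expr1.
  by exists (sqrtc c); rewrite expnS exprM sqr_sqrtc.
have cN1 : c ^+ (2 ^ n.+1) = 1 by rewrite expnSr exprM cN sqrrN expr1n.
have c1 : normc c = 1.
  apply/eqP; rewrite -(@pexpr_eq1 _ _ (2 ^ n.+1)) ?expn_gt0 ?normc_ge0//.
  by rewrite -normcX cN1 normcR normr1.
exists c => //.
have [k pk] := prim_order_exists (expn_gt0 2 n.+1) cN1.
case/(dvdn_pfactor _ _ (isT : prime 2)) => j; rewrite leq_eqVlt => /orP[/eqP -> kE|jn kE].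
  by rewrite -kE.
have : c ^+ (2 ^ n) = 1.
  by apply/eqP; rewrite -(prim_order_dvd pk) kE dvdn_exp2l// -ltnS.
rewrite cN => /eqP; rewrite -subr_eq0 -opprD oppr_eq0.
have -> : 1 + 1 = (2 : R)%:C :> R[i] by rewrite rmorph_nat.
by rewrite -[0]/((0 : R)%:C) (inj_eq (@complexI R)) pnatr_eq0.
Qed.

Lemma sum_prim_root c N k l : N.-primitive_root c -> normc c = 1 ->
  (k < N)%N -> (l < N)%N ->
  \sum_(i < N) (c ^+ k * conjc c ^+ l) ^+ i = if k == l then N%:R else 0.
Proof.
move=> pc c1 kN lN.
have cc : c * conjc c = 1 by rewrite -normc_conj c1 expr1n.
case: eqP => [->|/eqP kl].
  under eq_bigr do rewrite -exprMn cc !expr1n.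
  by rewrite sumr_const card_ord.
set x := _ * _.
have x1 : x - 1 != 0.
  apply: contra kl; rewrite subr_eq0 => /eqP xE.
  have : c ^+ k == c ^+ l.
    by rewrite -[X in _ == X]mulr1 -[X in _ == _ * X]xE /x mulrCA -exprMn cc expr1n mulr1.
  by rewrite (eq_prim_root_expr pc) !modn_small.
apply/eqP; rewrite -(mulrI_eq0 _ (mulfI x1)) -subrX1 subr_eq0; apply/eqP.
rewrite /x exprMn -!exprM ![(_ * N)%N]mulnC !exprM (prim_expr_order pc).
by rewrite -(rmorphXn (@conjc R)) (prim_expr_order pc) rmorph1 !expr1n mulr1.
Qed.

(** N sample points are exact for polynomials of degree below N, so a finite sum replaces the
    integral over the angle. *)
Lemma parseval_psum a c N z : N.-primitive_root c -> normc c = 1 ->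
  \sum_(k < N) normc (psum a N (c ^+ k * z)) ^+ 2 =
  N%:R * \sum_(n < N) normc (a n) ^+ 2 * (normc z ^+ 2) ^+ n.
Proof.
move=> pc c1; apply: (@complexI R).
rewrite rmorphM rmorph_nat !rmorph_sum /=.
under eq_bigr => k _.
  rewrite normc_conj /psum rmorph_sum mulr_suml /=.
  under eq_bigr => n _ do rewrite mulr_sumr.
  over.
rewrite exchange_big mulr_sumr /=; apply: eq_bigr => n _.
rewrite exchange_big /=.
rewrite (eq_bigr (fun l : 'I_N => (a n * z ^+ n) * conjc (a l * z ^+ l) *
   \sum_(k < N) (c ^+ n * conjc c ^+ l) ^+ k)).
  under eq_bigr => l _ do rewrite sum_prim_root//.
  rewrite (bigD1 n)//= eqxx big1 ?addr0.
    by rewrite -normc_conj mulrC Normc.normcM exprMn normcX -exprM mulnC exprM.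
  by move=> l ln; rewrite (_ : (n == l :> nat) = false) ?mulr0//; apply/negbTE; rewrite eq_sym.
move=> l _; rewrite mulr_sumr; apply: eq_bigr => k _.
rewrite !rmorphM !rmorphXn !rmorphM !rmorphXn /= !exprMn -!exprM [(l * k)%N]mulnC [(n * k)%N]mulnC.
ring.
Qed.

End RootsOfUnity.

(** * The Gaussian norm of a power series *)

Section GaussianNorm.
Variable R : realType.
Local Notation mu := (@lebesgue_measure R).
Local Notation mu2 := (mu \x mu)%E.
Implicit Types (f g : R[i] -> R[i]) (z : R[i]) (w : R * R) (a : nat -> R[i]).

Definition cmeas f :=
  measurable_fun setT (fun w : R * R => complex.Re (f (to_complex w))) /\
  measurable_fun setT (fun w : R * R => complex.Im (f (to_complex w))).

Lemma cmeas_cst (c : R[i]) : cmeas (fun=> c).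
Proof. by split; exact: measurable_cst. Qed.

Lemma cmeas_id : cmeas id.
Proof. by split => /=; [exact: measurable_fst|exact: measurable_snd]. Qed.

Lemma cmeasD f g : cmeas f -> cmeas g -> cmeas (fun z => f z + g z).
Proof.
move=> [f1 f2] [g1 g2]; split.
  by under eq_fun do rewrite raddfD; exact: measurable_funD.
by under eq_fun do rewrite raddfD; exact: measurable_funD.
Qed.

Lemma cmeasM f g : cmeas f -> cmeas g -> cmeas (fun z => f z * g z).
Proof.
move=> [f1 f2] [g1 g2]; split.
  by under eq_fun do rewrite ReM; apply: measurable_funB; apply: measurable_funM.
by under eq_fun do rewrite ImM; apply: measurable_funD; apply: measurable_funM.
Qed.

Lemma cmeas_sum (I : Type) (s : seq I) (F : I -> R[i] -> R[i]) :
  (forall i, cmeas (F i)) -> cmeas (fun z => \sum_(i <- s) F i z).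
Proof.
move=> mF; elim: s => [|i s IH].
  by under eq_fun do rewrite big_nil; exact: cmeas_cst.
by under eq_fun do rewrite big_cons; exact: cmeasD.
Qed.

Lemma cmeasX n : cmeas (fun z => z ^+ n).
Proof.
elim: n => [|n IH]; first exact: cmeas_cst.
by under eq_fun do rewrite exprS; apply: cmeasM => //; exact: cmeas_id.
Qed.

Lemma cmeas_psum a n : cmeas (psum a n).
Proof.
apply: cmeas_sum => k; apply: cmeasM; [exact: cmeas_cst|exact: cmeasX].
Qed.

Lemma cmeas_power_series a : fast_decay a -> cmeas (power_series a).
Proof.
move=> ha; split.
- apply: (@measurable_fun_cvg _ _ _ _ (fun n w => complex.Re (psum a n (to_complex w)))).
    by move=> n; case: (cmeas_psum a n).
  move=> w _; apply/cvgrPdist_lt => e e0.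
  have /cvg_normcP/(_ e e0)[N hN] := @power_series_cvg R a (to_complex w) ha.
  exists N => // n /= /hN; apply: le_lt_trans.
  by rewrite distrC -raddfB normc_Re.
- apply: (@measurable_fun_cvg _ _ _ _ (fun n w => complex.Im (psum a n (to_complex w)))).
    by move=> n; case: (cmeas_psum a n).
  move=> w _; apply/cvgrPdist_lt => e e0.
  have /cvg_normcP/(_ e e0)[N hN] := @power_series_cvg R a (to_complex w) ha.
  exists N => // n /= /hN; apply: le_lt_trans.
  by rewrite distrC -raddfB normc_Im.
Qed.

Lemma normc_lip (x y : R[i]) : `|normc x - normc y| <= normc (x - y).
Proof.
have := normcD (x - y) y; have := normcD (y - x) x.
rewrite !subrK (normc_distC y x) ler_norml => h1 h2; apply/andP; split; lra.
Qed.

Definition gdens f w : R := normc (f (to_complex w)) ^+ 2 * gauss_weight (to_complex w).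

Lemma gauss_weightE w : gauss_weight (to_complex w) = expR (- (w.1 ^+ 2 + w.2 ^+ 2)).
Proof. by rewrite /gauss_weight normc_sqr. Qed.

Lemma measurable_gauss_weight :
  measurable_fun setT (fun w : R * R => gauss_weight (to_complex w)).
Proof.
under eq_fun do rewrite gauss_weightE.
apply: measurableT_comp; first exact: measurable_expR.
apply: measurableT_comp => //.
by apply: measurable_funD; apply: measurable_funX.
Qed.

Lemma measurable_gdens f : cmeas f -> measurable_fun setT (gdens f).
Proof.
move=> [f1 f2]; apply: measurable_funM; last exact: measurable_gauss_weight.
by under eq_fun do rewrite normc_sqr; apply: measurable_funD; apply: measurable_funX.
Qed.

Lemma gdens_ge0 f w : 0 <= gdens f w.
Proof. by rewrite mulr_ge0 ?sqr_ge0// expR_ge0. Qed.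

Lemma gauss_weight_rotate (c : R[i]) w : normc c = 1 ->
  gauss_weight (to_complex (rotate c w)) = gauss_weight (to_complex w).
Proof. by move=> c1; rewrite /gauss_weight to_complex_rotate Normc.normcM c1 mul1r. Qed.

Definition circle_avg f (c : R[i]) N w : R :=
  N%:R^-1 * \sum_(k < N) gdens f (rotate (c ^+ k) w).

Lemma measurable_circle_avg f c N : cmeas f -> measurable_fun setT (circle_avg f c N).
Proof.
move=> mf; apply: measurable_funM => //.
apply: measurable_sum => k.
by apply: (measurableT_comp (measurable_gdens mf)); exact: measurable_rotate.
Qed.

Lemma circle_avg_ge0 f c N w : 0 <= circle_avg f c N w.
Proof. by rewrite mulr_ge0 ?invr_ge0// sumr_ge0// => k _; exact: gdens_ge0. Qed.

Lemma integral_circle_avg f c N : cmeas f -> normc c = 1 ->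
  (\int[mu2]_w (circle_avg f c N.+1 w)%:E = \int[mu2]_w (gdens f w)%:E)%E.
Proof.
move=> mf c1.
have mg : measurable_fun setT (fun w => (gdens f w)%:E).
  by apply/measurable_EFinP; exact: measurable_gdens.
have mr k : measurable_fun setT (fun w : R * R => (gdens f (rotate (c ^+ k) w))%:E).
  by apply: (measurableT_comp mg); exact: measurable_rotate.
have g0 k w : (0 <= (gdens f (rotate (c ^+ k) w))%:E)%E by rewrite lee_fin gdens_ge0.
under eq_integral do rewrite EFinM -sumEFin.
rewrite ge0_integralZl_EFin//; last 2 first.
- by move=> w _; exact: sume_ge0.
- by apply: emeasurable_sum => k; exact: mr.
rewrite ge0_integral_sum//; last by move=> k; exact: mr.
rewrite (eq_bigr (fun=> \int[mu2]_w (gdens f w)%:E)%E); last first.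
  move=> k _; apply: (@integral_rotate R (fun w => (gdens f w)%:E)) => //.
  - by move=> w; rewrite lee_fin gdens_ge0.
  - by rewrite normcX c1 expr1n.
move: (integral _ _ _) => I.
rewrite (_ : (\sum_(i < N.+1) I)%R = (N.+1%:R)%:E * I)%E; last first.
  by rewrite sumr_const card_ord mule_natl.
by rewrite muleA -EFinM mulVf ?mul1e// pnatr_eq0.
Qed.

Lemma circle_avg_le f g c N w (e : R) : 0 <= e -> normc c = 1 ->
  (forall z, normc z = normc (to_complex w) -> normc (f z) ^+ 2 <= normc (g z) ^+ 2 + e) ->
  circle_avg f c N.+1 w <= circle_avg g c N.+1 w + e.
Proof.
move=> e0 c1 fg; rewrite /circle_avg.
have -> : e = N.+1%:R^-1 * \sum_(k < N.+1) e.
  by rewrite sumr_const card_ord -[e *+ _]mulr_natl mulKf// pnatr_eq0.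
rewrite -mulrDr -big_split ler_wpM2l ?invr_ge0//=; apply: ler_sum => k _.
have k1 : normc (c ^+ k) = 1 by rewrite normcX c1 expr1n.
rewrite /gdens to_complex_rotate; set z := c ^+ k * _.
have zE : normc z = normc (to_complex w) by rewrite /z Normc.normcM k1 mul1r.
have h := fg z zE.
have g1 : gauss_weight z <= 1 by rewrite -expR0 ler_expR oppr_le0 sqr_ge0.
have g0 : 0 <= gauss_weight z by exact: expR_ge0.
apply: le_trans (ler_wpM2r g0 h) _; rewrite mulrDl lerD2l.
by rewrite -[leRHS]mulr1 ler_wpM2l.
Qed.

Lemma circle_avg_psum a c N w : N.+1.-primitive_root c -> normc c = 1 ->
  circle_avg (psum a N.+1) c N.+1 w = \sum_(n < N.+1) normc (a n) ^+ 2 * radial n w.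
Proof.
move=> pc c1; rewrite /circle_avg /gdens.
under eq_bigr => k _.
  rewrite gauss_weight_rotate ?normcX ?c1 ?expr1n// to_complex_rotate; over.
transitivity (N.+1%:R^-1 * ((\sum_(k < N.+1) normc (psum a N.+1 (c ^+ k * to_complex w)) ^+ 2) *
    gauss_weight (to_complex w))); first by rewrite mulr_suml.
rewrite parseval_psum// -!mulrA mulKf ?pnatr_eq0// mulr_suml.
by apply: eq_bigr => n _; rewrite -mulrA [normc (to_complex w) ^+ 2]normc_sqr gauss_weightE.
Qed.

Lemma measurable_radial n : measurable_fun setT (@radial R n).
Proof.
apply: measurable_funM; first apply: measurable_funX.
  by apply: measurable_funD; apply: measurable_funX.
have := measurable_gauss_weight.
by under eq_fun do rewrite gauss_weightE.
Qed.

Lemma radial_ge0 n w : 0 <= radial n w.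
Proof. by rewrite mulr_ge0 ?expR_ge0// exprn_ge0// addr_ge0 ?sqr_ge0. Qed.

Lemma integral_sum_radial a M :
  (\int[mu2]_w (\sum_(n < M) normc (a n) ^+ 2 * radial n w)%:E =
   (pi * \sum_(n < M) normc (a n) ^+ 2 * n`!%:R)%:E)%E.
Proof.
under eq_integral do rewrite -sumEFin.
have mr n : measurable_fun setT (fun w : R * R => (radial n w)%:E).
  by apply/measurable_EFinP; exact: measurable_radial.
rewrite ge0_integral_sum//; last 2 first.
- by move=> n; under eq_fun do rewrite EFinM; apply: measurable_funeM; exact: mr.
- by move=> n w _; rewrite lee_fin mulr_ge0 ?sqr_ge0 ?radial_ge0.
rewrite mulr_sumr -sumEFin; apply: eq_bigr => n _.
under eq_integral do rewrite EFinM.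
rewrite ge0_integralZl_EFin ?sqr_ge0//; [|by move=> w _; rewrite lee_fin radial_ge0|exact: mr].
by rewrite integral_radial -EFinM mulrCA.
Qed.

Lemma integral_psum a m :
  (\int[mu2]_w (gdens (psum a (2 ^ m.+1)) w)%:E =
   (pi * \sum_(n < 2 ^ m.+1) normc (a n) ^+ 2 * n`!%:R)%:E)%E.
Proof.
have [c pc c1] := ex_prim_root_pow2 R m.
move: pc; case E : (2 ^ m.+1)%N => [|N] pc; first by have := expn_gt0 2 m.+1; rewrite E.
rewrite -(integral_circle_avg N (cmeas_psum a _) c1) -integral_sum_radial.
by apply: eq_integral => w _; rewrite circle_avg_psum.
Qed.

(** Fatou's lemma along the partial sums, whose integrals are known exactly. *)
Lemma integral_power_series_le a (B : R) : fast_decay a ->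
  (forall M, \sum_(n < M) normc (a n) ^+ 2 * n`!%:R <= B) ->
  (\int[mu2]_w (gdens (power_series a) w)%:E <= (pi * B)%:E)%E.
Proof.
move=> ha hB.
apply: (@fatou_le _ _ _ mu2 (fun m => gdens (psum a (2 ^ m.+1)))).
- by move=> m; apply: measurable_gdens; exact: cmeas_psum.
- by apply: measurable_gdens; exact: cmeas_power_series.
- by move=> m w; exact: gdens_ge0.
- by move=> w; exact: gdens_ge0.
- move=> w eps eps0.
  pose z := to_complex w.
  have cv : (fun n => normc (psum a n z) ^+ 2 * gauss_weight z) @ \oo -->
      (normc (power_series a z) ^+ 2 * gauss_weight z).
    apply: cvgM; last exact: cvg_cst.
    suff c : (fun n => normc (psum a n z)) @ \oo --> normc (power_series a z).
      by under eq_fun do rewrite expr2; rewrite expr2; exact: cvgM.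
    apply/cvgrPdist_lt => e e0.
    have /cvg_normcP/(_ e e0)[N hN] := @power_series_cvg R a z ha.
    exists N => // n /= /hN; apply: le_lt_trans.
    by rewrite (normc_distC (psum a n z)); exact: normc_lip.
  move/cvgrPdist_lt: cv => /(_ _ eps0)[N _ hN].
  exists N => n Nn.
  have Nn' : (N <= 2 ^ n.+1)%N.
    by apply: leq_trans Nn _; apply: ltnW; apply: leq_trans (ltn_expl n.+1 _) => //; exact: ltnW.
  have h : `|normc (power_series a z) ^+ 2 * gauss_weight z -
             normc (psum a (2 ^ n.+1) z) ^+ 2 * gauss_weight z| < eps by exact: hN.
  have := le_lt_trans (ler_norm _) h.
  by rewrite /gdens -/z; move: (_ * _) (_ * _) => u v; lra.
- move=> m; rewrite integral_psum lee_fin; apply: ler_wpM2l; [exact: pi_ge0|exact: hB].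
Qed.

(** (u + 2Cq)^2 exceeds u^2 by 4uCq + 4C^2 q^2 <= 12 C^2 q. *)
Lemma sqr_perturb (C q u v : R) : 0 <= C -> u <= 2 * C -> 0 <= q -> q <= 1 ->
  0 <= u -> 0 <= v -> v - u <= 2 * C * q -> v ^+ 2 <= u ^+ 2 + 12 * C ^+ 2 * q.
Proof.
move=> C0 uC q0 q1 u0 v0 vu.
have : v ^+ 2 <= (u + 2 * C * q) ^+ 2.
  have Cq : 0 <= C * q by exact: mulr_ge0.
  by rewrite ler_sqr ?nnegrE; lra.
have h1 : u * (C * q) <= 2 * C * (C * q) by rewrite ler_wpM2r// mulr_ge0.
have h2 : C ^+ 2 * q * q <= C ^+ 2 * q * 1 by rewrite ler_wpM2l// mulr_ge0// sqr_ge0.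
nra.
Qed.

(** Fatou's lemma is applied to the averages of the full series over roots of unity, whose integrals
    all equal that of the series. On each circle the series is uniformly close to its partial sum of
    length 2^(n+1), whose average is exactly a sum of radial terms containing the first M. *)
Lemma integral_power_series_ge a M : fast_decay a ->
  ((pi * \sum_(n < M) normc (a n) ^+ 2 * n`!%:R)%:E <=
   \int[mu2]_w (gdens (power_series a) w)%:E)%E.
Proof.
move=> ha; rewrite -integral_sum_radial.
have ex m : exists c : R[i], (2 ^ m.+1).-primitive_root c /\ normc c = 1.
  by have [c pc c1] := ex_prim_root_pow2 R m; exists c.
have [c hc] := choice ex.
apply: (@fatou_le _ _ _ mu2 (fun m => circle_avg (power_series a) (c m) (2 ^ m.+1))).
- by move=> m; apply: measurable_circle_avg; exact: cmeas_power_series.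
- apply: measurable_sum => n; apply: measurable_funM => //; exact: measurable_radial.
- by move=> m w; exact: circle_avg_ge0.
- by move=> w; apply: sumr_ge0 => n _; rewrite mulr_ge0 ?sqr_ge0 ?radial_ge0.
- move=> w eps eps0.
  pose z := to_complex w.
  pose B := normc z + 1.
  have B0 : 0 < B by have := normc_ge0 z; rewrite /B; lra.
  have B20 : 0 < (2 * B)^-1 by rewrite invr_gt0 mulr_gt0.
  have [C hC] := ha _ B20.
  have tail := power_series_tail B0 hC.
  have C0 : 0 <= C by have := hC 0; rewrite expr0 mulr1; exact: le_trans (normc_ge0 _).
  have h21 : 0 <= (2^-1 : R) < 1 by lra.
  have [N hN] := geometric_small (12 * C ^+ 2) h21 eps0.
  exists (maxn M N) => n; rewrite geq_max => /andP[Mn Nn].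
  have n2 : (n <= 2 ^ n.+1)%N.
    by apply: ltnW; apply: leq_trans (ltn_expl n.+1 _) => //; exact: ltnW.
  have := hN _ (leq_trans Nn n2); have := leq_trans Mn n2.
  case: (hc n); case: (2 ^ n.+1)%N (expn_gt0 2 n.+1) => [//|K] _ pc c1 MK small.
  apply: le_trans (le_trans (_ : _ <= circle_avg (psum a K.+1) (c n) K.+1 w) _) _.
  - rewrite circle_avg_psum//; apply: (@sum_homo R (fun k => normc (a k) ^+ 2 * radial k w)) => // k.
    by rewrite mulr_ge0 ?sqr_ge0 ?radial_ge0.
  - apply: (@circle_avg_le _ (power_series a) _ _ _ (12 * C ^+ 2 * 2^-1 ^+ K.+1)) => //.
      by rewrite mulr_ge0 ?exprn_ge0// mulr_ge0 ?sqr_ge0.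
    move=> x xz; have xB : normc x <= B by rewrite xz /B lerDl.
    have [_ tx] := tail x xB.
    have := tx 0%N; rewrite /psum big_ord0 subr0 expr0 mulr1 => t0.
    have := tx K.+1; have p1 : (2^-1 : R) ^+ K.+1 <= 1 by rewrite exprn_ile1; lra.
    have p0 : 0 <= (2^-1 : R) ^+ K.+1 by rewrite exprn_ge0; lra.
    have := normc_lip (psum a K.+1 x) (power_series a x).
    rewrite normc_distC => /(le_trans (ler_norm _)) h /(le_trans h) {}h.
    exact: sqr_perturb C0 t0 p0 p1 (normc_ge0 _) (normc_ge0 _) h.
  - by rewrite lerD2l ltW.
- move=> m; case: (hc m) => _ c1.
  case E : (2 ^ m.+1)%N => [|N]; first by have := expn_gt0 2 m.+1; rewrite E.
  by rewrite integral_circle_avg//; exact: cmeas_power_series.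
Qed.

End GaussianNorm.

(** * Chaotic operators in coordinates *)

Section CoordinateConvergence.
Variable R : realType.
Implicit Types (s : nat -> nat -> R[i]) (t w v : nat -> R[i]).

Definition coord_cvg s t := forall k (eps : R), 0 < eps ->
  exists N, forall m, (N <= m)%N -> normc (s m k - t k) < eps.

Lemma coord_cvg_unique s t t' : coord_cvg s t -> coord_cvg s t' -> t = t'.
Proof.
move=> h h'; apply/funext => k; apply/eqP; rewrite -subr_eq0; apply/eqP/Normc.eq0_normc.
apply/eqP; rewrite eq_le normc_ge0 andbT leNgt; apply/negP => p0.
have e0 : 0 < normc (t k - t' k) / 2 by lra.
have [N hN] := h k _ e0; have [N' hN'] := h' k _ e0.
have := hN _ (leq_maxl N N'); have := hN' _ (leq_maxr N N').
have := normcD (t k - s (maxn N N') k) (s (maxn N N') k - t' k).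
by rewrite subrKA (normc_distC (t k)); lra.
Qed.

(** Each row has at most two entries, so coordinatewise limits pass through the matrix even though
    norm limits need not. *)
Lemma coord_cvg_jacobi w v s t : coord_cvg s t ->
  coord_cvg (fun m => jacobi w v (s m)) (jacobi w v t).
Proof.
have lin (c : R[i]) s' t' : coord_cvg s' t' ->
    coord_cvg (fun m k => c * s' m k) (fun k => c * t' k).
  move=> h k eps e0; have c0 := normc_ge0 c.
  have e1 : 0 < eps / (normc c + 1) by rewrite divr_gt0//; lra.
  have [N hN] := h k _ e1; exists N => m /hN.
  rewrite -mulrBr Normc.normcM ltr_pdivlMr; last lra.
  have := normc_ge0 (s' m k - t' k); move: (normc (_ - _)) (normc c) c0 => x y y0 x0.
  by rewrite mulrDr mulr1 mulrC; lra.
move=> h [|k] eps e0; rewrite /jacobi.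
  have [N hN] := lin (w 0) _ _ h 1%N eps e0; exists N => m /hN.
  by rewrite !addr0.
have e20 : 0 < eps / 2 by lra.
have [N hN] := lin (w k.+1) _ _ h k.+2 _ e20.
have [N' hN'] := lin (v k) _ _ h k _ e20.
exists (maxn N N') => m; rewrite geq_max => /andP[/hN h1 /hN' h2].
by rewrite opprD addrACA (le_lt_trans (normcD _ _))//; lra.
Qed.

Lemma jacobi_comb w v (a : R[i]) t t' k :
  jacobi w v (fun k => a * t k + t' k) k = a * jacobi w v t k + jacobi w v t' k.
Proof. by rewrite /jacobi; case: k => [|k]; ring. Qed.

End CoordinateConvergence.

(** * Transfer of the criterion to an operator given by a matrix in coordinates *)

Section SequenceModel.
Variables (R : realType) (V : lmodType R[i]) (X : set V) (nrm : V -> R).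
Variables (e : V -> nat -> R[i]) (r : (nat -> R[i]) -> V).
Hypothesis subX : is_subspace X.
Hypothesis eD : forall a u v, X u -> X v ->
  e (a *: u + v) = fun k => a * e u k + e v k.
Hypothesis e_l2 : forall u, X u -> l2C (e u).
Hypothesis nrmE : forall u, X u -> nrm u = l2Cnorm (e u).
Hypothesis e_inj : forall u v, X u -> X v -> e u = e v -> u = v.
Hypothesis rX : forall s, l2C s -> X (r s).
Hypothesis rK : forall s, l2C s -> e (r s) = s.

Let X0 : X 0. Proof. by case: subX. Qed.

Let e0 : e 0 = fun=> 0.
Proof.
have := eD (-1) X0 X0; rewrite scaler0 addr0 => ->.
by apply/funext => k; rewrite mulN1r addNr.
Qed.

Let eB u v : X u -> X v -> e (u - v) = fun k => e u k - e v k.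
Proof.
move=> xu xv; rewrite addrC -scaleN1r eD//.
by apply/funext => k; rewrite mulN1r addrC.
Qed.

Let eZ a u : X u -> e (a *: u) = fun k => a * e u k.
Proof.
by move=> xu; rewrite -[a *: u]addr0 eD// e0; apply/funext => k; rewrite addr0.
Qed.

Lemma model_norm : is_norm X nrm.
Proof.
split.
- move=> u xu; rewrite nrmE// => /(l2norm_eq0 (e_l2 xu)) h.
  apply: e_inj => //; rewrite e0; apply/funext => k; apply: Normc.eq0_normc.
  by have := congr1 (fun f => f k) h.
- by move=> a u xu; rewrite !nrmE//; [rewrite eZ// l2CnormZ//; exact: e_l2|exact: subZ].
- move=> u v xu xv; rewrite !nrmE//; last exact: subD.
  rewrite -[u]scale1r eD// (_ : (fun k => _) = fun k => e u k + e v k).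
    by rewrite scale1r; apply: l2CnormD; exact: e_l2.
  by apply/funext => k; rewrite mul1r.
Qed.

Let nrmBE u v : X u -> X v -> nrm (u - v) = l2Cnorm (fun k => e u k - e v k).
Proof. by move=> xu xv; rewrite nrmE ?eB//; exact: subB. Qed.

Lemma model_coord (u : nat -> V) u0 : (forall k, X (u k)) -> X u0 ->
  cvg_in nrm u u0 -> coord_cvg (fun m => e (u m)) (e u0).
Proof.
move=> xu xu0 /(cvg_inP subX model_norm xu xu0) h k eps eps0.
have [N hN] := h _ eps0; exists N => m /hN; apply: le_lt_trans.
rewrite nrmBE//; apply: (@coord_le_l2Cnorm _ (fun k => e (u m) k - e u0 k) k).
by apply: l2CB; exact: e_l2.
Qed.

Lemma model_banach : is_banach X nrm.
Proof.
split=> //; first exact: model_norm.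
move=> u xu cau.
have [|//|s l2s hs] := @l2C_complete _ (fun m => e (u m)).
- by move=> m; exact: e_l2.
- move=> eps eps0; have [N hN] := cau _ eps0.
  by exists N => m n Nm Nn; rewrite -nrmBE//; exact: hN.
exists (r s); first exact: rX.
apply/(cvg_inP subX model_norm xu (rX l2s)) => eps eps0.
have eps20 : 0 < eps / 2 by lra.
have [N hN] := hs _ eps20; exists N => m /hN.
by rewrite nrmBE// ?rK//; [lra|exact: rX].
Qed.

Variables (w v : nat -> R[i]) (A : operator V).
Variables (K : nat -> nat -> R[i]) (T : (nat -> R[i]) -> nat -> R[i]).
Local Notation J := (jacobi w v).
Hypothesis w_neq0 : forall n, w n != 0.
Hypothesis domA : forall u, op_dom A u <-> X u /\ l2C (J (e u)).
Hypothesis actA : forall u, op_dom A u -> X (op_act A u) /\ e (op_act A u) = J (e u).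
Hypothesis l2K : forall i, l2C (K i).
Hypothesis K00 : K 0 0 = 1.
Hypothesis JK0 : J (K 0) = fun=> 0.
Hypothesis JKS : forall i, J (K i.+1) = K i.
Hypothesis decK : forall rho : R, 0 < rho -> exists C, forall i, l2Cnorm (K i) <= C * rho ^+ i.
Hypothesis denK : forall s (eps : R), l2C s -> 0 < eps -> exists n (c : nat -> R[i]),
  l2Cnorm (fun k => s k - \sum_(i < n) c i * K i k) < eps.
Hypothesis l2T : forall s, l2C s -> l2C (T s).
Hypothesis T_bounded : exists M, forall s, l2C s -> l2Cnorm (T s) <= M * l2Cnorm s.
Hypothesis JT : forall s, l2C s -> J (T s) = s.
Hypothesis T0 : forall s, T s 0 = 0.

Let l2C0 : l2C (fun=> 0 : R[i]).
Proof. by rewrite -e0; exact: e_l2. Qed.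

(** Additivity of T is not assumed: a right inverse of the matrix vanishing at coordinate 0 is
    unique. *)
Let TB s t : l2C s -> l2C t -> T (fun k => s k - t k) = fun k => T s k - T t k.
Proof.
move=> hs ht; apply: (jacobi_inj (v := v) w_neq0); last by rewrite !T0 subrr.
move=> n; rewrite (_ : (fun k => T s k - T t k) = fun k => -1 * T t k + T s k).
  by rewrite jacobi_comb !JT//; [rewrite mulN1r addrC|exact: l2CB].
by apply/funext => k; rewrite mulN1r addrC.
Qed.

Let rB s t : l2C s -> l2C t -> r (fun k => s k - t k) = r s - r t.
Proof.
move=> hs ht; apply: e_inj; [exact/rX/l2CB|by apply: subB => //; exact: rX|].
by rewrite eB ?rK//; [exact: l2CB|exact: rX|exact: rX].
Qed.

Lemma e_sum (I : Type) (q : seq I) (F : I -> V) k : (forall i, X (F i)) ->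
  e (\sum_(i <- q) F i) k = \sum_(i <- q) e (F i) k.
Proof.
move=> xF; elim: q => [|i q IH]; first by rewrite !big_nil e0.
rewrite !big_cons -IH -[F i]scale1r eD// ?mul1r ?scale1r//.
exact: sub_sum.
Qed.

Let e_iter m u : pow_dom X A m u -> e (iter m (op_act A) u) = iter m J (e u).
Proof.
elim: m u => [//|m IH] u [du /IH]; rewrite !iterSr => ->.
by case: (actA du) => _ ->.
Qed.

Let X_iter m u : pow_dom X A m u -> X (iter m (op_act A) u).
Proof. by elim: m u => [//|m IH] u [du /IH]; rewrite iterSr. Qed.

Lemma model_linear : linear_operator X A.
Proof.
have key a u u' : op_dom A u -> op_dom A u' -> op_dom A (a *: u + u') /\
    J (e (a *: u + u')) = fun k => a * J (e u) k + J (e u') k.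
  move=> /domA[xu lu] /domA[xu' lu'].
  have E : J (e (a *: u + u')) = fun k => a * J (e u) k + J (e u') k.
    by rewrite eD//; apply/funext => k; exact: jacobi_comb.
  split=> //; apply/domA; split; first by case: subX => _; apply.
  by rewrite E; exact: l2C_comb.
split.
- by move=> u /domA[].
- by move=> u /actA[].
- split; last by move=> a u u' du du'; case: (key a u u' du du').
  apply/domA; split=> //; rewrite e0 (_ : J _ = fun=> 0)//.
  by apply/funext => -[|n]; rewrite /jacobi !mulr0 addr0.
- move=> a u u' du du'; have [d E] := key a u u' du du'.
  have [xa ea] := actA d; have [xu eu] := actA du; have [xu' eu'] := actA du'.
  apply: e_inj => //; first by case: subX => _; apply.
  by rewrite eD// ea E eu eu'.
Qed.

Theorem model_chaotic : chaotic X nrm A.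
Proof.
have [M hM] := T_bounded.
have domr s : l2C s -> l2C (J s) -> op_dom A (r s).
  by move=> ls lj; apply/domA; rewrite rK//; split=> //; exact: rX.
have domK i : op_dom A (r (K i)).
  apply: domr => //; case: i => [|i]; last by rewrite JKS.
  by rewrite JK0; exact: l2C0.
have eK i : e (r (K i)) = K i by rewrite rK.
have domT u : X u -> op_dom A (r (T (e u))).
  by move=> xu; have lu := e_l2 xu; apply: domr; rewrite ?JT//; exact: l2T.
apply: (@chaos_criterion R V X nrm A (fun i => r (K i)) (fun u => r (T (e u)))
  (fun m u => iter m J (e u) 0)).
- exact: model_banach.
- exact: model_linear.
- move=> u l l' du xl xl' cl cl'.
  have xu k : X (u k) by case/domA: (du k).
  have xA k : X (op_act A (u k)) by case: (actA (du k)).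
  have c1 := coord_cvg_jacobi w v (model_coord xu xl cl).
  have c2 := model_coord xA xl' cl'.
  have E : J (e l) = e l'.
    apply: coord_cvg_unique c1 _.
    by rewrite (_ : (fun m => J (e (u m))) = fun m => e (op_act A (u m)))//;
      apply/funext => m; case: (actA (du m)).
  (* Maximality of the domain: the matrix applied to the coordinates of l gives those of l', hence
     lies in l^2. *)
  have dl : op_dom A l by apply/domA; rewrite E; split=> //; exact: e_l2.
  by split=> //; have [xl1 el1] := actA dl; apply: e_inj => //; rewrite el1.
- exact: domK.
- have [x1 x2] := actA (domK 0); apply: e_inj => //.
  by rewrite x2 eK JK0 e0.
- move=> i; have [x1 x2] := actA (domK i.+1).
  by apply: e_inj => //; [exact: rX|rewrite x2 !eK JKS].
- apply/eqP => /(congr1 (fun u => e u 0)); rewrite eK K00 e0 => /eqP.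
  by rewrite oner_eq0.
- move=> rho rho0; have [C hC] := decK rho0; exists C => i.
  by rewrite nrmE ?eK//; exact: rX.
- move=> u xu eps eps0.
  have [n [c hc]] := denK (e_l2 xu) eps0.
  have xK i : X (c i *: r (K i)) by apply: subZ => //; exact: rX.
  have xS : X (\sum_(i < n) c i *: r (K i)) by apply: sub_sum.
  exists (\sum_(i < n) c i *: r (K i)); split=> //; first by exists n, c.
  rewrite (nrm_distC subX model_norm)// nrmBE//.
  rewrite (_ : (fun k => _) = (fun k => e u k - \sum_(i < n) c i * K i k))//.
  apply/funext => k; rewrite e_sum//; congr (_ - _).
  by apply: eq_bigr => i _; rewrite eZ ?eK//; exact: rX.
- exact: domT.
- move=> u xu; have [x1 x2] := actA (domT _ xu); apply: e_inj => //.
  by rewrite x2 rK ?JT//; [exact: e_l2|apply: l2T; exact: e_l2].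
- exists M => u xu; rewrite !nrmE//; last by apply/rX/l2T; exact: e_l2.
  by rewrite rK; [apply: hM|apply: l2T]; exact: e_l2.
- move=> u u' xu xu'; rewrite eB// TB ?rB//; try (exact: e_l2); by apply: l2T; exact: e_l2.
- move=> m u u0 xu xu0 cu.
  have cc : coord_cvg (fun k => iter m J (e (u k))) (iter m J (e u0)).
    elim: m => [|m IH]; first exact: model_coord.
    exact: coord_cvg_jacobi.
  apply/cvgrPdist_lt => eps eps0; have [N hN] := cc 0 _ eps0.
  exists N => // k /= /hN; rewrite sub0r normrN ger0_norm//.
  exact: normc_ge0.
- move=> m u pd.
  have [pm dm] := proj1 (pow_domSr model_linear m u) pd.
  set y := iter m (op_act A) u; have xy : X y by exact: X_iter.
  have xAy : X (op_act A y) by case: (actA dm).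
  have ly := e_l2 xy; have lAy := e_l2 xAy.
  have xTy : X (r (T (e (op_act A y)))) by apply/rX/l2T.
  rewrite iterS -/y -(e_iter pm) -/y.
  apply: e_inj => //; first by apply: subD => //; apply: subZ => //; exact: rX.
  rewrite addrC eD//; last exact: rX.
  rewrite eK rK; last exact: l2T.
  apply: (jacobi_inj (v := v) w_neq0); last by rewrite K00 T0 mulr1 addr0.
  move=> n; rewrite jacobi_comb JK0 mulr0 add0r JT//.
  by case: (actA dm) => _ ->.
Qed.

End SequenceModel.

Section ShiftModels.
Variable R : realType.
Implicit Types (s t : nat -> R[i]) (f : nat -> R).

(** From x^n / n! <= exp x at x = rho^-2, after a square root. *)
Lemma inv_sqrt_fact_decay (rho : R) : 0 < rho ->
  exists C, forall n, (Num.sqrt n`!%:R)^-1 <= C * rho ^+ n.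
Proof.
move=> rho0; exists (Num.sqrt (expR (rho ^- 2))) => n.
have x0 : 0 <= rho ^- 2 by rewrite invr_ge0 exprn_ge0 ?ltW.
have f0 : 0 < n`!%:R :> R by rewrite ltr0n fact_gt0.
have h := exp_coeff_le n x0.
rewrite -sqrtrV; last exact: ltW.
rewrite -[rho ^+ n]ger0_norm; last by rewrite exprn_ge0// ltW.
rewrite -sqrtr_sqr -sqrtrM ?expR_ge0//.
apply: ler_wsqrtr; apply: le_trans (ler_wpM2r (sqr_ge0 (rho ^+ n)) h).
have -> : (rho ^- 2) ^+ n = (rho ^+ n ^+ 2)^-1 by rewrite exprVn -!exprM mulnC.
by rewrite mulrAC mulVf ?mul1r// !expf_neq0// gt_eqF.
Qed.

Definition delta_seq (n : nat) (c : R[i]) (k : nat) : R[i] := if k == n then c else 0.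

Lemma l2C_delta n c : l2C (delta_seq n c) /\ l2Cnorm (delta_seq n c) <= normc c.
Proof.
apply: l2norm_leP; first exact: normc_ge0.
move=> m; have [nm|mn] := ltnP n m.
  rewrite (bigD1 (Ordinal nm))//= big1 ?addr0 /delta_seq ?eqxx//.
  move=> k kn; rewrite ifF ?Normc.normc0 ?expr0n//.
  by apply: contraNF kn => /eqP kE; apply/eqP/val_inj.
rewrite big1 ?sqr_ge0// => k _; rewrite /delta_seq ifF ?Normc.normc0 ?expr0n//.
by apply/negP => /eqP kE; have := ltn_ord k; rewrite kE ltnNge mn.
Qed.

Lemma l2C_tail s (eps : R) : l2C s -> 0 < eps ->
  exists n, l2Cnorm (fun k => if (k < n)%N then 0 else s k) < eps.
Proof.
move=> ls eps0; have e20 : 0 < (eps / 2) ^+ 2 by rewrite exprn_gt0// divr_gt0.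
have /cvgrPdist_lt/(_ _ e20)[N _ hN] := ip_cvg ls ls.
have := hN N (leqnn N); rewrite /= ltr_norml => /andP[_ hS].
exists N; apply: (@le_lt_trans _ _ (eps / 2)); last lra.
have e2 : 0 <= eps / 2 by lra.
apply: (proj2 (l2norm_leP e2 _)) => m; apply: le_trans (ltW hS).
rewrite lerBrDr.
apply: le_trans (ip_ge_sum (N + m) ls).
rewrite big_split_ord /= [leRHS]addrC; apply: lerD; last by apply: ler_sum => k _; rewrite expr2.
apply: le_trans (@sum_homo _ (fun k => normc (if (k < N)%N then 0 else s k) ^+ 2) _ _ _ (leq_addl N m)) _.
  by move=> k; exact: sqr_ge0.
rewrite big_split_ord /= big1 ?add0r; last by move=> k _; rewrite ltn_ord Normc.normc0 expr0n.
by apply: ler_sum => k _; rewrite ltnNge leq_addr.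
Qed.

(** * The weighted backward shift *)

Section WeightedShift.
Variable w : nat -> R.
Hypothesis w_ge : forall n, Num.sqrt n.+1%:R <= w n.
Local Notation wC := (fun n => (w n)%:C).
Local Notation J := (jacobi wC (fun=> 0)).

Let w0 n : 0 < w n.
Proof. by apply: lt_le_trans (w_ge n); rewrite sqrtr_gt0. Qed.

(** The i-th unit vector scaled so that the shift steps down exactly. These vectors span all finite
    sequences, and with w_n >= sqrt(n+1) their norms are at most 1 / sqrt(i!). *)
Definition shift_ker i := delta_seq i ((\prod_(j < i) w j)^-1)%:C.

Definition shift_inv s k : R[i] := if k is k'.+1 then s k' / (w k')%:C else 0.

Let prod_gt0 i : 0 < \prod_(j < i) w j.
Proof. by apply: prodr_gt0. Qed.

Lemma shift_kerS i : J (shift_ker i.+1) = shift_ker i.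
Proof.
apply/funext => k; rewrite /jacobi /shift_ker /delta_seq eqSS.
rewrite (_ : (if k is m.+1 then 0 * _ else 0) = 0) ?addr0; last by case: k => [|k]; rewrite ?mul0r.
case: eqP => [->|_]; last by rewrite mulr0.
rewrite big_ord_recr /= -rmorphM; congr (_%:C).
by rewrite invfM mulrCA divff ?mulr1// gt_eqF.
Qed.

Lemma shift_ker_norm i : normc (((\prod_(j < i) w j)^-1)%:C : R[i]) <= (Num.sqrt i`!%:R)^-1.
Proof.
rewrite normcR ger0_norm; last by rewrite invr_ge0 ltW.
rewrite lef_pV2 ?posrE ?sqrtr_gt0 ?ltr0n ?fact_gt0//.
elim: i => [|i IH]; first by rewrite big_ord0 fact0 sqrtr1.
rewrite big_ord_recr /= factS natrM sqrtrM// mulrC ler_pM// ?sqrtr_ge0//.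
Qed.

Lemma shift_invK s : J (shift_inv s) = s.
Proof.
apply/funext => k; rewrite /jacobi /=.
rewrite (_ : (if k is m.+1 then 0 * _ else 0) = 0) ?addr0; last by case: k => [|k]; rewrite ?mul0r.
by rewrite mulrCA divff ?mulr1// -[0]/((0 : R)%:C) (inj_eq (@complexI R)) gt_eqF.
Qed.

Lemma l2C_shift_inv s : l2C s -> l2C (shift_inv s) /\ l2Cnorm (shift_inv s) <= l2Cnorm s.
Proof.
move=> ls; apply: l2norm_leP; first exact: l2norm_ge0.
move=> n; rewrite sqr_l2norm//.
case: n => [|n]; first by rewrite big_ord0 ip_ge0.
rewrite big_ord_recl [shift_inv s _]/(0 : R[i]) Normc.normc0 expr0n add0r.
apply: le_trans (ip_ge_sum n ls); apply: ler_sum => k _.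
rewrite ler_sqr ?nnegrE ?normc_ge0// Normc.normcM ler_piMr ?normc_ge0//.
rewrite -fmorphV normcR ger0_norm; last by rewrite invr_ge0 ltW.
rewrite invf_le1//.
apply: le_trans (w_ge _); rewrite -[leLHS]sqrtr1 ler_wsqrtr// ler1n//.
Qed.

Lemma shift_dense s (eps : R) : l2C s -> 0 < eps -> exists n (c : nat -> R[i]),
  l2Cnorm (fun k => s k - \sum_(i < n) c i * shift_ker i k) < eps.
Proof.
move=> ls eps0; have [n hn] := l2C_tail ls eps0.
exists n, (fun i => s i * (\prod_(j < i) w j)%:C).
rewrite (_ : (fun k => _) = fun k => if (k < n)%N then 0 else s k)//.
apply/funext => k.
have cE i : s i * (\prod_(j < i) w j)%:C * shift_ker i k = if k == i then s i else 0.
  rewrite /shift_ker /delta_seq; case: eqP => _; last by rewrite mulr0.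
  by rewrite -mulrA -rmorphM divff ?mulr1// gt_eqF.
under eq_bigr do rewrite cE.
have [kn|nk] := ltnP k n.
  rewrite (bigD1 (Ordinal kn))//= eqxx big1 ?addr0 ?subrr//.
  by move=> i ik; rewrite ifF//; apply: contraNF ik => /eqP kE; apply/eqP/val_inj.
rewrite big1 ?subr0// => i _; rewrite ifF//.
by apply/negP => /eqP kE; have := ltn_ord i; rewrite -kE ltnNge nk.
Qed.

Theorem weighted_shift_chaotic (V : lmodType R[i]) (X : set V) (nrm : V -> R)
    (e : V -> nat -> R[i]) (r : (nat -> R[i]) -> V) (A : operator V) :
  is_subspace X ->
  (forall a u v, X u -> X v -> e (a *: u + v) = fun k => a * e u k + e v k) ->
  (forall u, X u -> l2C (e u)) -> (forall u, X u -> nrm u = l2Cnorm (e u)) ->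
  (forall u v, X u -> X v -> e u = e v -> u = v) ->
  (forall s, l2C s -> X (r s)) -> (forall s, l2C s -> e (r s) = s) ->
  (forall u, op_dom A u <-> X u /\ l2C (J (e u))) ->
  (forall u, op_dom A u -> X (op_act A u) /\ e (op_act A u) = J (e u)) ->
  chaotic X nrm A.
Proof.
move=> subX eD e_l2 nrmE e_inj rX rK domA actA.
apply: (@model_chaotic R V X nrm e r subX eD e_l2 nrmE e_inj rX rK
  wC (fun=> 0) A shift_ker shift_inv) => //.
- by move=> n; rewrite -[0]/((0 : R)%:C) (inj_eq (@complexI R)) gt_eqF.
- by move=> i; case: (l2C_delta i ((\prod_(j < i) w j)^-1)%:C).
- by rewrite /shift_ker /delta_seq /= big_ord0 invr1.
- apply/funext => k; rewrite /jacobi /shift_ker /delta_seq /= mulr0 add0r.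
  by case: k => [|k]; rewrite ?mul0r.
- exact: shift_kerS.
- move=> rho rho0; have [C hC] := inv_sqrt_fact_decay rho0; exists C => i.
  apply: le_trans (hC i); apply: le_trans (shift_ker_norm i).
  by case: (l2C_delta i ((\prod_(j < i) w j)^-1)%:C).
- exact: shift_dense.
- by move=> s /l2C_shift_inv[].
- by exists 1 => s /l2C_shift_inv[]; rewrite mul1r.
- by move=> s _; exact: shift_invK.
Qed.

End WeightedShift.

(** * The complex Jacobi matrix, reduced to the real one *)

Section JacobiModel.
Variable w : nat -> R.
Hypothesis w_gt0 : forall n, 0 < w n.
Hypothesis w_logconcave : forall n, w n * w n.+2 <= w n.+1 ^+ 2.
Hypothesis w_summable : exists W, forall n, \sum_(k < n) (w k)^-1 <= W.
Local Notation wC := (fun n => (w n)%:C).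
Local Notation J := (jacobi wC wC).
Local Notation T := (jacobi_inv w).
Local Notation K := (jacobi_sol w 1 0).

Let w0 n : w n != 0. Proof. by rewrite gt_eqF. Qed.

(** Real weights act separately on real and imaginary parts, which carries the real l^2 theory
    over. *)
Lemma jacobi_ReIm (f g : nat -> R) n :
  J (fun k => f k +i* g k) n = jacobi w w f n +i* jacobi w w g n.
Proof.
rewrite /jacobi; case: n => [|n]; apply/eqP; rewrite eq_complex /=;
  by apply/andP; split; apply/eqP; ring.
Qed.

Definition jacobi_ker i k : R[i] := (iter i T K k)%:C.

Definition jacobiC_inv s k : R[i] :=
  T (fun j => complex.Re (s j)) k +i* T (fun j => complex.Im (s j)) k.

Lemma jacobi_real f n : J (fun k => (f k)%:C) n = (jacobi w w f n)%:C.
Proof.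
rewrite (jacobi_ReIm f (fun=> 0)); congr (_ +i* _).
by rewrite /jacobi; case: n => [|n]; rewrite !mulr0 addr0.
Qed.

Lemma l2C_real f : l2 f -> l2C (fun k => (f k)%:C) /\ l2Cnorm (fun k => (f k)%:C) = l2norm f.
Proof.
move=> lf; split.
  by rewrite /l2C; under eq_fun do rewrite normcR; exact: (l2_norm f).1.
by rewrite /l2Cnorm; under eq_fun do rewrite normcR; exact: l2norm_norm.
Qed.

Let S := l2norm (jacobi_majorant w) ^+ 2.

Lemma jacobi_inv_bounded f : l2 f -> l2 (T f) /\ l2norm (T f) <= S * l2norm f.
Proof.
move=> lf; have [h1 h2] := jacobi_inv_iter_decay w_gt0 w_logconcave w_summable 0 lf.
by move: h2; rewrite expr0 fact0 divr1 mulr1.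
Qed.

Lemma jacobi_ker_decay (rho : R) : 0 < rho ->
  exists C, forall i, l2Cnorm (jacobi_ker i) <= C * rho ^+ i.
Proof.
move=> rho0.
have lK := l2_jacobi_sol w_gt0 w_logconcave w_summable 1 0.
have S0 : 0 <= S by exact: sqr_ge0.
have kE i := (l2C_real (l2_iter_jacobi_inv w_gt0 w_logconcave w_summable i lK)).2.
exists (l2norm K + S * expR (S / rho) * l2norm K / rho) => -[|i].
  rewrite kE expr0 mulr1 lerDl !mulr_ge0 ?l2norm_ge0 ?expR_ge0 ?invr_ge0//.
  exact: ltW.
rewrite kE.
have [_] := jacobi_inv_iter_decay w_gt0 w_logconcave w_summable i lK.
move/le_trans; apply.
apply: (@le_trans _ _ (S * expR (S / rho) * l2norm K / rho * rho ^+ i.+1)); last first.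
  by apply: ler_wpM2r; [rewrite exprn_ge0// ltW|rewrite lerDr l2norm_ge0].
have x0 : 0 <= S / rho by rewrite divr_ge0//; exact: ltW.
have h := exp_coeff_le i x0.
have -> : S * expR (S / rho) * l2norm K / rho * rho ^+ i.+1 =
    S * (expR (S / rho) * rho ^+ i) * l2norm K.
  by rewrite exprS; field; rewrite gt_eqF.
rewrite ler_wpM2r ?l2norm_ge0// ler_wpM2l//.
have p0 : 0 <= rho ^+ i by rewrite exprn_ge0 ?ltW.
apply: le_trans (ler_wpM2r p0 h).
rewrite [leRHS](_ : _ = S ^+ i / i`!%:R)// expr_div_n mulrAC mulfVK//.
by rewrite expf_neq0// gt_eqF.
Qed.

Lemma jacobiC_dense s (eps : R) : l2C s -> 0 < eps -> exists n (c : nat -> R[i]),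
  l2Cnorm (fun k => s k - \sum_(i < n) c i * jacobi_ker i k) < eps.
Proof.
move=> ls eps0; have e20 : 0 < eps / 2 by lra.
have [n1 [c1 h1]] := jacobi_dense w_gt0 w_logconcave w_summable (l2C_Re ls) e20.
have [n2 [c2 h2]] := jacobi_dense w_gt0 w_logconcave w_summable (l2C_Im ls) e20.
have lK := l2_jacobi_sol w_gt0 w_logconcave w_summable 1 0.
have pad n m (c : nat -> R) k : (n <= m)%N ->
    \sum_(i < n) c i * iter i T K k =
    \sum_(i < m) (if (i < n)%N then c i else 0) * iter i T K k.
  move=> nm; rewrite -(subnKC nm) big_split_ord /= [X in _ = _ + X]big1 ?addr0.
    by apply: eq_bigr => i _; rewrite ltn_ord.
  by move=> i _; rewrite ltnNge leq_addr mul0r.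
pose c i := (if (i < n1)%N then c1 i else 0) +i* (if (i < n2)%N then c2 i else 0).
exists (maxn n1 n2), c.
set d := fun k => _.
have dRe : (fun k => complex.Re (d k)) =
    fun k => complex.Re (s k) - \sum_(i < n1) c1 i * iter i T K k.
  apply/funext => k; rewrite /d raddfB raddf_sum (pad _ _ _ _ (leq_maxl n1 n2)).
  by congr (_ - _); apply: eq_bigr => i _; rewrite /jacobi_ker /= mulr0 subr0.
have dIm : (fun k => complex.Im (d k)) =
    fun k => complex.Im (s k) - \sum_(i < n2) c2 i * iter i T K k.
  apply/funext => k; rewrite /d raddfB raddf_sum (pad _ _ _ _ (leq_maxr n1 n2)).
  by congr (_ - _); apply: eq_bigr => i _; rewrite /jacobi_ker /= mulr0 add0r.
have lsum n (c' : nat -> R) : l2 (fun k => \sum_(i < n) c' i * iter i T K k).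
  elim: n => [|n IH].
    by under eq_fun do rewrite big_ord0; exact: l2_0.
  under eq_fun do rewrite big_ord_recr /= addrC.
  by apply: l2_comb => //; exact: l2_iter_jacobi_inv.
have lr : l2 (fun k => complex.Re (d k)) by rewrite dRe; apply: l2B => //; exact: l2C_Re.
have li : l2 (fun k => complex.Im (d k)) by rewrite dIm; apply: l2B => //; exact: l2C_Im.
have [_ hd] := l2C_ReIm lr li.
by apply: le_lt_trans hd _; rewrite dRe dIm; lra.
Qed.

Theorem jacobi_chaotic (V : lmodType R[i]) (X : set V) (nrm : V -> R)
    (e : V -> nat -> R[i]) (r : (nat -> R[i]) -> V) (A : operator V) :
  is_subspace X ->
  (forall a u v, X u -> X v -> e (a *: u + v) = fun k => a * e u k + e v k) ->
  (forall u, X u -> l2C (e u)) -> (forall u, X u -> nrm u = l2Cnorm (e u)) ->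
  (forall u v, X u -> X v -> e u = e v -> u = v) ->
  (forall s, l2C s -> X (r s)) -> (forall s, l2C s -> e (r s) = s) ->
  (forall u, op_dom A u <-> X u /\ l2C (J (e u))) ->
  (forall u, op_dom A u -> X (op_act A u) /\ e (op_act A u) = J (e u)) ->
  chaotic X nrm A.
Proof.
move=> subX eD e_l2 nrmE e_inj rX rK domA actA.
have lK := l2_jacobi_sol w_gt0 w_logconcave w_summable 1 0.
apply: (@model_chaotic R V X nrm e r subX eD e_l2 nrmE e_inj rX rK
  wC wC A jacobi_ker jacobiC_inv) => //.
- by move=> n; rewrite -[0]/((0 : R)%:C) (inj_eq (@complexI R)).
- by move=> i; apply: (l2C_real _).1; exact: l2_iter_jacobi_inv.
- by apply/funext => k; rewrite jacobi_real jacobi_sol_ker.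
- by move=> i; apply/funext => k; rewrite jacobi_real iterS jacobi_invK.
- exact: jacobi_ker_decay.
- exact: jacobiC_dense.
- move=> s ls; have [h _] := @l2C_ReIm R (jacobiC_inv s)
    (jacobi_inv_bounded (l2C_Re ls)).1 (jacobi_inv_bounded (l2C_Im ls)).1.
  exact: h.
- exists (2 * S) => s ls.
  have [lr br] := jacobi_inv_bounded (l2C_Re ls).
  have [li bi] := jacobi_inv_bounded (l2C_Im ls).
  have [_ /le_trans] := @l2C_ReIm R (jacobiC_inv s) lr li; apply.
  apply: le_trans (lerD br bi) _; rewrite -[2 * S * _]mulrA mulr_natl mulr2n.
  have S0 : 0 <= S by exact: sqr_ge0.
  apply: lerD; apply: ler_wpM2l => //.
    rewrite /l2Cnorm; apply: l2norm_le => //; first exact: l2C_Re.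
    by move=> k; rewrite (ger0_norm (normc_ge0 _)) normc_Re.
  rewrite /l2Cnorm; apply: l2norm_le => //; first exact: l2C_Im.
  by move=> k; rewrite (ger0_norm (normc_ge0 _)) normc_Im.
- move=> s _; apply/funext => k; rewrite jacobi_ReIm !jacobi_invK//.
  by case: (s k).
- by move=> s; rewrite /jacobiC_inv !jacobi_inv0.
Qed.

End JacobiModel.

End ShiftModels.

(** * The Bargmann space *)

Section BargmannCoordinates.
Variable R : realType.
Local Notation mu := (@lebesgue_measure R).
Local Notation mu2 := (mu \x mu)%E.
Implicit Types (f g : R[i] -> R[i]) (u v s : nat -> R[i]) (z : R[i]).

Definition sqrt_fact n : R[i] := (Num.sqrt (n`!%:R : R))%:C.

Lemma sqrt_fact_gt0 n : 0 < Num.sqrt (n`!%:R : R).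
Proof. by rewrite sqrtr_gt0 ltr0n fact_gt0. Qed.

Lemma sqrt_fact_neq0 n : sqrt_fact n != 0.
Proof. by rewrite /sqrt_fact -[0]/((0 : R)%:C) (inj_eq (@complexI R)) gt_eqF ?sqrt_fact_gt0. Qed.

Lemma sqr_sqrt_fact n : sqrt_fact n * sqrt_fact n = n`!%:R.
Proof. by rewrite /sqrt_fact -rmorphM -expr2 sqr_sqrtr ?ler0n// rmorph_nat. Qed.

Lemma fact_neq0 n : n`!%:R != 0 :> R[i].
Proof. by rewrite -sqr_sqrt_fact mulf_neq0 ?sqrt_fact_neq0. Qed.

Definition taylor u n := u n / sqrt_fact n.

Definition of_coord u : R[i] -> R[i] := power_series (taylor u).

(** Coordinates are read off derivatives at 0, so no integral enters their algebra;
    [bargmann_inner_basis] identifies them with inner products. *)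
Definition coord f n : R[i] := sqrt_fact n / n`!%:R * f^`(n)%classic 0.

Lemma normc_taylor u n : normc (taylor u n) ^+ 2 * n`!%:R = normc (u n) ^+ 2.
Proof.
rewrite /taylor Normc.normcM exprMn -fmorphV normcR.
rewrite -normrX ger0_norm ?sqr_ge0// exprVn sqr_sqrtr ?ler0n//.
by rewrite mulfVK// pnatr_eq0 -lt0n fact_gt0.
Qed.

Lemma fast_decay_taylor u : l2C u -> fast_decay (taylor u).
Proof.
move=> lu rho rho0; have [C hC] := @inv_sqrt_fact_decay R rho rho0.
exists (l2Cnorm u * C) => n.
rewrite /taylor Normc.normcM -fmorphV normcR ger0_norm; last by rewrite invr_ge0 sqrtr_ge0.
rewrite -mulrA; apply: ler_pM; [exact: normc_ge0| |exact: coord_le_l2Cnorm|exact: hC].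
by rewrite invr_ge0 sqrtr_ge0.
Qed.

Lemma coordK u : fast_decay (taylor u) -> coord (of_coord u) = u.
Proof.
move=> hu; apply/funext => n; rewrite /coord derive_power_series0// /taylor.
by field; rewrite fact_neq0 sqrt_fact_neq0.
Qed.

Lemma of_coord_comb (a : R[i]) u v : fast_decay (taylor u) -> fast_decay (taylor v) ->
  of_coord (fun k => a * u k + v k) = fun z => a * of_coord u z + of_coord v z.
Proof.
move=> hu hv; apply/funext => z; apply: power_series_unique.
rewrite (_ : (fun n => _) = fun n => a * psum (taylor u) n z + psum (taylor v) n z).
  by apply: cvgD; [apply: cvgM; [exact: cvg_cst|]|]; exact: power_series_cvg.
apply/funext => n; rewrite /psum mulr_sumr -big_split; apply: eq_bigr => k _ /=.
by rewrite /taylor !mulrDl !mulrA.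
Qed.

Lemma entire_coord f : entire f -> exists2 u, fast_decay (taylor u) & f = of_coord u.
Proof.
move=> /entireP/entire_power_series[a ha fE].
have E : taylor (fun n => a n * sqrt_fact n) = a.
  by apply/funext => n; rewrite /taylor mulfK ?sqrt_fact_neq0.
by exists (fun n => a n * sqrt_fact n); rewrite ?/of_coord E//; exact/funext.
Qed.

Lemma entire_of_coord u : fast_decay (taylor u) -> entire (of_coord u).
Proof. by move=> hu; apply/entireP => z; eexists; exact: cderiv_power_series. Qed.

Lemma bargmannE f : bargmann f <->
  entire f /\ (\int[mu2]_w (gdens f w)%:E < +oo)%E.
Proof. by []. Qed.

Lemma sum_taylor u M : \sum_(n < M) normc (taylor u n) ^+ 2 * n`!%:R =
  \sum_(n < M) normc (u n) ^+ 2.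
Proof. by apply: eq_bigr => n _; exact: normc_taylor. Qed.

Lemma integral_of_coord u : l2C u ->
  (\int[mu2]_w (gdens (of_coord u) w)%:E = (pi * l2Cnorm u ^+ 2)%:E)%E.
Proof.
move=> lu; have hu := fast_decay_taylor lu.
have up : (\int[mu2]_w (gdens (of_coord u) w)%:E <= (pi * l2Cnorm u ^+ 2)%:E)%E.
  apply: integral_power_series_le => // M; rewrite sum_taylor sqr_l2norm//.
  exact: (@ip_ge_sum _ (fun k => normc (u k))).
have lo0 : (0 <= \int[mu2]_w (gdens (of_coord u) w)%:E)%E.
  by apply: integral_ge0 => w _; rewrite lee_fin gdens_ge0.
have lo M : ((pi * \sum_(n < M) normc (u n) ^+ 2)%:E <= \int[mu2]_w (gdens (of_coord u) w)%:E)%E.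
  by rewrite -sum_taylor; exact: integral_power_series_ge.
move: up lo0 lo; case: (integral _ _ _) => [x| |]//.
rewrite !lee_fin => up _ lo; congr (_%:E); apply/eqP; rewrite eq_le up /= sqr_l2norm//.
rewrite mulrC -ler_pdivlMr ?pi_gt0//; apply: ip_le => // n.
rewrite ler_pdivlMr ?pi_gt0// mulrC.
by have := lo n; rewrite lee_fin.
Qed.

Lemma bargmannP f : bargmann f <-> exists2 u, l2C u & f = of_coord u.
Proof.
split=> [[ef fin]|[u lu ->]]; last first.
  apply/bargmannE; split; first exact/entire_of_coord/fast_decay_taylor.
  by rewrite integral_of_coord// ltry.
have [u hu fE] := entire_coord ef; exists u => //.
move: fin; rewrite -/(gdens f) => fin.
have lo M : ((pi * \sum_(n < M) normc (u n) ^+ 2)%:E <= \int[mu2]_w (gdens f w)%:E)%E.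
  by rewrite -sum_taylor fE; exact: integral_power_series_ge.
have lo0 : (0 <= \int[mu2]_w (gdens f w)%:E)%E.
  by apply: integral_ge0 => w _; rewrite lee_fin gdens_ge0.
have fin' : (\int[mu2]_w (gdens f w)%:E < +oo)%E by exact: fin.
move: fin' lo0 lo; case: (integral _ _ _) => [x| |]// _ _ lo.
exists (x / pi) => n; rewrite ler_pdivlMr ?pi_gt0// mulrC.
by have := lo n; rewrite lee_fin.
Qed.

Lemma cmeas_of_coord u : l2C u -> cmeas (of_coord u).
Proof. by move=> lu; apply: cmeas_power_series; exact: fast_decay_taylor. Qed.

Lemma integrable_gdens u : l2C u -> mu2.-integrable setT (EFin \o gdens (of_coord u)).
Proof.
move=> lu; apply/integrableP; split.
  by apply/measurable_EFinP; apply: measurable_gdens; exact: cmeas_of_coord.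
under eq_integral => w _ do rewrite /= ger0_norm ?gdens_ge0//.
by rewrite integral_of_coord// ltry.
Qed.

(** Polarisation reduces the inner product to norms, already computed; the factors 1 and -1 keep the
    shape of [of_coord_comb]. *)
Lemma Re_inner_integrand u v w : l2C u -> l2C v ->
  complex.Re (inner_integrand (of_coord u) (of_coord v) w) =
  4^-1 * (gdens (of_coord (fun k => 1 * u k + v k)) w -
          gdens (of_coord (fun k => -1 * v k + u k)) w).
Proof.
move=> /fast_decay_taylor hu /fast_decay_taylor hv.
rewrite /gdens !of_coord_comb// !normc_sqr /inner_integrand.
case: (of_coord u _) => a b; case: (of_coord v _) => c d; rewrite /=.
by move: (gauss_weight _) => q; field.
Qed.

Lemma Rintegral_Re u v : l2C u -> l2C v ->
  (\int[mu2]_w complex.Re (inner_integrand (of_coord u) (of_coord v) w))%R =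
  pi / 4 * (l2Cnorm (fun k => 1 * u k + v k) ^+ 2 - l2Cnorm (fun k => -1 * v k + u k) ^+ 2).
Proof.
move=> lu lv.
have l1 := l2C_comb 1 lu lv; have l2 := l2C_comb (-1) lv lu.
transitivity (\int[mu2]_w (4^-1 * (gdens (of_coord (fun k => 1 * u k + v k)) w -
    gdens (of_coord (fun k => -1 * v k + u k)) w)))%R.
  by apply: eq_Rintegral => w _; exact: Re_inner_integrand.
rewrite RintegralZl//; last exact: (integrableB measurableT (integrable_gdens l1) (integrable_gdens l2)).
rewrite RintegralB//; try exact: integrable_gdens.
by rewrite /Rintegral !integral_of_coord//=; field.
Qed.

(** Reduces the imaginary part to the real one by multiplying g by i; the added 0 fits
    [of_coord_comb]. *)
Lemma inner_integrand_i f g w :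
  complex.Im (inner_integrand f g w) =
  complex.Re (inner_integrand f (fun z => iC R * g z + 0) w).
Proof.
rewrite /inner_integrand; case: (f _) => a b; case: (g _) => c d; rewrite /=.
by move: (gauss_weight _) => q; ring.
Qed.

(** The two sequences differ in modulus at index n only, so the partial sums of the difference are
    constant beyond n. *)
Lemma l2C_polar_delta u n c : l2C u ->
  l2Cnorm (fun k => 1 * u k + delta_seq n c k) ^+ 2 -
  l2Cnorm (fun k => -1 * delta_seq n c k + u k) ^+ 2 = 4 * complex.Re (u n * conjc c).
Proof.
move=> lu; have [ld _] := l2C_delta n c.
have l1 := l2C_comb 1 lu ld; have l2 := l2C_comb (-1) ld lu.
rewrite !sqr_l2norm//.
have cv := cvgB (ip_cvg l1 l1) (ip_cvg l2 l2).
rewrite -[LHS](cvg_lim _ (cv eventually_filter))//; apply/cvg_lim => //.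
apply: cvg_near_cst; exists n.+1 => // m /= nm.
rewrite !fctE -sumrB (bigD1 (Ordinal nm))//= big1 ?addr0.
  rewrite /delta_seq eqxx -!expr2 !normc_sqr; case: (u n) => a b; case: c {l1 l2 cv ld} => c d /=; ring.
move=> k kn; rewrite /delta_seq ifF; last by apply: contraNF kn => /eqP kE; apply/eqP/val_inj.
by rewrite mul1r addr0 mulr0 add0r subrr.
Qed.

Lemma basis_funE n : basis_fun n = of_coord (delta_seq n 1).
Proof.
apply/funext => z; apply/esym/power_series_unique.
apply: cvg_near_cst; exists n.+1 => // m /= nm.
rewrite /psum (bigD1 (Ordinal nm))//= big1 ?addr0.
  by rewrite /taylor /delta_seq eqxx mul1r mulrC.
move=> k kn; rewrite /taylor /delta_seq ifF ?mul0r//.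
by apply: contraNF kn => /eqP kE; apply/eqP/val_inj.
Qed.

Lemma bargmann_inner_basis u n : l2C u ->
  bargmann_inner (of_coord u) (basis_fun n) = u n.
Proof.
move=> lu; have [l1 _] := @l2C_delta R n 1; have [li _] := @l2C_delta R n (iC R).
have [l0 _] := @l2C_delta R n 0.
have E : (fun z => iC R * of_coord (delta_seq n 1) z + 0) = of_coord (delta_seq n (iC R)).
  have -> : delta_seq n (iC R) = fun k => iC R * delta_seq n 1 k + delta_seq n 0 k.
    by apply/funext => k; rewrite /delta_seq; case: ifP; rewrite ?mulr1 ?mulr0 addr0.
  rewrite of_coord_comb; try exact: fast_decay_taylor.
  apply/funext => z; congr (_ + _); apply/esym/power_series_unique.
  apply: cvg_near_cst; apply: nearW => m.
  by rewrite /psum big1// => k _; rewrite /taylor /delta_seq; case: ifP; rewrite !mul0r.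
rewrite basis_funE /bargmann_inner Rintegral_Re//.
rewrite [X in _ +i* X](_ : _ = \int[mu2]_w
    complex.Re (inner_integrand (of_coord u) (of_coord (delta_seq n (iC R))) w))%R; last first.
  by apply: eq_Rintegral => w _; rewrite inner_integrand_i E.
rewrite Rintegral_Re// !l2C_polar_delta//.
have p0 : (pi : R) != 0 by rewrite gt_eqF ?pi_gt0.
rewrite /iC; case: (u n) => a b; apply/eqP; rewrite eq_complex /=.
by move: (pi) p0 => P p0; apply/andP; split; apply/eqP; field.
Qed.

Lemma bargmann_norm_of_coord u : l2C u -> bargmann_norm (of_coord u) = l2Cnorm u.
Proof.
move=> lu; rewrite /bargmann_norm /bargmann_inner Rintegral_Re//=.
have p0 : (pi : R) != 0 by rewrite gt_eqF ?pi_gt0.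
rewrite mul0r subr0.
have -> : (fun k => 1 * u k + u k) = (fun k => 2 * u k).
  by apply/funext => k; ring.
have -> : (fun k => -1 * u k + u k) = (fun k => 0 * u k).
  by apply/funext => k; ring.
rewrite !l2CnormZ// Normc.normc0 mul0r normc_natr.
have -> : pi^-1 * (pi / 4 * ((2 * l2Cnorm u) ^+ 2 - 0 ^+ 2)) = l2Cnorm u ^+ 2.
  by move: (pi) p0 => P p0; rewrite expr0n subr0; field.
by rewrite sqrtr_sqr ger0_norm// l2norm_ge0.
Qed.

End BargmannCoordinates.

(** * The subspaces B_p and their weights *)

Section BargmannSubspace.
Variables (R : realType) (p : nat).
Local Notation mu := (@lebesgue_measure R).
Implicit Types (f g : R[i] -> R[i]) (u v s : nat -> R[i]) (z : R[i]).

Definition pad s n : R[i] := if (n < p)%N then 0 else s (n - p)%N.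

Lemma pad_add s k : pad s (p + k) = s k.
Proof. by rewrite /pad ltnNge leq_addr /= addKn. Qed.

Lemma pad_lt s n : (n < p)%N -> pad s n = 0.
Proof. by rewrite /pad => ->. Qed.

Lemma pad_shift u : (forall j, (j < p)%N -> u j = 0) -> u = pad (fun k => u (p + k)%N).
Proof.
move=> h; apply/funext => n; rewrite /pad; case: ltnP => [/h //|pn].
by rewrite subnKC.
Qed.

Lemma sum_pad s n : \sum_(k < p + n) normc (pad s k) ^+ 2 = \sum_(k < n) normc (s k) ^+ 2.
Proof.
rewrite big_split_ord /= big1 ?add0r.
  by apply: eq_bigr => k _; rewrite pad_add.
by move=> k _; rewrite pad_lt// Normc.normc0 expr0n.
Qed.

Lemma l2C_pad s : l2C (pad s) <-> l2C s.
Proof.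
split=> -[M hM]; exists M => n; first by rewrite -sum_pad.
apply: le_trans (hM n); rewrite -[leRHS]sum_pad.
by apply: (@sum_homo R (fun k => normc (pad s k) ^+ 2)) => [k|]; rewrite ?sqr_ge0 ?leq_addl.
Qed.

Lemma l2Cnorm_pad s : l2C s -> l2Cnorm (pad s) = l2Cnorm s.
Proof.
move=> ls; have lp := (l2C_pad s).2 ls.
apply/eqP; rewrite eq_le; apply/andP; split.
  apply: (proj2 (l2norm_leP (l2norm_ge0 _) _)) => n.
  rewrite sqr_l2norm//; apply: le_trans (@ip_ge_sum _ (fun k => normc (s k)) n ls).
  rewrite -[leRHS]sum_pad.
  by apply: (@sum_homo R (fun k => normc (pad s k) ^+ 2)) => [k|]; rewrite ?sqr_ge0 ?leq_addl.
apply: (proj2 (l2norm_leP (l2norm_ge0 _) _)) => n.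
by rewrite sqr_l2norm// -sum_pad; exact: (@ip_ge_sum _ (fun k => normc (pad s k))).
Qed.

Definition subcoord f k : R[i] := coord f (p + k).

Definition of_subcoord s : R[i] -> R[i] := of_coord (pad s).

Lemma bargmann_subP f : bargmann_sub p f <-> exists2 s, l2C s & f = of_subcoord s.
Proof.
split=> [[/bargmannP[u lu ->] /= h]|[s ls ->]].
  have hu := fast_decay_taylor lu.
  have u0 j : (j < p)%N -> u j = 0.
    move=> /h; rewrite derive_power_series0// /taylor => /eqP.
    by rewrite !mulf_eq0 invr_eq0 (negbTE (fact_neq0 _ _)) (negbTE (sqrt_fact_neq0 _ _)) orbF => /eqP.
  exists (fun k => u (p + k)%N); last by rewrite /of_subcoord -pad_shift.
  by apply/l2C_pad; rewrite -pad_shift.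
have lp := (l2C_pad s).2 ls.
split; first by apply/bargmannP; exists (pad s).
move=> j jp /=; rewrite derive_power_series0 ?/taylor ?pad_lt ?mul0r ?mulr0//.
exact: fast_decay_taylor.
Qed.

Lemma subcoordK s : l2C s -> subcoord (of_subcoord s) = s.
Proof.
move=> ls; apply/funext => k; rewrite /subcoord coordK ?pad_add//.
by apply: fast_decay_taylor; apply/l2C_pad.
Qed.

Lemma subcoordE f : bargmann_sub p f -> l2C (subcoord f) /\ f = of_subcoord (subcoord f).
Proof. by move=> /bargmann_subP[s ls ->]; rewrite subcoordK. Qed.

Lemma pad_comb (a : R[i]) s t : pad (fun k => a * s k + t k) = fun k => a * pad s k + pad t k.
Proof. by apply/funext => n; rewrite /pad; case: ifP => _; rewrite ?mulr0 ?addr0. Qed.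

Lemma of_subcoord_comb (a : R[i]) s t : l2C s -> l2C t ->
  a *: of_subcoord s + of_subcoord t = of_subcoord (fun k => a * s k + t k).
Proof.
move=> ls lt; rewrite /of_subcoord pad_comb of_coord_comb//;
  by apply: fast_decay_taylor; apply/l2C_pad.
Qed.

Lemma bargmann_subspace : is_subspace (bargmann_sub (R := R) p).
Proof.
split.
  apply/bargmann_subP; exists (fun=> 0).
    by rewrite /l2C; under eq_fun do rewrite Normc.normc0; exact: l2_0.
  apply/funext => z; apply/esym/power_series_unique.
  apply: cvg_near_cst; apply: nearW => n.
  by rewrite /psum big1// => k _; rewrite /taylor /pad; case: ifP; rewrite !mul0r.
move=> a f g /bargmann_subP[s ls ->] /bargmann_subP[t lt ->].
apply/bargmann_subP; exists (fun k => a * s k + t k); first exact: l2C_comb.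
exact: of_subcoord_comb.
Qed.

Lemma bargmann_sub_model :
  [/\ (forall (a : R[i]) f g, bargmann_sub p f -> bargmann_sub p g ->
        subcoord (a *: f + g) = fun k => a * subcoord f k + subcoord g k),
      (forall f, bargmann_sub p f -> bargmann_norm f = l2Cnorm (subcoord f)),
      (forall f g, bargmann_sub p f -> bargmann_sub p g -> subcoord f = subcoord g -> f = g)
    & (forall s, l2C s -> bargmann_sub p (of_subcoord s))].
Proof.
split.
- move=> a f g /bargmann_subP[s ls ->] /bargmann_subP[t lt ->].
  by rewrite of_subcoord_comb// !subcoordK//; exact: l2C_comb.
- move=> f /bargmann_subP[s ls ->]; rewrite subcoordK// bargmann_norm_of_coord ?l2Cnorm_pad//.
  exact/l2C_pad.
- by move=> f g /subcoordE[_ fE] /subcoordE[_ gE] E; rewrite fE gE E.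
- by move=> s ls; apply/bargmann_subP; exists s.
Qed.

Definition weight k : R := omega R (p + k) p.
Local Notation wC := (fun k => (weight k)%:C).

Lemma omegaE n : (p <= n)%N -> omega R n p = Num.sqrt n.+1%:R * (n ^_ p)%:R.
Proof.
move=> pn; rewrite /omega big_mkord ffact_prod natr_prod; congr (_ * _).
by apply: eq_bigr => j _; rewrite natrB// ltnW// (leq_trans (ltn_ord j)).
Qed.

Lemma weightE k : weight k = Num.sqrt (p + k).+1%:R * ((p + k) ^_ p)%:R.
Proof. by rewrite /weight omegaE// leq_addr. Qed.

Lemma weight_ge k : Num.sqrt k.+1%:R <= weight k.
Proof.
rewrite weightE -[leLHS]mulr1 ler_pM ?sqrtr_ge0//.
  by rewrite ler_wsqrtr// ler_nat ltnS leq_addl.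
by rewrite ler1n ffact_gt0 leq_addr.
Qed.

Lemma weight_gt0 k : 0 < weight k.
Proof. by apply: lt_le_trans (weight_ge k); rewrite sqrtr_gt0. Qed.

(** Factor by factor: each factor of the falling factorial, and the argument of the square root, is
    an arithmetic progression in k. *)
Lemma weight_logconcave k : weight k * weight k.+2 <= weight k.+1 ^+ 2.
Proof.
rewrite !weightE !exprMn mulrACA.
apply: ler_pM; [by rewrite mulr_ge0 ?sqrtr_ge0|by rewrite mulr_ge0| |].
  rewrite -sqrtrM// sqr_sqrtr// -[leRHS]ger0_norm// -sqrtr_sqr ler_wsqrtr//.
  by rewrite -natrM -natrX ler_nat; nia.
rewrite -natrM -natrX ler_nat !ffact_prod -big_split expnS expn1 -big_split /=.
by apply: leq_prod => j _; have := ltn_ord j; nia.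
Qed.

(** For p >= 1 the falling factorial is at least k + 1, so the weight is at least (k+1)^(3/2). *)
Lemma weight_summable : (1 <= p)%N -> exists W, forall n, \sum_(k < n) (weight k)^-1 <= W.
Proof.
(* 3 = 1 + 2: the first term, plus the integral of x^(-3/2) from 1 on, here in the telescoping form
   2/sqrt(n+1) - 2/sqrt(n+2). *)
move=> p1; exists 3 => n.
have wge k : k.+1%:R * Num.sqrt k.+1%:R <= weight k.
  rewrite weightE mulrC ler_pM ?sqrtr_ge0//.
    by rewrite ler_wsqrtr// ler_nat ltnS leq_addl.
  rewrite ler_nat; move: p1; case: (p) => // q _.
  elim: q => [|q IH]; first by rewrite ffactn1.
  by rewrite addSn ffactSS; apply: leq_trans IH _; rewrite leq_pmull.
suff h : \sum_(k < n.+1) (weight k)^-1 <= 3 - 2 / Num.sqrt n.+1%:R.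
  apply: le_trans (le_trans h _).
    by rewrite big_ord_recr /= lerDl invr_ge0 ltW// weight_gt0.
  by rewrite gerBl divr_ge0// sqrtr_ge0.
elim: n => [|n IH].
  rewrite big_ord1 sqrtr1 divr1; apply: (@le_trans _ _ 1); last lra.
  rewrite invf_le1 ?weight_gt0//; apply: le_trans (wge 0); rewrite sqrtr1; lra.
rewrite big_ord_recr /=.
have h : (weight n.+1)^-1 <= (n.+2%:R * Num.sqrt n.+2%:R)^-1.
  by rewrite lef_pV2 ?posrE ?weight_gt0// mulr_gt0// sqrtr_gt0.
suff : (n.+2%:R * Num.sqrt n.+2%:R)^-1 <= 2 / Num.sqrt n.+1%:R - 2 / Num.sqrt n.+2%:R :> R.
  by move: IH h; move: (\sum_(_ < _) _) (_^-1) (_^-1) (_ / _) (_ / _) => x1 x2 x3 x4 x5; lra.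
have [a0 b0] : 0 < Num.sqrt (n.+1%:R : R) /\ 0 < Num.sqrt (n.+2%:R : R) by rewrite !sqrtr_gt0.
have ab : Num.sqrt (n.+1%:R : R) <= Num.sqrt (n.+2%:R : R) by rewrite ler_wsqrtr// ler_nat.
have aa : Num.sqrt (n.+1%:R : R) ^+ 2 = n.+1%:R by rewrite sqr_sqrtr.
have bb : Num.sqrt (n.+2%:R : R) ^+ 2 = n.+2%:R by rewrite sqr_sqrtr.
have d1 : Num.sqrt (n.+2%:R : R) ^+ 2 - Num.sqrt (n.+1%:R : R) ^+ 2 = 1.
  by rewrite aa bb -natr1 addrAC subrr add0r.
rewrite -{1}bb; move: (Num.sqrt n.+1%:R) (Num.sqrt n.+2%:R) a0 b0 ab d1 => a b a0 b0 ab d1.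
(* Multiplying the left-hand side by 1 = b^2 - a^2 brings out the common factor b - a. *)
rewrite -mulrBr -[leLHS]mulr1 -{1}d1.
have -> : a^-1 - b^-1 = (b - a) / (a * b) by field; rewrite !gt_eqF.
have -> : (b ^+ 2 * b)^-1 * (b ^+ 2 - a ^+ 2) = (b - a) * ((a + b) / b ^+ 3) by field; rewrite gt_eqF.
rewrite [leRHS]mulrCA; apply: ler_wpM2l; first by rewrite subr_ge0.
rewrite ler_pdivrMr ?exprn_gt0//.
have -> : 2 / (a * b) * b ^+ 3 = 2 * b * (b / a) by field; rewrite !gt_eqF.
have : 1 <= b / a by rewrite ler_pdivlMr// mul1r.
by move: (b / a) => c c1; nra.
Qed.

End BargmannSubspace.

(** * The two operators in coordinates *)

Section Operators.
Variables (R : realType) (p : nat).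
Implicit Types (f : R[i] -> R[i]) (u s a : nat -> R[i]) (z : R[i]).
Local Notation wC := (fun k => (weight R p k)%:C).

Lemma fast_decay_pad a : fast_decay a -> fast_decay (pad p a).
Proof.
move=> ha rho rho0; have [C hC] := ha rho rho0.
have C0 : 0 <= C by have := hC 0; rewrite expr0 mulr1; exact: le_trans (normc_ge0 _).
exists (C / rho ^+ p) => n; have [np|pn] := ltnP n p.
  by rewrite pad_lt// Normc.normc0 mulr_ge0 ?exprn_ge0 ?divr_ge0// ltW// exprn_gt0.
rewrite -(subnKC pn) pad_add; apply: le_trans (hC _) _.
by rewrite exprD mulrA mulfVK// expf_neq0// gt_eqF.
Qed.

Lemma power_series_pad a z : fast_decay a ->
  power_series (pad p a) z = z ^+ p * power_series a z.
Proof.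
move=> ha; have h1 := @power_series_cvg R _ z (fast_decay_pad ha).
have h2 : (fun n => psum (pad p a) (n + p) z) @ \oo --> z ^+ p * power_series a z.
  rewrite (_ : (fun n => _) = fun n => z ^+ p * psum a n z).
    by apply: cvgM; [exact: cvg_cst|exact: power_series_cvg].
  apply/funext => n; rewrite /psum addnC big_split_ord /= big1 ?add0r.
    rewrite mulr_sumr; apply: eq_bigr => k _.
    by rewrite pad_add exprD mulrCA.
  by move=> k _; rewrite pad_lt// mul0r.
apply/power_series_unique.
by rewrite -(cvg_shiftn p).
Qed.

(** Differentiating p + 1 times multiplies the Taylor coefficient by (m+1) m (m-1) ... (m-p+1), with
    m = p + k. Passing to orthonormal coordinates divides by sqrt(m+1), which leaves the weight; the
    factor z^p restores the padding. *)
Lemma Hp_act_coord s : fast_decay (taylor (pad p s)) ->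
  fast_decay (taylor (pad p (jacobi wC (fun=> 0) s))) /\
  Hp_act p (of_subcoord p s) = of_subcoord p (jacobi wC (fun=> 0) s).
Proof.
move=> hs.
pose b := iter p.+1 (@diff_coef R) (taylor (pad p s)).
have hb : fast_decay b.
  by rewrite /b; elim: p.+1 => [//|m IH]; rewrite iterS; exact: fast_decay_diff.
have E : taylor (pad p (jacobi wC (fun=> 0) s)) = pad p b.
  apply/funext => n; rewrite /taylor /pad; case: ltnP => [_|pn]; first by rewrite mul0r.
  rewrite -(subnKC pn) addKn; move: (n - p)%N => k {n pn}.
  rewrite /b iter_diff_coef /jacobi.
  rewrite (_ : (if k is m.+1 then 0 * _ else 0) = 0) ?addr0; last by case: k => [|k]; rewrite ?mul0r.
  rewrite (_ : (k + p.+1 = p + k.+1)%N); last by lia.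
  rewrite /taylor pad_add weightE addnS ffactSS natrM.
  have qq : (Num.sqrt (p + k).+1%:R)%:C * (Num.sqrt (p + k).+1%:R)%:C = (p + k).+1%:R :> R[i].
    by rewrite -rmorphM -expr2 sqr_sqrtr// rmorph_nat.
  have q0 : (Num.sqrt (p + k).+1%:R)%:C != 0 :> R[i].
    by rewrite -[0]/((0 : R)%:C) (inj_eq (@complexI R)) gt_eqF ?sqrtr_gt0.
  have -> : sqrt_fact R (p + k).+1 = (Num.sqrt (p + k).+1%:R)%:C * sqrt_fact R (p + k).
    by rewrite /sqrt_fact factS natrM sqrtrM// rmorphM.
  rewrite -qq rmorphM rmorph_nat.
  by field; rewrite q0 sqrt_fact_neq0.
rewrite E; split; first exact: fast_decay_pad.
apply/funext => z.
by rewrite /Hp_act /of_subcoord {1}/of_coord derive_power_series// -/b /of_coord E power_series_pad.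
Qed.

(** The domain only asks for an image in the whole Bargmann space; the factor z^p puts it in B_p. *)
Lemma op_dom_Hp f : op_dom (Hp R p) f <->
  bargmann_sub p f /\ l2C (jacobi wC (fun=> 0) (subcoord p f)).
Proof.
have key s : l2C s -> bargmann (Hp_act p (of_subcoord p s)) <->
    l2C (jacobi wC (fun=> 0) s).
  move=> ls; have hs : fast_decay (taylor (pad p s)) by apply/fast_decay_taylor/l2C_pad.
  have [hj ->] := Hp_act_coord hs; split; last first.
    by move=> lj; apply/bargmannP; exists (pad p (jacobi wC (fun=> 0) s)) => //; exact/l2C_pad.
  move=> /bargmannP[t lt /(congr1 (@coord R))].
  rewrite !coordK//; last exact: fast_decay_taylor.
  by move=> E; apply/(l2C_pad p); rewrite E.
split=> [[[_ hb] hs]|[hs lj]].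
  split=> //; move: hb; move/bargmann_subP: hs => [s ls ->].
  by rewrite subcoordK// => /key; exact.
split=> //; split; first by case: hs.
move: lj; move/bargmann_subP: hs => [s ls ->].
by rewrite subcoordK// => lj; apply/key.
Qed.

Lemma op_act_Hp f : op_dom (Hp R p) f ->
  bargmann_sub p (Hp_act p f) /\
  subcoord p (Hp_act p f) = jacobi wC (fun=> 0) (subcoord p f).
Proof.
move=> /op_dom_Hp[/bargmann_subP[s ls ->]]; rewrite subcoordK// => lj.
have hs : fast_decay (taylor (pad p s)) by apply/fast_decay_taylor/l2C_pad.
have [_ ->] := Hp_act_coord hs.
by rewrite subcoordK//; split=> //; apply/bargmann_subP; eexists; [exact: lj|].
Qed.

Lemma Hp_sum_coefE s k : l2C s ->
  Hp_sum_coef p (of_subcoord p s) (p + k) = jacobi wC wC s k.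
Proof.
move=> ls; have lp := (l2C_pad p s).2 ls.
rewrite /Hp_sum_coef /Hp_coef /Hp_star_coef /jacobi !bargmann_inner_basis//.
rewrite -addnS pad_add; congr (_ + _).
case: k => [|k]; first by rewrite addn0 ltnn.
by rewrite addnS ltnS leq_addr /= pad_add.
Qed.

Lemma Hp_sum_finite (c : nat -> R) : (forall n, 0 <= c n) ->
  (\sum_(p <= n <oo) (c n)%:E < +oo)%E <->
  exists M, forall n, \sum_(k < n) c (p + k)%N <= M.
Proof.
move=> c0.
have E n : (\sum_(p <= k < p + n) (c k)%:E)%E = (\sum_(k < n) c (p + k)%N)%:E.
  rewrite sumEFin -{1}[p]add0n big_addn addKn big_mkord; congr (_%:E).
  by apply: eq_bigr => k _; rewrite addnC.
have c0' k : (p <= k)%N -> true -> (0 <= (c k)%:E)%E by rewrite lee_fin.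
split=> [fin|[M hM]].
  have ge0 : (0 <= \sum_(p <= n <oo) (c n)%:E)%E by apply: nneseries_ge0 => n _ _; rewrite lee_fin.
  have lo n : ((\sum_(k < n) c (p + k)%N)%:E <= \sum_(p <= n <oo) (c n)%:E)%E.
    by rewrite -E; apply: nneseries_lim_ge => k _ _; rewrite lee_fin.
  move: fin ge0 lo; case: (limn _) => [x| |]// _ _ lo.
  by exists x => n; have := lo n; rewrite lee_fin.
apply: le_lt_trans (ltry M).
apply: lime_le; first by apply: is_cvg_nneseries => n _ _; rewrite lee_fin.
apply: nearW => n; have [np|pn] := leqP n p.
  rewrite big_geq// lee_fin; apply: le_trans (hM 0%N); by rewrite big_ord0.
by rewrite -(subnKC (ltnW pn)) E lee_fin.
Qed.

Lemma op_dom_Hp_sum f : op_dom (Hp_sum R p) f <->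
  bargmann_sub p f /\ l2C (jacobi wC wC (subcoord p f)).
Proof.
have key s : l2C s -> (\sum_(p <= n <oo) (normc (Hp_sum_coef p (of_subcoord p s) n) ^+ 2)%:E < +oo)%E
    <-> l2C (jacobi wC wC s).
  move=> ls; rewrite Hp_sum_finite => [|n]; last exact: sqr_ge0.
  have E n : \sum_(k < n) normc (Hp_sum_coef p (of_subcoord p s) (p + k)) ^+ 2 =
      \sum_(k < n) normc (jacobi wC wC s k) ^+ 2.
    by apply: eq_bigr => k _; rewrite Hp_sum_coefE.
  by split=> -[M hM]; exists M => n; have := hM n; rewrite E.
split=> [[hs fin]|[hs lj]]; have [s ls fE] := (bargmann_subP p f).1 hs.
  by split=> //; rewrite fE subcoordK//; apply/(key s ls); rewrite -fE.
by split=> //; rewrite fE; apply/(key s ls); move: lj; rewrite fE subcoordK.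
Qed.

(** The partial sums in [Hp_sum_act] are literally those of the power series of the image sequence,
    so the pointwise limits agree. *)
Lemma op_act_Hp_sum f : op_dom (Hp_sum R p) f ->
  bargmann_sub p (Hp_sum_act p f) /\
  subcoord p (Hp_sum_act p f) = jacobi wC wC (subcoord p f).
Proof.
move=> /op_dom_Hp_sum[/bargmann_subP[s ls ->]]; rewrite subcoordK// => lj.
suff -> : Hp_sum_act p (of_subcoord p s) = of_subcoord p (jacobi wC wC s).
  by rewrite subcoordK//; split=> //; apply/bargmann_subP; eexists; [exact: lj|].
apply/funext => z; rewrite /Hp_sum_act.
rewrite -[RHS]/(limn (fun N => psum (taylor (pad p (jacobi wC wC s))) N z)).
congr (lim (_ @ \oo)); apply/funext => N.
have z0 k : (k < p)%N -> taylor (pad p (jacobi wC wC s)) k * z ^+ k = 0.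
  by move=> kp; rewrite /taylor pad_lt// !mul0r.
rewrite /psum -(big_mkord xpredT (fun k => taylor (pad p (jacobi wC wC s)) k * z ^+ k)).
have [Np|pN] := leqP N p.
  rewrite [LHS]big_geq// [RHS]big_nat [RHS]big1// => k /andP[_ kN]; apply: z0; exact: leq_trans Np.
rewrite (@big_cat_nat _ _ _ p 0 N)//=; last exact: ltnW.
rewrite [X in _ = X + _]big_nat [X in _ = X + _]big1 ?add0r.
  apply: eq_big_nat => k /andP[pk _].
  rewrite -(subnKC pk) Hp_sum_coefE// /taylor pad_add /basis_fun -/(sqrt_fact R (p + (k - p))).
  by rewrite mulrA mulrAC.
by move=> k /andP[_ kp]; exact: z0.
Qed.

End Operators.

Theorem theorem3p2 (R : realType) :
  (forall p : nat,
     chaotic (bargmann_sub (R:=R) p) (bargmann_norm (R:=R)) (Hp R p)) /\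
  (forall p : nat, (1 <= p)%N ->
     chaotic (bargmann_sub (R:=R) p) (bargmann_norm (R:=R)) (Hp_sum R p)).
Proof.
split=> p => [|p1]; have [eD nrmE e_inj rX] := bargmann_sub_model R p.
  apply: (@weighted_shift_chaotic R (weight R p) (@weight_ge R p) _ _ _
    (@subcoord R p) (@of_subcoord R p)) => //.
  - exact: bargmann_subspace.
  - by move=> f /subcoordE[].
  - exact: subcoordK.
  - exact: op_dom_Hp.
  - exact: op_act_Hp.
apply: (@jacobi_chaotic R (weight R p) (@weight_gt0 R p) (@weight_logconcave R p)
  (weight_summable R p1) _ _ _ (@subcoord R p) (@of_subcoord R p)) => //.
- exact: bargmann_subspace.
- by move=> f /subcoordE[].
- exact: subcoordK.
- exact: op_dom_Hp_sum.
- exact: op_act_Hp_sum.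
Qed.
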